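(* Consider the individual-sum controlled branching process of the context, started from $X_0=i\ge1$. Suppose that for some $p\ge2$, with $q:=p/2$, there is $C<\infty$ such that $\mathbf E|\xi-m|^p<\infty$ and, for all $k\ge1$, $$\mathbf E[N(k)^q]+\mathbf E|N(k)-\lambda Ak|^p\le C(1+k^q),\qquad \mathbf P\{N(k)=0\}+\mathbf E[N(k)^{-q};N(k)>0]\le Ck^{-q}.$$ Fix $\varepsilon>0$. (1) If the induced BPREI is nondecreasing and satisfies condition (H) of the context, then $$\limsup_{n\to\infty}\frac{\mathcal R_n(\varepsilon)}{b^{\mathrm{sc}}_{i,n}(q)}<\infty,\qquad b^{\mathrm{sc}}_{i,n}(q):=\begin{cases}c_q^n,&c_q>\gamma_i,\\ n\gamma_i^n,&c_q=\gamma_i,\\ \gamma_i^n,&c_q<\gamma_i,\end{cases}$$ where $c_q:=\mathbf E[(m\lambda A)^{-q}]$ and $\gamma_i:=\mathbf P(A=1,B=0)\,\bigl(\mathbf P(L=1)\mathbf P(\xi=1)\bigr)^i$. (2) If instead the induced BPREI is critical and satisfies condition (C) of the context, then for each $j=1,2,3$ there is a finite nonnegative constant $K_{i,j}(\varepsilon)$ such that $$\frac{\mathcal R_{n,j}(\varepsilon)}{d_n^-}\longrightarrow K_{i,j}(\varepsilon)\qquad(n\to\infty).$$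
   Context: Notation: $\mathbb N=\{1,2,\dots\}$, $\mathbb N_0=\{0,1,\dots\}$, $\mathbf E[Y;B]=\mathbf E[Y\mathbf 1_B]$; $\mathbf P_i,\mathbf E_i$ (resp. $\mathbf P_\nu,\mathbf E_\nu$) refer to initial state $i$ (resp. initial law $\nu$). Model. $\xi_{n,j}$ are i.i.d. copies of an $\mathbb N_0$-valued $\xi$ with mean $m\in(0,\infty)$. $(A_n,B_n)$, $n\ge0$, are i.i.d. with $A_n\in\mathbb N$, $B_n\in\mathbb N_0$ ($A_n,B_n$ possibly dependent). $L_{n,j}$ are i.i.d. copies of an $\mathbb N_0$-valued $L$ with $\lambda:=\mathbf EL\in(0,\infty)$. The three families and $X_0$ are independent. $C_n(k):=\sum_{j=1}^kL_{n,j}$, $\phi_n(k):=A_nC_n(k)+B_n$, $N_n:=\phi_n(X_n)$, $X_{n+1}:=\sum_{j=1}^{N_n}\xi_{n,j}$. For a generic generation, $N(k):=A\sum_{j=1}^kL_j+B$. Ratio failures. $\mathcal R_{n,1}(\varepsilon):=\mathbf P(X_n>0,|N_n/X_n-\lambda A_n|>\varepsilon)$; $\mathcal R_{n,2}(\varepsilon):=\mathbf P(X_n>0,|X_{n+1}/X_n-m\lambda A_n|>\varepsilon)$; $\mathcal R_{n,3}(\varepsilon):=\mathbf P(X_n>0$ and either $N_n=0$, or $N_n>0$ and $|X_{n+1}/N_n-m|>\varepsilon)$; $\mathcal R_n:=\sum_{j=1}^3\mathcal R_{n,j}$. Induced BPREI. $(X_n)$ is itself a branching process in the i.i.d. random environment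 $(A_n,B_n)$ with immigration: given $(A,B)$, the offspring law $Q$ is the law of $\sum_{r=1}^{AL}\xi_r$, the immigration $\eta$ has the law $G$ of $\sum_{r=1}^B\xi'_r$ (all variables independent given $(A,B)$), and the quenched reproduction mean is $M=m\lambda A$. Put $p_j:=Q(\{j\})$, $h_j:=G(\{j\})$ (random through $(A,B)$), $M_n:=m\lambda A_n$, $S_0:=0$, $S_n:=\sum_{j=0}^{n-1}\log M_j$, $L_n:=\min_{0\le j\le n}S_j$ (not to be confused with $L$), $\tau_n:=\min\{0\le j\le n:S_j=L_n\}$, $d_n^-:=\mathbf P(\tau_n=n)=\mathbf P(\max_{1\le j\le n}S_j<0)$. Condition (H): (H1) $p_0=0$ a.s. and $\mathbf E\log M\in(0,\infty)$; (H2) $\mathbf P(h_0>0,\,0<p_1<1)>0$; (H3) $\mathbf E[M^{-1}\sum_{j\ge1}j\log^+j\,p_j]<\infty$; (H4) $\mathbf EM^\delta<\infty$ for some $\delta>0$; (H5) $\mathbf E\eta<\infty$. Condition (C) (for the initial state $i$), the conjunction of: (SD) $S$ is nondegenerate and oscillating and $\mathbf P(S_n>0)\to\varrho$ for some $\varrho\in(0,1)$; (EL) with $\nu_{i,k}^-:=\mathbf P_i(X_k\in\cdot\mid\tau_k=k)$, there is a probability law $\nu_i^-$ on $\mathbb N_0$ with $\|\nu_{i,k}^--\nu_i^-\|_{\mathrm{TV}}\to0$, and $\mathbf P_{\nu_i^-}(X_{m_0}>0,L_{m_0}\ge0)>0$ for some $m_0\ge0$; (UIM) there is $s_0>0$ such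 that for every $s\in(0,s_0]$ there is a summable sequence $(\overline a_l(s))_{l\ge0}$ with $\sup_\nu\mathbf E_\nu[X_l^{-s};X_l>0,L_l\ge0]\le\overline a_l(s)$ for all $l\ge0$, the supremum being over $\nu\in\{\nu_{i,k}^-:k\ge0\}\cup\{\nu_i^-\}$; (LOC) for every $s\in(0,s_0]$, $(d_n^-)^{-1}\sum_{k=0}^{\lfloor n/2\rfloor}d_k^-\,\overline a_{n-k}(s)\to0$. *)

(* Defs.v *)
From HB Require Import structures.
From mathcomp Require Import all_boot all_order all_algebra.
From mathcomp Require Import all_classical all_reals all_analysis.
From mathcomp Require Import measurable_realfun.

Set Implicit Arguments.
Unset Strict Implicit.
Unset Printing Implicit Defensive.

Import Order.TTheory GRing.Theory Num.Theory.
Import numFieldNormedType.Exports.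

Local Open Scope classical_set_scope.
Local Open Scope ring_scope.

Section Probability.
Context {d : measure_display} {T : measurableType d} {R : realType}.
Variable P : probability T R.

(* The index type carries no order, so a finite subfamily is a duplicate-free
   list of indices. *)
Definition mutually_independent (I : eqType) (F : I -> set (set T)) : Prop :=
  forall (s : seq I) (E : I -> set T), uniq s ->
    (forall k, k \in s -> F k (E k)) ->
    P (\bigcap_(k in [set` s]) E k) = (\prod_(k <- s) P (E k))%E.

(* P( . | D); the junk value P is taken when P D = 0. *)
Definition cond_prob (D : set T) (mD : measurable D) : probability T R :=
  mnormalize (mrestr P mD) P.

End Probability.

(* Every subset of nat is measurable, so no restriction on E is needed. *)
Definition tv_dist (R : realType) (mu nu : set nat -> \bar R) : \bar R :=
  ereal_sup [set `|mu E - nu E|%E | E in [set: set nat]].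

Definition driving_index : eqType := ((nat * nat) + (nat * nat) + nat)%type.

Definition driving_events (d : measure_display) (T : measurableType d)
    (xi ell : nat -> nat -> T -> nat) (ctl : nat -> T -> nat * nat)
    (k : driving_index) : set (set T) :=
  match k with
  | inl (inl (n, j)) => preimage_set_system setT (xi n j) measurable
  | inl (inr (n, j)) => preimage_set_system setT (ell n j) measurable
  | inr n => preimage_set_system setT (ctl n) measurable
  end.

(* The initial state is not part of the data: the process started from the
   state x is [X D x], and an initial law nu independent of the driving
   families is realized on the product space (see [Pinit]).  Individuals are
   numbered from 0. *)
Record cbp (d : measure_display) (T : measurableType d) (R : realType)
    (P : probability T R) := Cbp {
  xi : nat -> nat -> {RV P >-> nat};
  ell : nat -> nat -> {RV P >-> nat};
  ctl : nat -> {RV P >-> (nat * nat)%type};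
  m : R;
  lambda : R;
  xi_id : forall n j, distribution P (xi n j) = distribution P (xi 0 0);
  ell_id : forall n j, distribution P (ell n j) = distribution P (ell 0 0);
  ctl_id : forall n, distribution P (ctl n) = distribution P (ctl 0);
  driving_indep : mutually_independent P
    (driving_events (fun n j => xi n j) (fun n j => ell n j) (fun n => ctl n));
  A_gt0 : forall n w, (0 < (ctl n w).1)%N;
  m_gt0 : 0 < m;
  mean_xi : 'E_P[fun w => (xi 0 0 w)%:R]%E = m%:E;
  lambda_gt0 : 0 < lambda;
  mean_ell : 'E_P[fun w => (ell 0 0 w)%:R]%E = lambda%:E
}.

Section Process.
Context {d : measure_display} {T : measurableType d} {R : realType}.
Context {P : probability T R}.
Variable D : cbp P.

Definition A (n : nat) (w : T) : nat := (ctl D n w).1.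
Definition B (n : nat) (w : T) : nat := (ctl D n w).2.

Definition Lsum (n k : nat) (w : T) : nat := (\sum_(j < k) ell D n j w)%N.
Definition phi (n k : nat) (w : T) : nat := (A n w * Lsum n k w + B n w)%N.

Fixpoint X (x n : nat) (w : T) : nat :=
  if n is n'.+1 then (\sum_(j < phi n' (X x n' w) w) xi D n' j w)%N else x.

Definition N (x n : nat) (w : T) : nat := phi n (X x n w) w.

Definition Rfail1 (x : nat) (eps : R) (n : nat) : R :=
  fine (P [set w | (0 < X x n w)%N /\
    `|(N x n w)%:R / (X x n w)%:R - lambda D * (A n w)%:R| > eps]).

Definition Rfail2 (x : nat) (eps : R) (n : nat) : R :=
  fine (P [set w | (0 < X x n w)%N /\
    `|(X x n.+1 w)%:R / (X x n w)%:R - m D * lambda D * (A n w)%:R| > eps]).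

Definition Rfail3 (x : nat) (eps : R) (n : nat) : R :=
  fine (P [set w | (0 < X x n w)%N /\
    (N x n w = 0%N \/
     ((0 < N x n w)%N /\ `|(X x n.+1 w)%:R / (N x n w)%:R - m D| > eps))]).

Definition Rfail (x : nat) (eps : R) (n : nat) : R :=
  Rfail1 x eps n + Rfail2 x eps n + Rfail3 x eps n.

(* The random laws Q and G, evaluated at A = a and B = b.  As the xi's and the
   L's are independent of (A, B), conditioning on (A, B) = (a, b) amounts to
   freezing these values. *)
Definition offspring_law (a : nat) (E : set nat) : \bar R :=
  P [set w | E (\sum_(r < a * ell D 0 0 w) xi D 0 r w)%N].
Definition immigration_law (b : nat) (E : set nat) : \bar R :=
  P [set w | E (\sum_(r < b) xi D 0 r w)%N].

Definition offspring_pr (j : nat) (w : T) : R := fine (offspring_law (A 0 w) [set j]).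
Definition immigration_pr (j : nat) (w : T) : R := fine (immigration_law (B 0 w) [set j]).

Definition eta (w : T) : nat := (\sum_(r < B 0 w) xi D 0 r w)%N.

Definition M (n : nat) (w : T) : R := m D * lambda D * (A n w)%:R.

Definition walk (n : nat) (w : T) : R := \sum_(j < n) ln (M j w).

(* walk 0 w = 0 is the term j = 0 of the minimum. *)
Definition walk_min (n : nat) (w : T) : R := \big[Num.min/walk 0 w]_(j < n.+1) walk j w.

(* The minimum of walk_min is attained at some j <= n, so the default n is
   harmless. *)
Definition tau (n : nat) (w : T) : nat :=
  (\big[minn/n]_(j < n.+1 | walk j w == walk_min n w) j)%N.

Definition dminus (n : nat) : R := fine (P [set w | tau n w = n]).

Lemma measurable_natdiag (f : nat -> T -> nat) (g : T -> nat) :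
  (forall k, measurable_fun setT (f k)) -> measurable_fun setT g ->
  measurable_fun setT (fun w => f (g w) w).
Proof.
move=> mf mg _ Y _; rewrite setTI.
have -> : (fun w => f (g w) w) @^-1` Y =
    \bigcup_k ((g @^-1` [set k]) `&` (f k @^-1` Y)).
  apply/seteqP; split => [w Yw|w [k _ [/= <-]]//].
  by exists (g w).
apply: bigcup_measurable => k _; apply: measurableI.
  by rewrite -[X in measurable X]setTI; exact: mg.
by rewrite -[X in measurable X]setTI; exact: mf.
Qed.

Lemma measurable_natcomp (f : nat -> nat -> nat) (g h : T -> nat) :
  measurable_fun setT g -> measurable_fun setT h ->
  measurable_fun setT (fun w => f (g w) (h w)).
Proof.
move=> mg mh; apply: (measurable_natdiag (f := fun k w => f k (h w))) => // k.
exact: (measurableT_comp (f := f k)).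
Qed.

Lemma measurable_natsum (f : nat -> T -> nat) (k : nat) :
  (forall j, measurable_fun setT (f j)) ->
  measurable_fun setT (fun w => (\sum_(j < k) f j w)%N).
Proof.
move=> mf; elim: k => [|k IH].
  by under eq_fun do rewrite big_ord0; exact: measurable_cst.
under eq_fun do rewrite big_ord_recr /=.
exact: (measurable_natcomp addn).
Qed.

Lemma measurable_A (n : nat) : measurable_fun setT (A n).
Proof. exact: (measurableT_comp (f := fst)). Qed.

Lemma measurable_B (n : nat) : measurable_fun setT (B n).
Proof. exact: (measurableT_comp (f := snd)). Qed.

Lemma measurable_phi (n k : nat) : measurable_fun setT (phi n k).
Proof.
apply: (measurable_natcomp addn); last exact: measurable_B.
apply: (measurable_natcomp muln); first exact: measurable_A.
exact: (measurable_natsum (f := fun j => ell D n j)).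
Qed.

Lemma measurable_X (x n : nat) : measurable_fun setT (X x n).
Proof.
elim: n => [|n IH] /=; first exact: measurable_cst.
apply: (measurable_natdiag
  (f := fun k w => (\sum_(j < k) xi D n j w)%N) (g := fun w => _)).
  by move=> k; exact: (measurable_natsum (f := fun j => xi D n j)).
by apply: measurable_natdiag => // k; exact: measurable_phi.
Qed.

Lemma measurable_walk (n : nat) : measurable_fun setT (walk n).
Proof.
rewrite /walk; apply: measurable_sum => j.
apply: (measurableT_comp (f := fun a : nat => ln (m D * lambda D * a%:R))) => //.
exact: measurable_A.
Qed.

Lemma measurable_walk_min (n : nat) : measurable_fun setT (walk_min n).
Proof.
rewrite /walk_min; under eq_fun do rewrite -(big_mkord predT (walk ^~ _)).
elim: (index_iota 0 n.+1) => [|j r IH].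
  by under eq_fun do rewrite big_nil; exact: measurable_walk.
under eq_fun do rewrite big_cons /=.
by apply: measurable_minr; first exact: measurable_walk.
Qed.

Lemma measurable_tau (n : nat) : measurable_fun setT (tau n).
Proof.
rewrite /tau.
under eq_fun do rewrite -(big_mkord (fun j => walk j _ == walk_min n _) id).
elim: (index_iota 0 n.+1) => [|j r IH].
  by under eq_fun do rewrite big_nil; exact: measurable_cst.
under eq_fun do rewrite big_cons /=.
apply: measurable_fun_ifT => //.
  by apply: measurable_fun_eqr; [exact: measurable_walk|exact: measurable_walk_min].
exact: (measurable_natcomp minn).
Qed.

Lemma measurable_tau_eq (n : nat) : measurable [set w | tau n w = n].
Proof.
have mY : measurable ([set n] : set nat) by [].
by have := measurable_tau n measurableT mY; rewrite setTI.
Qed.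

Definition popRV (x n : nat) : {mfun T >-> nat} :=
  mfun_Sub (mem_set (measurable_X x n)).

(* The law of X_n under P_i( . | tau_n = n). *)
Definition trapped_law (i n : nat) : probability nat R :=
  distribution (cond_prob P (measurable_tau_eq n)) (popRV i n).

(* P_nu: on this product space the initial state is z.1, with law nu, and the
   driving families are read off z.2. *)
Definition Pinit (nu : probability nat R) : {measure set (nat * T) -> \bar R} :=
  (nu \x P)%E.

Definition nondecreasing_bprei : Prop :=
  forall x n, {ae P, forall w, (X x n w <= X x n.+1 w)%N}.

Definition oscillating : Prop :=
  {ae P, forall w, limn_esup (fun n => (walk n w)%:E) = +oo%E /\
                   limn_einf (fun n => (walk n w)%:E) = -oo%E}.

(* A BPREI is critical when its associated random walk oscillates. *)
Definition critical_bprei : Prop := oscillating.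

Definition logp (x : R) : R := Num.max 0 (ln x).

Definition condH1 : Prop :=
  {ae P, forall w, offspring_pr 0 w = 0} /\
  (0 < 'E_P[fun w => ln (M 0 w)] < +oo)%E.

Definition condH2 : Prop :=
  (0 < P [set w | (0 < immigration_pr 0 w)%R /\
                  (0 < offspring_pr 1 w < 1)%R])%E.

Definition condH3 : Prop :=
  (\int[P]_w ((M 0 w)^-1%:E *
     \sum_(1 <= j <oo) (j%:R * logp j%:R * offspring_pr j w)%:E) < +oo)%E.

Definition condH4 : Prop :=
  exists delta : R, 0 < delta /\ ('E_P[fun w => (M 0 w `^ delta)%R] < +oo)%E.

Definition condH5 : Prop := ('E_P[fun w => (eta w)%:R] < +oo)%E.

Definition condH : Prop := [/\ condH1, condH2, condH3, condH4 & condH5].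

Definition nondegenerate_walk : Prop :=
  forall c : R, (P [set w | ln (M 0 w) = c] < 1)%E.

Definition condSD : Prop :=
  [/\ nondegenerate_walk, oscillating &
    exists rho : R, 0 < rho < 1 /\
      fine (P [set w | 0 < walk n w]) @[n --> \oo] --> rho].

Definition condEL (i : nat) (nu_lim : probability nat R) : Prop :=
  tv_dist (trapped_law i k) nu_lim @[k --> \oo] --> 0%E /\
  exists m0 : nat,
    (0 < Pinit nu_lim [set z | (0 < X z.1 m0 z.2)%N /\
                               (0 <= walk_min m0 z.2)%R])%E.

(* E_nu[X_l^{-s}; X_l > 0, min_{j <= l} S_j >= 0] *)
Definition inv_moment (nu : probability nat R) (s : R) (l : nat) : \bar R :=
  (\int[Pinit nu]_(z in [set z | (0 < X z.1 l z.2)%N /\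
                                 (0 <= walk_min l z.2)%R])
     ((X z.1 l z.2)%:R `^ (- s))%:E)%E.

Definition condUIM (i : nat) (nu_lim : probability nat R)
    (s0 : R) (abar : R -> nat -> R) : Prop :=
  forall s : R, 0 < s <= s0 ->
    cvgn (series (abar s)) /\
    forall l : nat,
      (ereal_sup [set inv_moment nu s l |
                  nu in range (trapped_law i) `|` [set nu_lim]]
       <= (abar s l)%:E)%E.

Definition condLOC (s0 : R) (abar : R -> nat -> R) : Prop :=
  forall s : R, 0 < s <= s0 ->
    (dminus n)^-1 * (\sum_(0 <= k < (n./2).+1) dminus k * abar s (n - k)%N)
      @[n --> \oo] --> (0 : R).

Definition condC (i : nat) : Prop :=
  condSD /\
  exists nu_lim : probability nat R, condEL i nu_lim /\
  exists (s0 : R) (abar : R -> nat -> R),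
    [/\ 0 < s0, condUIM i nu_lim s0 abar & condLOC s0 abar].

(* N(k) of a generic generation is phi 0 k. *)
Definition moment_bounds (p q K : R) : Prop :=
  [/\ ('E_P[fun w => (`|(xi D 0 0 w)%:R - m D| `^ p)%R] < +oo)%E,
      forall k : nat, (0 < k)%N ->
        ('E_P[fun w => ((phi 0 k w)%:R `^ q)%R] +
         'E_P[fun w => (`|(phi 0 k w)%:R - lambda D * (A 0 w)%:R * k%:R| `^ p)%R]
         <= (K * (1 + k%:R `^ q))%:E)%E &
      forall k : nat, (0 < k)%N ->
        (P [set w | phi 0 k w = 0%N] +
         \int[P]_(w in [set w | (0 < phi 0 k w)%N])
           ((phi 0 k w)%:R `^ (- q))%:E
         <= (K * k%:R `^ (- q))%:E)%E].

Definition cq (q : R) : R := fine 'E_P[fun w => (M 0 w `^ (- q))%R]%E.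

Definition gammai (i : nat) : R :=
  fine (P [set w | A 0 w = 1%N /\ B 0 w = 0%N]) *
  (fine (P [set w | ell D 0 0 w = 1%N]) *
   fine (P [set w | xi D 0 0 w = 1%N])) ^+ i.

Definition bsc (i : nat) (q : R) (n : nat) : R :=
  if gammai i < cq q then cq q ^+ n
  else if cq q == gammai i then n%:R * gammai i ^+ n
  else gammai i ^+ n.

End Process.

(* Main.v *)
(* Given X_n = k a failure has probability O(k^-q), by Markov's inequality applied to
   N(k) - lambda A k and to sums of centred offspring numbers (whose p-th moment is
   controlled by a Marcinkiewicz-Zygmund bound); so R_n = O(E[X_n^-q; X_n > 0]).

   (1) In the nondecreasing case E[X_(n+1)^-s | X_n = k] <= (c_s + O(k^-1/4)) k^-s.
   A Lyapunov function equal to k^-s for large k and geometrically decreasing in k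
   below a fixed level gives E X_n^-s = O(r^n) for r > c_s, r >= gamma_i;
   feeding this with s = q + 1/4 into the recursion for s = q gives the three cases.

   (2) In the critical case, splitting at the time tau_n = k of the first minimum
   gives R_n = sum_k d_k g(k, n - k), where g(k, l) is the mean, under the law of
   X_k given tau_k = k, of a bounded function of the initial state; it converges as
   k -> oo and is dominated by the sequence of (UIM).  Hence R_n / d_n converges by
   dominated convergence, (LOC) handling the terms k <= n/2, as soon as
   d_(n-l) / d_n -> 1 for fixed l and d_(n-l) = O(d_n) uniformly in l <= n/2.
   This regularity comes from Spitzer's identity
     n d_n = sum_(j <= n) P(S_j < 0) d_(n-j),
   since P(S_n < 0) -> 1 - rho > 0 and d is nonincreasing. *)

Require Import Defs.
From mathcomp Require Import all_boot all_order all_algebra.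
From mathcomp Require Import all_classical all_reals all_analysis.
From mathcomp Require Import measurable_realfun ring lra zify.

Set Implicit Arguments.
Unset Strict Implicit.
Unset Printing Implicit Defensive.

Import Order.TTheory GRing.Theory Num.Theory.
Import numFieldNormedType.Exports.

Local Open Scope classical_set_scope.
Local Open Scope ring_scope.

(** * Independence of the driving families *)

(** Every driving variable is countable-valued, and this shapes the proof. Independence is
    established once, for disjoint sets of driving slots; afterwards conditioning means freezing a
    variable and summing over its fibres. The same feature yields Spitzer's identity. The walk at
    time n is a function of n and of the integer product of the A's, so path probabilities are
    functions of pairs (length, product), under a convolution that is a finite sum at each index.
    Cutting at the first minimum factors the law of all paths, multiplication by the length is a
    derivation, and the identity is the negative part of a logarithmic derivative. (SD) concerns
    P(S_n > 0) while strict minima involve P(S_n < 0), so P(S_n = 0) -> 0 must be proved: a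
    persistent atom of the product would propagate backwards to too many distinct points. In the
    nondecreasing case the delicate rate is gamma_i itself: the state i is treated apart, because
    all higher states have the strictly smaller holding bound gamma_(i+1). Passing from q to q + 1/4
    lowers c_q strictly because m * lambda > 1, a consequence of (H1) and (H2). *)

Section Independence.
Context {d : measure_display} {T : measurableType d} {R : realType}.
Variable P : probability T R.

(** The class on which the pi-lambda argument of [gen_cylinders_indep] runs, with the other event
    held fixed. *)
Lemma dynkin_indep (E' : set T) : measurable E' ->
  dynkin [set E | measurable E /\ P (E `&` E') = (P E * P E')%E].
Proof.
move=> mE'; split=> [|E [mE PE]|F tF FP] /=.
- by split; [exact: measurableT|rewrite setTI probability_setT mul1e].
- split; first exact: measurableC.
  transitivity (P E' - P E * P E')%E.
    rewrite setIC -setDE measureD// ?(le_lt_trans (probability_le1 _ _)) ?ltry//.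
    by congr (_ - _)%E; rewrite setIC; exact: PE.
  rewrite probability_setC// muleBl ?mul1e//.
  exact: fin_num_measure.
- have mF k : measurable (F k) by case: (FP k).
  split; first exact: bigcup_measurable.
  rewrite setI_bigcupl !measure_bigcup//.
  + rewrite muleC -[P E']fineK ?fin_num_measure// -nneseriesZl//.
    apply: eq_eseriesr => k _; rewrite fineK ?fin_num_measure// [RHS]muleC.
    exact: (FP k).2.
  + by move=> k _; exact: measurableI.
  + exact: trivIset_setIr.
Qed.

Variables (I : eqType) (F : I -> set (set T)).

(** The pi-system generating the information of the slots in [J]. The family [E] is total, its
    values off the list [s] being ignored, so that two cylinders merge by a case distinction on
    membership. *)
Definition cylinders (J : set I) : set (set T) :=
  [set C | exists s E, [/\ uniq s, forall k, k \in s -> J k,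
     forall k, F k (E k) & C = \bigcap_(k in [set` s]) E k]].

Hypothesis indepF : mutually_independent P F.
Hypothesis F_setT : forall k, F k setT.
Hypothesis F_setI : forall k, setI_closed (F k).
Hypothesis F_meas : forall k, F k `<=` measurable.

Lemma cylinders1 (J : set I) k E : J k -> F k E -> cylinders J E.
Proof.
move=> Jk FE.
have E_k : (if k == k then E else setT) = E by rewrite eqxx.
exists [:: k], (fun l => if l == k then E else setT); split=> //.
- by move=> l; rewrite inE => /eqP ->.
- by move=> l; case: eqP => [->|].
- apply/seteqP; split=> [w Ew l /=|w]; first by rewrite inE => /eqP ->; rewrite E_k.
  by move/(_ k); rewrite E_k; apply; rewrite /= inE.
Qed.

Lemma cylinders_meas (J : set I) : cylinders J `<=` measurable.
Proof.
move=> _ [s [E [_ _ FE ->]]]; apply: fin_bigcap_measurable => // k _.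
exact: (F_meas (FE k)).
Qed.

Lemma cylinders_setI (J : set I) : setI_closed (cylinders J).
Proof.
move=> _ _ [s [E [us sJ FE ->]]] [s' [E' [us' sJ' FE' ->]]].
exists (undup (s ++ s')), (fun k => (if k \in s then E k else setT) `&`
  (if k \in s' then E' k else setT)); split.
- exact: undup_uniq.
- by move=> k; rewrite mem_undup mem_cat => /orP[/sJ|/sJ'].
- by move=> k; apply: F_setI; case: ifP.
- apply/seteqP; split=> [w [Ew Ew'] k /=|w Ew].
    by move=> _; split; case: ifPn => // ?; [exact: Ew|exact: Ew'].
  split=> k /= ks.
    have := Ew k; rewrite /= mem_undup mem_cat ks => /(_ isT) [+ _].
    by [].
  have := Ew k; rewrite /= mem_undup mem_cat ks orbT => /(_ isT) [_ +].
  by [].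
Qed.

Lemma sub_cylinders (J J' : set I) : J `<=` J' -> cylinders J `<=` cylinders J'.
Proof.
by move=> JJ' _ [s [E [us sJ FE ->]]]; exists s, E; split=> // k /sJ/JJ'.
Qed.

Lemma gen_cylinders_meas (J : set I) : <<s cylinders J >> `<=` measurable.
Proof.
apply: smallest_sub; last exact: cylinders_meas.
exact: sigma_algebra_measurable.
Qed.

(** Disjointness of [J] and [J'] makes [s ++ s'] duplicate-free, so the two cylinders form one
    finite intersection and the product over the merged list splits. *)
Lemma cylinders_indep (J J' : set I) C C' : J `&` J' = set0 ->
  cylinders J C -> cylinders J' C' -> P (C `&` C') = (P C * P C')%E.
Proof.
move=> JJ' [s [E [us sJ FE ->]]] [s' [E' [us' sJ' FE' ->]]].
have dis k : k \in s' -> (k \in s) = false.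
  move=> ks'; apply/negP => ks.
  have : (J `&` J') k by split; [exact: sJ|exact: sJ'].
  by rewrite JJ'.
have -> : \bigcap_(k in [set` s]) E k `&` \bigcap_(k in [set` s']) E' k =
    \bigcap_(k in [set` s ++ s']) (if k \in s then E k else E' k).
  apply/seteqP; split=> [w [Ew Ew'] k /=|w Ew].
    by rewrite mem_cat; case: ifPn => [? _|_ /= ?]; [exact: Ew|exact: Ew'].
  split=> k /= ks.
    by have := Ew k; rewrite /= mem_cat ks /=; apply.
  by have := Ew k; rewrite /= mem_cat ks (dis _ ks) orbT; apply.
rewrite !indepF//; last 2 first.
  by rewrite cat_uniq us us' andbT; apply/hasPn => k /dis ->.
  by move=> k _; case: ifP.
rewrite big_cat /=; congr (_ * _)%E; rewrite [LHS]big_seq_cond [RHS]big_seq_cond;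
  apply: eq_bigr => k /andP[ks _]; rewrite ?ks//.
by rewrite (dis _ ks).
Qed.

(** The pi-lambda theorem applied twice: on the [J'] side against a fixed cylinder of [J], then on
    the [J] side against the event obtained. *)
Lemma gen_cylinders_indep (J J' : set I) E E' : J `&` J' = set0 ->
  <<s cylinders J >> E -> <<s cylinders J' >> E' ->
  P (E `&` E') = (P E * P E')%E.
Proof.
move=> JJ'.
have step K K' C' : K `&` K' = set0 -> measurable C' ->
    (forall C, cylinders K C -> P (C `&` C') = (P C * P C')%E) ->
    forall C, <<s cylinders K >> C -> P (C `&` C') = (P C * P C')%E.
  move=> KK' mC' CC' C sC.
  suff sub : <<s cylinders K >> `<=`
    [set E | measurable E /\ P (E `&` C') = (P E * P C')%E] by have [] := sub _ sC.
  apply: lambda_system_subset => //; first exact: cylinders_setI.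
    by apply/dynkin_lambda_system; exact: dynkin_indep.
  by move=> B cB; split; [exact: (cylinders_meas cB)|exact: CC'].
move=> sE sE'.
have mE' := gen_cylinders_meas sE'.
apply: (step J J') => // C cC; rewrite setIC muleC.
apply: (step J' J) => //; [by rewrite setIC|exact: (cylinders_meas cC)|].
by move=> C'' cC''; rewrite setIC muleC; exact: (cylinders_indep JJ').
Qed.

End Independence.

Section DiscreteMeasurability.
Context {d : measure_display} {T : measurableType d} {R : realType}.
Variable P : probability T R.
Variables (I : eqType) (F : I -> set (set T)).

Hypothesis indepF : mutually_independent P F.
Hypothesis F_setT : forall k, F k setT.
Hypothesis F_setI : forall k, setI_closed (F k).
Hypothesis F_meas : forall k, F k `<=` measurable.

(** Measurability for the power set of the target. The variables involved have countable range, so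
    no sigma-algebra on [S] has to be carried and postcomposition with any map is free. *)
Definition dmeas (J : set I) (S : Type) (f : T -> S) : Prop :=
  forall Y : set S, <<s cylinders F J >> (f @^-1` Y).

Lemma dmeas_meas J (S : Type) (f : T -> S) Y : dmeas J f -> measurable (f @^-1` Y).
Proof. by move=> /(_ Y); exact: gen_cylinders_meas. Qed.

Lemma sub_dmeas J J' (S : Type) (f : T -> S) : dmeas J f -> J `<=` J' -> dmeas J' f.
Proof.
move=> mf JJ' Y; apply: sub_sigma_algebra2 (mf Y).
exact: sub_cylinders.
Qed.

Lemma dmeas_cst J (S : Type) (s : S) : dmeas J (fun=> s).
Proof.
move=> Y; have [Ys|Ys] := pselect (Y s).
  rewrite (_ : _ @^-1` _ = setT); last by apply/seteqP; split.
  exact: (@measurableT _ (g_sigma_algebraType (cylinders F J))).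
rewrite (_ : _ @^-1` _ = set0); last by apply/seteqP; split.
exact: (@measurable0 _ (g_sigma_algebraType (cylinders F J))).
Qed.

Lemma dmeas_comp J (S S' : Type) (g : S -> S') (f : T -> S) :
  dmeas J f -> dmeas J (fun w => g (f w)).
Proof. by move=> mf Y; exact: (mf (g @^-1` Y)). Qed.

Lemma preimage_diag (S : countType) (S' : Type) (f : T -> S) (h : S -> T -> S') Y :
  (fun w => h (f w) w) @^-1` Y =
  \bigcup_n (if @unpickle S n is Some s then (f @^-1` [set s]) `&` (h s @^-1` Y)
             else set0).
Proof.
apply/seteqP; split=> [w /= Yw|w [n _]].
  by exists (pickle (f w)) => //; rewrite pickleK.
by case: unpickle => // s [/= <-].
Qed.

(** A random index with countably many values is harmless, since the preimage splits over these
    values. Random sums and iterated states are all handled this way. *)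
Lemma dmeas_diag J (S : countType) (S' : Type) (f : T -> S) (h : S -> T -> S') :
  dmeas J f -> (forall s, dmeas J (h s)) -> dmeas J (fun w => h (f w) w).
Proof.
move=> mf mh Y; rewrite preimage_diag.
apply: (@bigcup_measurable _ (g_sigma_algebraType (cylinders F J))) => n _.
case: unpickle => [s|]; last exact: measurable0.
by apply: measurableI; [exact: mf|exact: mh].
Qed.

Lemma dmeas_pair J (S : countType) (S' : Type) (f : T -> S) (g : T -> S') :
  dmeas J f -> dmeas J g -> dmeas J (fun w => (f w, g w)).
Proof.
move=> mf mg; apply: (dmeas_diag (h := fun s w => (s, g w))) => // s.
exact: (dmeas_comp (pair s)).
Qed.

Lemma dmeas_sum J (f : nat -> T -> nat) k : (forall j, (j < k)%N -> dmeas J (f j)) ->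
  dmeas J (fun w => (\sum_(j < k) f j w)%N).
Proof.
move=> mf; have : forall l, (l <= k)%N -> dmeas J (fun w => (\sum_(j < l) f j w)%N).
  elim=> [|l IH] lk; first by under eq_fun do rewrite big_ord0; exact: dmeas_cst.
  under eq_fun do rewrite big_ord_recr /=.
  apply: (dmeas_comp (fun z => z.1 + z.2)%N (f := fun w => (_, _))).
  by apply: dmeas_pair; [exact: IH (ltnW lk)|exact: mf].
exact.
Qed.

Lemma dmeas_indep J J' (S S' : Type) (f : T -> S) (g : T -> S') Y Y' :
  J `&` J' = set0 -> dmeas J f -> dmeas J' g ->
  P (f @^-1` Y `&` g @^-1` Y') = (P (f @^-1` Y) * P (g @^-1` Y'))%E.
Proof.
move=> JJ' mf mg.
exact: (gen_cylinders_indep indepF F_setT F_setI F_meas JJ' (mf Y) (mg Y')).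
Qed.

End DiscreteMeasurability.

(** * Splitting along the fibres of a countable-valued variable *)

Section CountablePartition.
Context {d : measure_display} {T : measurableType d} {R : realType}.
Variable P : probability T R.
Local Open Scope ereal_scope.

Lemma fibers_cover (V : T -> nat) (E : set T) :
  E = \bigcup_n (E `&` V @^-1` [set n]).
Proof. by apply/seteqP; split=> [w Ew|w [n _ []]//]; exists (V w). Qed.

Lemma fibers_trivIset (V : T -> nat) (E : set T) :
  trivIset setT (fun n => E `&` V @^-1` [set n]).
Proof.
by apply/trivIsetP => i j _ _ /eqP ij; apply/seteqP; split=> // w [[_ /= Vi] [_ /= Vj]];
  case: ij; rewrite -Vi.
Qed.

Lemma prob_fibers_nat (V : T -> nat) (E : set T) :
  (forall n, measurable (V @^-1` [set n])) -> measurable E ->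
  P E = \sum_(n <oo) P (E `&` V @^-1` [set n]).
Proof.
move=> mV mE; rewrite {1}(fibers_cover V E) measure_bigcup//.
- by apply: eq_eseriesl => n; rewrite in_setT.
- by move=> n _; exact: measurableI.
- exact: fibers_trivIset.
Qed.

Lemma integral_fibers_nat (V : T -> nat) (E : set T) (f : T -> \bar R) :
  (forall n, measurable (V @^-1` [set n])) -> measurable E ->
  measurable_fun E f -> (forall w, E w -> 0 <= f w) ->
  \int[P]_(w in E) f w = \sum_(n <oo) \int[P]_(w in E `&` V @^-1` [set n]) f w.
Proof.
move=> mV mE mf f0; rewrite {1}(fibers_cover V E) ge0_integral_bigcup//.
- by move=> n; exact: measurableI.
- by rewrite -fibers_cover.
- by move=> w; rewrite -fibers_cover; exact: f0.
- exact: fibers_trivIset.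
Qed.

(** [pickle_inv] is an exact partial inverse of [pickle], so each fibre of the encoded variable is a
    fibre of [V] or empty. This reduces sums over a countable type to series over [nat]. *)
Lemma pickle_fiber (S : countType) (V : T -> S) n :
  (fun w => pickle (V w)) @^-1` [set n] =
  if @pickle_inv S n is Some s then V @^-1` [set s] else set0.
Proof.
case E : (@pickle_inv S n) => [s|].
  have := @pickle_invK S n; rewrite /oapp E => <-; apply/seteqP; split=> [w /=|w /= -> //].
  by move/(pcan_inj (@pickleK_inv S)).
by apply/seteqP; split=> // w /= Vw; move: E; rewrite -Vw pickleK_inv.
Qed.

Lemma measurable_discrete (S : countType) (V : T -> S) d' (T' : measurableType d')
    (g : S -> T') :
  (forall s, measurable (V @^-1` [set s])) -> measurable_fun setT (fun w => g (V w)).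
Proof.
move=> mV _ Y _; rewrite setTI.
rewrite (fibers_cover (fun w => pickle (V w)) (_ @^-1` _)).
apply: bigcup_measurable => n _; rewrite pickle_fiber.
case: pickle_inv => [s|]; last by rewrite setI0.
have [Ys|Ys] := pselect (Y (g s)).
  rewrite (_ : _ `&` _ = V @^-1` [set s])//.
  by apply/seteqP; split=> [w []//|w /= Vw]; split=> //=; rewrite Vw.
rewrite (_ : _ `&` _ = set0)//.
by apply/seteqP; split=> [w /= [+ Vw]|//]; rewrite Vw.
Qed.

Lemma integral_discrete (S : countType) (V : T -> S) (E : set T) (g : S -> \bar R) :
  (forall s, measurable (V @^-1` [set s])) -> measurable E -> (forall s, 0 <= g s) ->
  \int[P]_(w in E) g (V w) = \sum_(n <oo)
    (if @pickle_inv S n is Some s then g s * P (E `&` V @^-1` [set s]) else 0).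
Proof.
move=> mV mE g0; rewrite (integral_fibers_nat (V := fun w => pickle (V w)))//.
- apply: eq_eseriesr => n _; rewrite pickle_fiber.
  case: pickle_inv => [s|]; last by rewrite setI0 integral_set0.
  rewrite -integral_cst; last exact: measurableI.
  by apply: eq_integral => w; rewrite inE => -[_ /= ->].
- by move=> n; rewrite pickle_fiber; case: pickle_inv.
- apply: measurable_funTS; exact: measurable_discrete.
Qed.

Lemma prob_eq_fibers (S : countType) (V V' : T -> S) (E E' : set T) :
  (forall s, measurable (V @^-1` [set s])) -> (forall s, measurable (V' @^-1` [set s])) ->
  measurable E -> measurable E' ->
  (forall s, P (E `&` V @^-1` [set s]) = P (E' `&` V' @^-1` [set s])) ->
  P E = P E'.
Proof.
move=> mV mV' mE mE' EE'.
rewrite (prob_fibers_nat (V := fun w => pickle (V w)))//; last first.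
  by move=> n; rewrite pickle_fiber; case: pickle_inv.
rewrite [RHS](prob_fibers_nat (V := fun w => pickle (V' w)))//; last first.
  by move=> n; rewrite pickle_fiber; case: pickle_inv.
apply: eq_eseriesr => n _; rewrite !pickle_fiber.
by case: pickle_inv => [s|]; [exact: EE'|rewrite !setI0].
Qed.

Definition eqlaw (S : Type) (f g : T -> S) : Prop :=
  forall Y : set S, P (f @^-1` Y) = P (g @^-1` Y).

Lemma integral_eqlaw (S : countType) (V V' : T -> S) (g : S -> \bar R) :
  (forall s, measurable (V @^-1` [set s])) -> (forall s, measurable (V' @^-1` [set s])) ->
  (forall s, 0 <= g s) -> eqlaw V V' ->
  \int[P]_w g (V w) = \int[P]_w g (V' w).
Proof.
move=> mV mV' g0 VV'; rewrite !integral_discrete//.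
by apply: eq_eseriesr => n _; case: pickle_inv => // s; rewrite !setTI VV'.
Qed.

End CountablePartition.

Section Freezing.
Context {d : measure_display} {T : measurableType d} {R : realType}.
Variable P : probability T R.
Variables (I : eqType) (F : I -> set (set T)).
Local Open Scope ereal_scope.

Hypothesis indepF : mutually_independent P F.
Hypothesis F_setT : forall k, F k setT.
Hypothesis F_setI : forall k, setI_closed (F k).
Hypothesis F_meas : forall k, F k `<=` measurable.

Let dm_meas J (S : Type) (f : T -> S) Y (mf : dmeas F J f) :
  measurable (f @^-1` Y) := dmeas_meas F_meas Y mf.

Lemma prob_diag_fiber (S : countType) (S' : Type) J J' (f : T -> S)
    (h : S -> T -> S') Y s : J `&` J' = set0 ->
  dmeas F J f -> (forall s, dmeas F J' (h s)) ->
  P ((fun w => h (f w) w) @^-1` Y `&` f @^-1` [set s]) =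
  P (f @^-1` [set s]) * P (h s @^-1` Y).
Proof.
move=> JJ' mf mh; rewrite -(dmeas_indep indepF F_setT F_setI F_meas _ _ JJ' mf (mh s)).
by congr (P _); apply/seteqP; split=> w /= [] => [Yw fw|fw Yw]; split=> //;
  move: Yw; rewrite fw.
Qed.

(** On each fibre [f = s] the probability factors, so the joint law depends only on the law of [f]
    and on those of the [h s]. This carries equality of laws from single variables to whole blocks
    of generations. *)
Lemma eqlaw_diag (S : countType) (S' : Type) J J' K K' (f g : T -> S)
    (h k : S -> T -> S') : J `&` J' = set0 -> K `&` K' = set0 ->
  dmeas F J f -> (forall s, dmeas F J' (h s)) ->
  dmeas F K g -> (forall s, dmeas F K' (k s)) ->
  eqlaw P f g -> (forall s, eqlaw P (h s) (k s)) ->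
  eqlaw P (fun w => (f w, h (f w) w)) (fun w => (g w, k (g w) w)).
Proof.
move=> JJ' KK' mf mh mg mk fg hk Y.
have dJ : dmeas F (J `|` J') (fun w => (f w, h (f w) w)).
  have mf' : dmeas F (J `|` J') f by refine (sub_dmeas mf _) => ?; left.
  apply: dmeas_pair => //; apply: dmeas_diag => // s.
  by refine (sub_dmeas (mh s) _) => ?; right.
have dK : dmeas F (K `|` K') (fun w => (g w, k (g w) w)).
  have mg' : dmeas F (K `|` K') g by refine (sub_dmeas mg _) => ?; left.
  apply: dmeas_pair => //; apply: dmeas_diag => // s.
  by refine (sub_dmeas (mk s) _) => ?; right.
apply: (prob_eq_fibers (V := f) (V' := g)).
- by move=> s; exact: dm_meas mf.
- by move=> s; exact: dm_meas mg.
- exact: dm_meas dJ.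
- exact: dm_meas dK.
move=> s; rewrite (prob_diag_fiber (h := fun s w => (s, h s w)) _ _ JJ')//; last first.
  by move=> s'; exact: dmeas_comp (mh s').
rewrite (prob_diag_fiber (h := fun s w => (s, k s w)) _ _ KK')//; last first.
  by move=> s'; exact: dmeas_comp (mk s').
by rewrite fg; congr (_ * _); exact: (hk s (fun y => Y (s, y))).
Qed.

(** Elementary conditioning: on the fibre [f = n] the index is constant, and [h n] is independent of
    that fibre. *)
Lemma prob_freeze (S' : Type) J J' (f : T -> nat) (h : nat -> T -> S') Y :
  J `&` J' = set0 -> dmeas F J f -> (forall n, dmeas F J' (h n)) ->
  P ((fun w => h (f w) w) @^-1` Y) =
  \sum_(n <oo) P (f @^-1` [set n]) * P (h n @^-1` Y).
Proof.
move=> JJ' mf mh; rewrite (prob_fibers_nat P (V := f)).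
- by apply: eq_eseriesr => n _; rewrite (prob_diag_fiber _ _ JJ').
- by move=> n; exact: dm_meas mf.
- suff : dmeas F (J `|` J') (fun w => h (f w) w) by exact: dm_meas.
  apply: dmeas_diag; first by refine (sub_dmeas mf _) => ?; left.
  by move=> s; refine (sub_dmeas (mh s) _) => ?; right.
Qed.

Lemma integral_freeze (S : countType) J J' (f : T -> nat) (h : nat -> T -> S)
    (G : nat -> S -> \bar R) : J `&` J' = set0 -> (forall n s, 0 <= G n s) ->
  dmeas F J f -> (forall n, dmeas F J' (h n)) ->
  \int[P]_w G (f w) (h (f w) w) =
  \sum_(n <oo) P (f @^-1` [set n]) * \int[P]_w G n (h n w).
Proof.
move=> JJ' G0 mf mh.
have mff n : measurable (f @^-1` [set n]) by exact: dm_meas mf.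
have mhh n s : measurable (h n @^-1` [set s]) by exact: dm_meas (mh n).
rewrite (integral_fibers_nat P (V := f))//; last first.
  have dJ : dmeas F (J `|` J') (fun w => (f w, h (f w) w)).
    have mf' : dmeas F (J `|` J') f by refine (sub_dmeas mf _) => ?; left.
    apply: dmeas_pair => //; apply: dmeas_diag => // s.
    by refine (sub_dmeas (mh s) _) => ?; right.
  apply: (@measurable_discrete _ _ _ (fun w => (f w, h (f w) w)) _ _
    (fun z => G z.1 z.2)) => s.
  exact: dm_meas dJ.
apply: eq_eseriesr => n _; rewrite setTI.
transitivity (\int[P]_(w in f @^-1` [set n]) G n (h n w)).
  by apply: eq_integral => w; rewrite inE => /= ->.
rewrite !integral_discrete// -[P (f @^-1` [set n])]fineK ?fin_num_measure//.
rewrite -nneseriesZl; last first.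
  by move=> k _; case: pickle_inv => // s; rewrite mule_ge0.
apply: eq_eseriesr => k _; case: pickle_inv => [s|]; last by rewrite mule0.
rewrite fineK ?fin_num_measure// setTI muleCA; congr (_ * _).
exact: (dmeas_indep indepF F_setT F_setI F_meas _ _ JJ' mf (mh n)).
Qed.

End Freezing.

(** * Elementary inequalities *)

Section PowerInequalities.
Context {R : realType}.
Implicit Types x y t p : R.

(** Both signs start from [expR x <= 1 + x * expR x], that is [expR (- x) >= 1 - x]. The product
    [x * expR x] is then bounded by the same inequality for [x >= 0] and by [expR x >= 1 + x] for
    [x < 0]. *)
Lemma expR_le_quadratic x : expR x <= 1 + x + x ^+ 2 * expR `|x|.
Proof.
have e0 := expR_gt0 x.
have h : expR x * (1 - x) <= 1.
  have := expR_ge1Dx (- x); rewrite expRN => h.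
  have := ler_wpM2l (ltW e0) h; rewrite divff ?gt_eqF//.
have [x0|x0] := lerP 0 x.
  by have := ler_wpM2l x0 h; rewrite (ger0_norm x0); lra.
have e1 : 1 <= expR `|x|.
  by have := expR_ge1Dx `|x|; have := normr_ge0 x; lra.
have h1 := ler_wnM2l (ltW x0) (expR_ge1Dx x).
have h2 := ler_wpM2l (sqr_ge0 x) e1.
lra.
Qed.

(** A second-order expansion at 0. For [|t| <= 1/2] it comes from [(1 + t)^p <= expR (p * t)], for
    larger [|t|] from crude comparison; the summands of [c] serve these two ranges. *)
Lemma powR_norm1D_le p : 2 <= p -> exists2 c : R, 1 <= c &
  forall t, `|1 + t| `^ p <= 1 + p * t + c * (t ^+ 2 + `|t| `^ p).
Proof.
move=> p2; pose c := 1 + 2 * p + p ^+ 2 * expR p + 3 `^ p.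
have e0 : 0 <= p ^+ 2 * expR p by rewrite mulr_ge0 ?expR_ge0 ?sqr_ge0.
have t0 : 0 <= (3 : R) `^ p := powR_ge0 _ _.
have c1 : 1 <= c by rewrite /c; lra.
exists c => // t.
have tp0 : 0 <= `|t| `^ p := powR_ge0 _ _.
have s0 := sqr_ge0 t.
have [tle|tgt] := lerP `|t| (2^-1).
  have t1 : 0 < 1 + t by move: tle; rewrite ler_norml => /andP[]; lra.
  rewrite gtr0_norm// -(lnK t1) -expRM.
  apply: (@le_trans _ _ (expR (p * t))).
    rewrite ler_expR mulrC ler_wpM2l//; first by lra.
    by apply: le_ln1Dx; lra.
  apply: le_trans (expR_le_quadratic _) _.
  have : expR `|p * t| <= expR p.
    rewrite ler_expR normrM ger0_norm; last by lra.
    by rewrite ler_piMr//; lra.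
  move=> h; rewrite -addrA -[leRHS]addrA lerD2l lerD2l exprMn.
  have h1 : p ^+ 2 * t ^+ 2 * expR `|p * t| <= p ^+ 2 * t ^+ 2 * expR p.
    by rewrite ler_wpM2l// mulr_ge0// sqr_ge0.
  apply: le_trans h1 _.
  rewrite mulrDr; apply: ler_wpDr; first by rewrite mulr_ge0//; lra.
  rewrite mulrAC ler_wpM2r//; rewrite /c; lra.
(* Here [1 < 2 |t|], whence [|1 + t| <= 3 |t|]; and [|t| <= 2 t^2] lets the quadratic term absorb
   [p * t], which may be negative. *)
have h3 : `|1 + t| `^ p <= 3 `^ p * `|t| `^ p.
  rewrite -powRM//; apply: ge0_ler_powR; rewrite ?nnegrE ?mulr_ge0//; first by lra.
  by apply: le_trans (ler_normD _ _) _; rewrite normr1; lra.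
have h2 : `|t| <= 2 * t ^+ 2 by rewrite -(real_normK (num_real t)); nra.
have ht : - t <= `|t| by rewrite -normrN ler_norm.
have : 0 <= p * (t + 2 * t ^+ 2) by rewrite mulr_ge0; lra.
have : 0 <= (1 + p ^+ 2 * expR p + 3 `^ p) * t ^+ 2 by rewrite mulr_ge0//; lra.
have : 0 <= (1 + 2 * p + p ^+ 2 * expR p) * `|t| `^ p by rewrite mulr_ge0//; lra.
rewrite /c; lra.
Qed.

(** The previous bound rescaled by [x]. The slope [l] depends on [x] but not on [y], so the linear
    term integrates to 0 when [y] is centred, while [c] is uniform in [x]. *)
Lemma powR_normD_le p : 2 <= p -> exists2 c : R, 1 <= c &
  forall x, exists l : R, forall y,
    `|x + y| `^ p <= `|x| `^ p + l * y + c * (`|x| `^ (p - 2) * y ^+ 2 + `|y| `^ p).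
Proof.
move=> p2; have [c c1 h] := powR_norm1D_le p2; exists c => // x.
have [->|x0] := eqVneq x 0.
  exists 0 => y; rewrite add0r mul0r addr0 normr0.
  have y0 : 0 <= `|y| `^ p := powR_ge0 _ _.
  have : 0 <= (0 : R) `^ p := powR_ge0 _ _.
  have : 0 <= (0 : R) `^ (p - 2) * y ^+ 2 by rewrite mulr_ge0 ?powR_ge0 ?sqr_ge0.
  nra.
exists (`|x| `^ p * p / x) => y.
have nx0 : 0 < `|x| by rewrite normr_gt0.
have -> : `|x + y| `^ p = `|x| `^ p * `|1 + y / x| `^ p.
  by rewrite -powRM// -normrM mulrDr mulr1 mulrCA divff// mulr1.
have /(ler_wpM2l (powR_ge0 `|x| p)) := h (y / x).
move=> /le_trans; apply.
have -> : `|x| `^ (p - 2) = `|x| `^ p / x ^+ 2.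
  rewrite powRB ?(normr_eq0, x0, implybT)//.
  by rewrite (powR_mulrn 2)// real_normK ?num_real.
have -> : `|y| `^ p = `|x| `^ p * `|y / x| `^ p.
  by rewrite -powRM// -normrM mulrCA divff// mulr1.
by rewrite le_eqVlt; apply/orP; left; apply/eqP; field.
Qed.

(** Case split at [x ^ 2 = t]. In [xisum_moment] the free parameter [t] is proportional to the
    number of summands. *)
Lemma powR_interpolate p x (t : R) : 2 <= p -> 0 < t -> 0 <= x ->
  x `^ (p - 2) <= t^-1 * x `^ p + t `^ (p / 2 - 1).
Proof.
move=> p2 t0 x0; have [xt|xt] := lerP t (x ^+ 2).
  rewrite -[leLHS]addr0 lerD ?powR_ge0//.
  have xp : 0 < x by rewrite lt_neqAle x0 andbT; apply: contraTneq xt => <-; rewrite expr0n /=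
    -ltNge.
  rewrite powRB ?(gt_eqF xp) ?implybT// (powR_mulrn 2)// mulrC ler_wpM2r ?powR_ge0//.
  by rewrite lef_pV2// posrE exprn_gt0.
rewrite -[leLHS]add0r lerD// ?mulr_ge0 ?powR_ge0 ?invr_ge0 ?(ltW t0)//.
have -> : x `^ (p - 2) = (x ^+ 2) `^ (p / 2 - 1).
  by rewrite -powR_mulrn// -powRrM; congr (_ `^ _); field.
by apply: ge0_ler_powR; rewrite ?nnegrE ?sqr_ge0 ?(ltW t0) ?(ltW xt)//; lra.
Qed.

Lemma sqr_le_1DpowR p x : 2 <= p -> x ^+ 2 <= 1 + `|x| `^ p.
Proof.
move=> p2; rewrite -(real_normK (num_real x)).
have x0 := normr_ge0 x; have xp := powR_ge0 `|x| p.
have [x1|x1] := lerP `|x| 1; first by nra.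
rewrite -powR_mulrn//; apply: le_trans (_ : `|x| `^ p <= _); last by lra.
by apply: ler_powR => //; lra.
Qed.

(** Write the right-hand side as [u + 1] times a power of order [q - 1] and lower the base of that
    power to [u]. *)
Lemma powR_succ_ge q (u : nat) : 1 <= q -> (0 < u)%N ->
  u%:R `^ q + u%:R `^ (q - 1) <= (u.+1)%:R `^ q :> R.
Proof.
move=> q1 u0; have u0' : (0 : R) < u%:R by rewrite ltr0n.
have q0 : 0 < q by lra.
rewrite -(mulr_powRB1 (ltW u0') q0) -(mulr_powRB1 (ler0n R u.+1) q0).
rewrite -{2}[_ `^ (q - 1)]mul1r -mulrDl -natr1 ler_wpM2l ?addr_ge0//.
by apply: ge0_ler_powR; [lra|rewrite nnegrE ltW|rewrite nnegrE; lra|lra].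
Qed.

Lemma powRN_le1 (s : R) (k : nat) : 0 < s -> k%:R `^ (- s) <= 1 :> R.
Proof.
move=> s0; case: k => [|k]; first by rewrite powR0// oppr_eq0 gt_eqF.
rewrite powRN invf_le1 ?powR_gt0 ?ltr0n//.
by rewrite -[leLHS](powRr0 k.+1%:R); apply: ler_powR; rewrite ?ler1n// ltW.
Qed.

(** Only [x < y] has content; there the tangent-line bounds [ln z <= z - 1] and [1 + z <= expR z] do
    the work of a mean value theorem. *)
Lemma powRN_lipschitz (s x y : R) : 0 < s -> 1 <= x -> 1 <= y ->
  x `^ (- s) <= y `^ (- s) + s * `|x - y|.
Proof.
move=> s0 x1 y1.
have x0 : 0 < x by lra.
have y0 : 0 < y by lra.
have [yx|xy] := lerP y x.
  rewrite -[leLHS]addr0; apply: lerD; last by rewrite mulr_ge0 ?(ltW s0)// subr_ge0.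
  rewrite !powRN lef_pV2 ?posrE ?powR_gt0//.
  by apply: ge0_ler_powR; rewrite ?nnegrE ?(ltW s0) ?(ltW x0) ?(ltW y0).
have xs0 : 0 <= x `^ (- s) := powR_ge0 _ _.
have xs1 : x `^ (- s) <= 1.
  rewrite powRN invf_le1 ?powR_gt0//.
  by rewrite -[leLHS](powRr0 x); apply: ler_powR => //; exact: ltW.
have yE : y `^ (- s) = x `^ (- s) * (y / x) `^ (- s).
  by rewrite -powRM ?divr_ge0 ?ltW// mulrCA divff ?gt_eqF// mulr1.
have t0 : 0 < y / x by rewrite divr_gt0.
have h1 : ln (y / x) <= y / x - 1.
  by have := le_ln1Dx (x := y / x - 1); rewrite addrCA subrr addr0; apply; lra.
have h2 : 1 - s * (y / x - 1) <= (y / x) `^ (- s).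
  rewrite -{2}(lnK t0) -expRM; apply: le_trans (expR_ge1Dx _).
  by have := ler_wpM2l (ltW s0) h1; lra.
have h3 : y / x - 1 <= y - x.
  have -> : y / x - 1 = (y - x) / x by rewrite mulrBl divff ?gt_eqF.
  by rewrite ler_pdivrMr//; nra.
have h4 := ler_wpM2l (ltW s0) h3.
have h5 := ler_wpM2l xs0 h2; rewrite -yE in h5.
have h6 : x `^ (- s) * (s * (y / x - 1)) <= s * (y - x).
  have : 0 <= s * (y / x - 1).
    by rewrite mulr_ge0 ?(ltW s0)// subr_ge0 ler_pdivlMr// mul1r ltW.
  nra.
lra.
Qed.

Lemma powRN_small (C e t : R) : 0 <= C -> 0 < e -> 0 < t ->
  exists k0 : nat, forall k, (k0 <= k)%N -> C * k%:R `^ (- t) <= e.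
Proof.
move=> C0 e0 t0; pose z := ((C + 1) / e) `^ t^-1.
have ce0 : 0 < (C + 1) / e by rewrite divr_gt0//; lra.
have z0 : 0 < z by rewrite powR_gt0.
have := archi_boundP (ltW z0); set k0 := Num.bound z => zk.
exists k0 => k k0k.
have zk' : z <= k%:R by apply: le_trans (ltW zk) _; rewrite ler_nat.
have kt : (C + 1) / e <= k%:R `^ t.
  have -> : (C + 1) / e = z `^ t.
    by rewrite /z -powRrM mulVf ?gt_eqF// powRr1// ltW.
  by apply: ge0_ler_powR; rewrite ?nnegrE ?(ltW t0) ?(ltW z0).
have kt0 : 0 < k%:R `^ t by apply: lt_le_trans ce0 kt.
rewrite powRN ler_pdivrMr//; move: kt; rewrite ler_pdivrMr// mulrC; lra.
Qed.

End PowerInequalities.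

(** * Graded convolution *)

Section TruncatedConvolution.
Context {R : realType}.
Variables (a b : nat).
Implicit Types (f g h : nat * nat -> R) (x y z : nat * nat).

Local Notation I := ('I_a * 'I_b)%type.

(* An index (n, v) stands for the environment paths of length n whose A's have
   product v, which determines the value of the walk. *)
Definition pmul x y : nat * nat := ((x.1 + y.1)%N, (x.2 * y.2)%N).

Definition inrange z : bool := (z.1 < a)%N && (0 < z.2 < b)%N.

Definition pval (t : I) : nat * nat := (val t.1, val t.2).

(** Lengths add and products multiply. The sum runs over a finite box, and this truncation is exact
    at the indices accepted by [inrange]. *)
Definition conv f g z : R :=
  \sum_(x : I) \sum_(y : I) (pmul (pval x) (pval y) == z)%:R * (f (pval x) * g (pval y)).

Lemma pmulC x y : pmul x y = pmul y x.
Proof. by rewrite /pmul addnC mulnC. Qed.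

Lemma pmulA x y z : pmul x (pmul y z) = pmul (pmul x y) z.
Proof. by rewrite /pmul /= addnA mulnA. Qed.

(** A positive product below [b] has positive factors below [b]. Hence every factorization of an
    index of the box stays in the box, which is why [conv] is associative there. *)
Lemma inrange_pmull x y : inrange (pmul x y) -> inrange x.
Proof.
case: x y => [x1 x2] [y1 y2]; rewrite /inrange /pmul /= muln_gt0.
move=> /andP[xy /andP[/andP[x0 y0] xyb]]; rewrite x0 (leq_ltn_trans _ xy) ?leq_addr//=.
by rewrite (leq_ltn_trans _ xyb)// leq_pmulr.
Qed.

Lemma sum_pval t (h : nat * nat -> R) : inrange t ->
  \sum_(x : I) (t == pval x)%:R * h (pval x) = h t.
Proof.
case: t => [n v] /andP[/= na /andP[v0 vb]].
rewrite (bigD1 (Ordinal na, Ordinal vb))//= eqxx mul1r big1 ?addr0// => x xn.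
case: eqP => [[n1 v1]|]; last by rewrite mul0r.
by case/negP: xn; apply/eqP; case: x n1 v1 => [x1 x2] /= n1 v1; congr (_, _); apply: val_inj.
Qed.

Lemma convC f g z : conv f g z = conv g f z.
Proof.
rewrite /conv exchange_big /=; apply: eq_bigr => y _; apply: eq_bigr => x _.
by rewrite pmulC [f _ * _]mulrC.
Qed.

Lemma eq_conv f f' g g' z : (forall x, inrange x -> f x = f' x) ->
  (forall x, inrange x -> g x = g' x) -> inrange z -> conv f g z = conv f' g' z.
Proof.
move=> ff gg zr; apply: eq_bigr => x _; apply: eq_bigr => y _.
case: eqP => [xy|_]; last by rewrite !mul0r.
have xr : inrange (pval x) by apply: (@inrange_pmull _ (pval y)); rewrite xy.
have yr : inrange (pval y) by apply: (@inrange_pmull _ (pval x)); rewrite pmulC xy.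
by rewrite ff// gg.
Qed.

Lemma convDl f f' g z : conv (fun x => f x + f' x) g z = conv f g z + conv f' g z.
Proof.
rewrite /conv -big_split /=; apply: eq_bigr => x _; rewrite -big_split /=.
by apply: eq_bigr => y _; rewrite mulrDl mulrDr.
Qed.

Lemma convBl f f' g z : conv (fun x => f x - f' x) g z = conv f g z - conv f' g z.
Proof.
rewrite /conv -sumrB /=; apply: eq_bigr => x _; rewrite -sumrB /=.
by apply: eq_bigr => y _; rewrite mulrBl mulrBr.
Qed.

Lemma convBr f g g' z : conv f (fun x => g x - g' x) z = conv f g z - conv f g' z.
Proof. by rewrite convC convBl !(convC f). Qed.

Lemma conv_triple f g h z : inrange z -> conv (conv f g) h z =
  \sum_(x : I) \sum_(y : I) \sum_(s : I)
    (pmul (pmul (pval x) (pval y)) (pval s) == z)%:R *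
      (f (pval x) * g (pval y) * h (pval s)).
Proof.
move=> zr; rewrite /conv.
under eq_bigr => t _ do under eq_bigr => s _ do
  rewrite mulr_suml mulr_sumr; rewrite /=.
under eq_bigr => t _.
  rewrite exchange_big /=.
  under eq_bigr => x _ do under eq_bigr => s _ do rewrite mulr_suml mulr_sumr.
  under eq_bigr => x _ do rewrite exchange_big.
  over.
rewrite exchange_big /=; apply: eq_bigr => x _.
rewrite exchange_big /=; apply: eq_bigr => y _.
rewrite exchange_big /=; apply: eq_bigr => s _.
have [xys|xys] := eqVneq (pmul (pmul (pval x) (pval y)) (pval s)) z.
  have xyr : inrange (pmul (pval x) (pval y)).
    by apply: (@inrange_pmull _ (pval s)); rewrite xys.
  pose H t := (pmul t (pval s) == z)%:R * (f (pval x) * g (pval y) * h (pval s)).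
  transitivity (H (pmul (pval x) (pval y))); last by rewrite /H xys eqxx.
  by apply: etrans (sum_pval H xyr); apply: eq_bigr => t _; rewrite /H; ring.
rewrite mul0r; apply: big1 => t _.
case: eqP => [ts|_]; last by rewrite mul0r.
case: eqP => [xt|_]; last by rewrite !mul0r mulr0.
by case/negP: xys; apply/eqP; rewrite xt.
Qed.

Lemma convA f g h z : inrange z -> conv (conv f g) h z = conv f (conv g h) z.
Proof.
move=> zr; rewrite [RHS]convC !conv_triple// [RHS]exchange_big /=.
under [RHS]eq_bigr => x _ do rewrite exchange_big /=.
rewrite [RHS]exchange_big /=; apply: eq_bigr => x _.
rewrite [RHS]exchange_big /=; apply: eq_bigr => y _; apply: eq_bigr => s _.
rewrite -pmulA [pmul (pval y) _]pmulC; congr ((_ == z)%:R * _); last by ring.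
exact: pmulC.
Qed.

Definition conv1 z : R := (z == (0%N, 1%N))%:R.

Lemma conv1l f z : inrange z -> conv conv1 f z = f z.
Proof.
move=> zr; have [za zb] := andP zr.
have o : inrange (0%N, 1%N).
  by rewrite /inrange /= (leq_ltn_trans _ za)//=; case: (z.2) zb => [|v] /andP[]//; lia.
rewrite /conv /conv1.
transitivity (\sum_(x : I) ((0%N, 1%N) == pval x)%:R *
   (\sum_(y : I) (pmul (pval x) (pval y) == z)%:R * f (pval y))).
  apply: eq_bigr => x _; rewrite mulr_sumr; apply: eq_bigr => y _.
  by rewrite [_ == pval x]eq_sym; ring.
rewrite (sum_pval (fun x => \sum_(y : I) (pmul x (pval y) == z)%:R * f (pval y)) o).
apply: etrans (sum_pval f zr); apply: eq_bigr => y _.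
have -> : pmul (0%N, 1%N) (pval y) = pval y by rewrite /pmul /= add0n mul1n.
by rewrite eq_sym.
Qed.

(** The analogue of z d/dz on generating functions in the length: a derivation for [conv], since
    lengths add. *)
Definition grade f z : R := z.1%:R * f z.

Lemma grade_conv f g z : grade (conv f g) z = conv (grade f) g z + conv f (grade g) z.
Proof.
rewrite /grade /conv mulr_sumr -big_split /=; apply: eq_bigr => x _.
rewrite mulr_sumr -big_split /=; apply: eq_bigr => y _.
case: eqP => [<-|_]; last by rewrite !mul0r mulr0 addr0.
by rewrite /pmul /= natrD; ring.
Qed.

(* [F = D * E] with [grade F = (Fn + Fp) * F] forces [grade D - Fn * D = 0]: after
   cancelling, this difference and [Fp * E - grade E] have disjoint supports. *)
Lemma graded_factorization (neg : pred (nat * nat)) (F D E Fn Fp : nat * nat -> R) :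
  (forall z, inrange z -> F z = conv D E z) ->
  (forall z, inrange z -> grade F z = conv (fun x => Fn x + Fp x) F z) ->
  (forall z, inrange z -> z.1 = 0%N -> D z = conv1 z) ->
  (forall z, inrange z -> z.1 = 0%N -> E z = conv1 z) ->
  (forall z, z.1 = 0%N -> Fn z = 0) -> (forall z, z.1 = 0%N -> Fp z = 0) ->
  (forall z, ~~ neg z -> Fn z = 0) -> (forall z, neg z -> Fp z = 0) ->
  (forall z, inrange z -> (0 < z.1)%N -> ~~ neg z -> D z = 0) ->
  (forall z, inrange z -> neg z -> E z = 0) ->
  (forall x y, inrange x -> inrange y -> neg x -> neg y -> neg (pmul x y)) ->
  (forall x y, inrange x -> inrange y -> ~~ neg x -> ~~ neg y -> ~~ neg (pmul x y)) ->
  forall z, inrange z -> grade D z = conv Fn D z.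
Proof.
move=> FDE gF D0 E0 Fn0 Fp0 Fnn Fpn Dneg Eneg negM posM.
pose al z := grade D z - conv Fn D z.
pose be z := conv Fp E z - grade E z.
have key z : inrange z -> conv al E z = conv D be z.
  move=> zr; rewrite /al /be convBl convBr convA//.
  have e1 : conv Fn (conv D E) z = conv Fn F z.
    by apply: eq_conv => // x xr; rewrite FDE.
  have e2 : conv D (conv Fp E) z = conv Fp F z.
    rewrite -convA//; transitivity (conv (conv Fp D) E z).
      by apply: eq_conv => // x _; exact: convC.
    by rewrite convA//; apply: eq_conv => // x xr; rewrite FDE.
  rewrite e1 e2; have := gF z zr; rewrite convDl.
  have -> : grade F z = grade (conv D E) z by rewrite /grade FDE.
  by rewrite grade_conv; lra.
(* Induction on the length, for all products at once. With [al] and [be] zero at smaller lengths,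
   only the unit parts of [E] and [D] contribute to the two sides of [key]. *)
suff al0 : forall n v, inrange (n, v) -> al (n, v) = 0 /\ be (n, v) = 0.
  by case=> n v zr; have [/eqP + _] := al0 n v zr; rewrite subr_eq0 => /eqP.
elim/ltn_ind => n IH v zr; set z := (n, v).
have aE : conv al E z = al z.
  rewrite -[RHS](conv1l _ zr) convC; apply: eq_bigr => x _; apply: eq_bigr => y _.
  case: eqP => [xy|_]; last by rewrite !mul0r.
  have xr : inrange (pval x) by apply: (@inrange_pmull _ (pval y)); rewrite xy.
  have yr : inrange (pval y) by apply: (@inrange_pmull _ (pval x)); rewrite pmulC xy.
  have [x0|x0] := posnP (pval x).1; first by rewrite E0.
  have [-> _] : al (pval y) = 0 /\ be (pval y) = 0.
    rewrite [pval y]surjective_pairing; apply: IH; last by rewrite -surjective_pairing.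
    have xE : ((pval x).1 + (pval y).1 = n)%N by exact: (congr1 fst xy).
    by rewrite -xE -[X in (X < _)%N]add0n ltn_add2r.
  by rewrite !mulr0.
have bE : conv D be z = be z.
  rewrite -[RHS](conv1l _ zr); apply: eq_bigr => x _; apply: eq_bigr => y _.
  case: eqP => [xy|_]; last by rewrite !mul0r.
  have xr : inrange (pval x) by apply: (@inrange_pmull _ (pval y)); rewrite xy.
  have yr : inrange (pval y) by apply: (@inrange_pmull _ (pval x)); rewrite pmulC xy.
  have [x0|x0] := posnP (pval x).1; first by rewrite D0.
  have [_ ->] : al (pval y) = 0 /\ be (pval y) = 0.
    rewrite [pval y]surjective_pairing; apply: IH; last by rewrite -surjective_pairing.
    have xE : ((pval x).1 + (pval y).1 = n)%N by exact: (congr1 fst xy).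
    by rewrite -xE -[X in (X < _)%N]add0n ltn_add2r.
  by rewrite !mulr0.
(* It remains that one of the two equal values vanishes: [be] at negative indices, [al] at the
   others. *)
have ab : al z = be z by rewrite -aE -bE; exact: key.
have [n0|n0] := posnP n.
  have al0 : al z = 0.
    rewrite /al /grade /z /= n0 mul0r /conv big1 ?subr0// => x _; rewrite big1// => y _.
    case: eqP => [xy|_]; last by rewrite mul0r.
    rewrite Fn0 ?mul0r ?mulr0//; apply/eqP.
    have xE : ((pval x).1 + (pval y).1 = 0)%N by exact: (congr1 fst xy).
    by move/eqP: xE; rewrite addn_eq0 => /andP[].
  by rewrite -ab.
have [zneg|zpos] := boolP (neg z).
  have be0 : be z = 0.
    rewrite /be /grade (Eneg _ zr zneg) mulr0 subr0 /conv big1// => x _; rewrite big1// => y _.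
    case: eqP => [xy|_]; last by rewrite mul0r.
    have xr : inrange (pval x) by apply: (@inrange_pmull _ (pval y)); rewrite xy.
    have yr : inrange (pval y) by apply: (@inrange_pmull _ (pval x)); rewrite pmulC xy.
    have [xn|xn] := boolP (neg (pval x)); first by rewrite Fpn// mul0r mulr0.
    have [yn|yn] := boolP (neg (pval y)); first by rewrite (Eneg (pval y))// !mulr0.
    by have := posM _ _ xr yr xn yn; rewrite xy zneg.
  by rewrite ab.
have al0 : al z = 0.
  rewrite /al /grade (Dneg _ zr n0 zpos) mulr0 sub0r /conv big1 ?oppr0// => x _.
  rewrite big1// => y _; case: eqP => [xy|_]; last by rewrite mul0r.
  have xr : inrange (pval x) by apply: (@inrange_pmull _ (pval y)); rewrite xy.
  have yr : inrange (pval y) by apply: (@inrange_pmull _ (pval x)); rewrite pmulC xy.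
  have [xn|xn] := boolP (neg (pval x)); last by rewrite Fnn// mul0r mulr0.
  (* A factor of [D] of length 0 is the unit, which would make [z] equal to the negative index
     [pval x]. *)
  have [y0|y0] := posnP (pval y).1.
    rewrite D0// /conv1; case: eqP => [yE|_]; last by rewrite !mulr0.
    case/negP: zpos; rewrite -xy yE.
    suff -> : pmul (pval x) (0%N, 1%N) = pval x by exact: xn.
    by rewrite /pmul /= addn0 muln1.
  have [yn|yn] := boolP (neg (pval y)); last by rewrite (Dneg (pval y))// !mulr0.
  by case/negP: zpos; rewrite -xy; exact: negM.
by rewrite -ab.
Qed.

End TruncatedConvolution.

(** * The process in discrete coordinates *)

Section IidSums.
Context {d : measure_display} {T : measurableType d} {R : realType}.
Variable P : probability T R.
Variables (I : eqType) (F : I -> set (set T)).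

Hypothesis indepF : mutually_independent P F.
Hypothesis F_setT : forall k, F k setT.
Hypothesis F_setI : forall k, setI_closed (F k).
Hypothesis F_meas : forall k, F k `<=` measurable.

Lemma eqlaw_sum (e e' : nat -> I) (f g : nat -> T -> nat) k :
  injective e -> injective e' ->
  (forall j, dmeas F [set e j] (f j)) -> (forall j, dmeas F [set e' j] (g j)) ->
  (forall j, eqlaw P (f j) (g j)) ->
  eqlaw P (fun w => \sum_(j < k) f j w)%N (fun w => \sum_(j < k) g j w)%N.
Proof.
move=> ie ie' mf mg fg; elim: k => [|k IH].
  suff -> : (fun w => \sum_(j < 0) f j w)%N = (fun w => \sum_(j < 0) g j w)%N by [].
  by apply/funext => w; rewrite !big_ord0.
have part (a : nat -> I) (h : nat -> T -> nat) : (forall j, dmeas F [set a j] (h j)) ->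
    dmeas F [set a j | j in [set j | (j < k)%N]] (fun w => \sum_(j < k) h j w)%N.
  move=> mh; apply: dmeas_sum => // j jk.
  by refine (sub_dmeas (mh j) _) => _ ->; exists j.
have dis (a : nat -> I) : injective a ->
    [set a j | j in [set j | (j < k)%N]] `&` [set a k] = set0.
  by move=> ia; apply/seteqP; split=> // _ [[j /= jk <-] /ia jk']; rewrite jk' ltnn in jk.
have := eqlaw_diag indepF F_setT F_setI F_meas (dis _ ie) (dis _ ie') (part _ _ mf)
  (fun=> mf k) (part _ _ mg) (fun=> mg k) IH (fun=> fg k).
move=> H Y.
under [X in X @^-1` _]eq_fun do rewrite big_ord_recr /=.
under [X in _ = P (X @^-1` _)]eq_fun do rewrite big_ord_recr /=.
exact: (H [set z | Y (z.1 + z.2)%N]).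
Qed.

End IidSums.

Unset Implicit Arguments.

Section Chain.
Context {d : measure_display} {T : measurableType d} {R : realType}.
Context {P : probability T R}.
Variable D : cbp P.

Definition devents : driving_index -> set (set T) :=
  driving_events (fun n j => xi D n j) (fun n j => ell D n j) (fun n => ctl D n).

Lemma devents_meas k : devents k `<=` measurable.
Proof.
by case: k => [[[n j]|[n j]]|n] _ [Y mY <-] /=;
  exact: (measurable_funP (_ : {RV P >-> _})).
Qed.

Lemma devents_setT k : devents k setT.
Proof.
by case: k => [[[n j]|[n j]]|n]; exists setT => //; rewrite preimage_setT setTI.
Qed.

Lemma devents_setI k : setI_closed (devents k).
Proof.
by case: k => [[[n j]|[n j]]|n] _ _ [Y mY <-] [Z mZ <-];
  (exists (Y `&` Z); [exact: measurableI|rewrite !setTI preimage_setI]).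
Qed.

Lemma devents_indep : mutually_independent P devents.
Proof. by move=> s E; exact: driving_indep. Qed.

Definition gen_of (k : driving_index) : nat :=
  match k with inl (inl (n, _)) => n | inl (inr (n, _)) => n | inr n => n end.

Definition gens (Q : set nat) : set driving_index := [set k | Q (gen_of k)].

Definition step (n x : nat) (w : T) : nat := (\sum_(j < phi D n x w) xi D n j w)%N.

(** The process restarted from [x] at generation [k] and run for [l] steps. It describes the
    evolution after a cut time, through [XsD]. *)
Fixpoint Xs (k x l : nat) (w : T) : nat :=
  if l is l'.+1 then step (k + l') (Xs k x l' w) w else x.

Definition seqA (k l : nat) (w : T) : seq nat := mkseq (fun j => A D (k + j) w) l.

Notation dm := (dmeas devents).

Lemma dm_meas {J} {S : Type} {f : T -> S} Y : dm J f -> measurable (f @^-1` Y).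
Proof. by move=> mf; exact: (dmeas_meas devents_meas Y mf). Qed.

Lemma dm_xi {n j} {J : set driving_index} : J (inl (inl (n, j))) -> dm J (xi D n j).
Proof.
move=> Jn Y; apply: sub_gen_smallest; apply: (cylinders1 devents_setT Jn).
by exists Y => //; rewrite setTI.
Qed.

Lemma dm_ell {n j} {J : set driving_index} : J (inl (inr (n, j))) -> dm J (ell D n j).
Proof.
move=> Jn Y; apply: sub_gen_smallest; apply: (cylinders1 devents_setT Jn).
by exists Y => //; rewrite setTI.
Qed.

Lemma measurable_natpair (Y : set (nat * nat)) : measurable Y.
Proof.
apply: countable_measurable; last exact: countableP.
move=> [a b]; rewrite (_ : [set (a, b)] = [set a] `*` [set b]); first exact: measurableX.
by apply/seteqP; split=> [[x y] [-> ->]|[x y] /= [-> ->]].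
Qed.

Lemma dm_ctl {n} {J : set driving_index} : J (inr n) -> dm J (ctl D n).
Proof.
move=> Jn Y; apply: sub_gen_smallest; apply: (cylinders1 devents_setT Jn).
by exists Y; [exact: measurable_natpair|rewrite setTI].
Qed.

Lemma dm_A {n} {J : set driving_index} : J (inr n) -> dm J (A D n).
Proof. by move=> Jn; apply: (dmeas_comp fst); exact: dm_ctl. Qed.

Definition ctl_slot n : set driving_index := [set k | k = inr n].
Definition ell_slots n : set driving_index := [set k | exists j, k = inl (inr (n, j))].
Definition xi_slots n : set driving_index := [set k | exists j, k = inl (inl (n, j))].

Lemma dm_Lsum n k : dm (ell_slots n) (Lsum D n k).
Proof.
by apply: (dmeas_sum (f := fun j => ell D n j)) => j _; apply: dm_ell; exists j.
Qed.

Definition xisum n k w := (\sum_(j < k) xi D n j w)%N.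

Lemma dm_xisum n k : dm (xi_slots n) (xisum n k).
Proof.
by apply: (dmeas_sum (f := fun j => xi D n j)) => j _; apply: dm_xi; exists j.
Qed.

Lemma eqlaw_xi n j n' j' : eqlaw P (xi D n j) (xi D n' j').
Proof.
move=> Y; have E k l : P (xi D k l @^-1` Y) = P (xi D 0 0 @^-1` Y).
  by rewrite -[LHS]/(distribution P (xi D k l) Y) xi_id.
by rewrite !E.
Qed.

Lemma eqlaw_ell n j n' j' : eqlaw P (ell D n j) (ell D n' j').
Proof.
move=> Y; have E k l : P (ell D k l @^-1` Y) = P (ell D 0 0 @^-1` Y).
  by rewrite -[LHS]/(distribution P (ell D k l) Y) ell_id.
by rewrite !E.
Qed.

Lemma eqlaw_ctl n n' : eqlaw P (ctl D n) (ctl D n').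
Proof.
move=> Y; have E k : P (ctl D k @^-1` Y) = P (ctl D 0 @^-1` Y).
  by rewrite -[LHS]/(distribution P (ctl D k) Y) ctl_id.
by rewrite !E.
Qed.

(** All that a failure event reads off generation [n] when the state is frozen at [x], gathered in
    one countable type. *)
Definition obs (n x : nat) (w : T) : nat * nat * nat * nat :=
  (ctl D n w, Lsum D n x w, step n x w).

Lemma dm_ctl_Lsum n x :
  dm (ctl_slot n `|` ell_slots n)
    (fun w => (ctl D n w, Lsum D n x w)).
Proof.
apply: dmeas_pair; first by apply: dm_ctl; left.
by refine (sub_dmeas (dm_Lsum n x) _) => ?; right.
Qed.

Lemma dis_ctl_Lsum n : ctl_slot n `&` ell_slots n =
  set0.
Proof. by apply/seteqP; split=> // k /= [-> []]. Qed.

Lemma dis_xi n : (ctl_slot n `|` ell_slots n) `&` xi_slots n = set0.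
Proof. by apply/seteqP; split=> // k /= [[->|[? ->]] []]. Qed.

Lemma eqlaw_Lsum n n' k : eqlaw P (Lsum D n k) (Lsum D n' k).
Proof.
refine (eqlaw_sum devents_indep devents_setT devents_setI devents_meas
  (e := fun j => inl (inr (n, j))) (e' := fun j => inl (inr (n', j)))
  (f := fun j => ell D n j) (g := fun j => ell D n' j) k _ _ _ _ _).
- by move=> i j [].
- by move=> i j [].
- by move=> j; exact: dm_ell.
- by move=> j; exact: dm_ell.
- by move=> j; exact: eqlaw_ell.
Qed.

Lemma eqlaw_xisum n n' k : eqlaw P (xisum n k) (xisum n' k).
Proof.
refine (eqlaw_sum devents_indep devents_setT devents_setI devents_meas
  (e := fun j => inl (inl (n, j))) (e' := fun j => inl (inl (n', j)))
  (f := fun j => xi D n j) (g := fun j => xi D n' j) k _ _ _ _ _).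
- by move=> i j [].
- by move=> i j [].
- by move=> j; exact: dm_xi.
- by move=> j; exact: dm_xi.
- by move=> j; exact: eqlaw_xi.
Qed.

Lemma eqlaw_ctl_Lsum n n' x : eqlaw P (fun w => (ctl D n w, Lsum D n x w))
  (fun w => (ctl D n' w, Lsum D n' x w)).
Proof.
refine (eqlaw_diag devents_indep devents_setT devents_setI devents_meas
  (dis_ctl_Lsum n) (dis_ctl_Lsum n') (h := fun=> Lsum D n x) (k := fun=> Lsum D n' x) _ _ _ _ _ _).
- exact: dm_ctl.
- by move=> _; exact: dm_Lsum.
- exact: dm_ctl.
- by move=> _; exact: dm_Lsum.
- exact: eqlaw_ctl.
- by move=> _; exact: eqlaw_Lsum.
Qed.

(** Two-stage freezing: the control pair and [Lsum] determine the number of reproducing individuals,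
    and the offspring slots are disjoint from the slots of both. *)
Lemma eqlaw_obs n n' x : eqlaw P (obs n x) (obs n' x).
Proof.
refine (eqlaw_diag devents_indep devents_setT devents_setI devents_meas
  (dis_xi n) (dis_xi n') (f := fun w => (ctl D n w, Lsum D n x w))
  (g := fun w => (ctl D n' w, Lsum D n' x w))
  (h := fun s => xisum n (s.1.1 * s.2 + s.1.2)%N)
  (k := fun s => xisum n' (s.1.1 * s.2 + s.1.2)%N) _ _ _ _ _ _).
- exact: dm_ctl_Lsum.
- by move=> s; exact: dm_xisum.
- exact: dm_ctl_Lsum.
- by move=> s; exact: dm_xisum.
- exact: eqlaw_ctl_Lsum.
- by move=> s; exact: eqlaw_xisum.
Qed.

Lemma dm_obs n x : dm (gens [set n]) (obs n x).
Proof.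
have cL : dm (gens [set n]) (fun w => (ctl D n w, Lsum D n x w)).
  by refine (sub_dmeas (dm_ctl_Lsum n x) _) => k /= [->|[? ->]].
apply: dmeas_pair => //.
apply: (dmeas_diag (h := fun s => xisum n (s.1.1 * s.2 + s.1.2)%N) cL) => s.
by refine (sub_dmeas (dm_xisum n _) _) => k /= [? ->].
Qed.

Lemma dm_step n x : dm (gens [set n]) (step n x).
Proof. exact: (dmeas_comp snd (dm_obs n x)). Qed.

Lemma dm_A_gens n : dm (gens [set n]) (A D n).
Proof. exact: dm_A. Qed.

(** Position and environment are kept together because the events of the critical case constrain the
    population and the walk at once. *)
Definition state k x l w := (Xs k x l w, seqA k l w).

Definition block k l : set nat := [set n | (k <= n < k + l)%N].

Lemma blockD k l : block k l `&` [set (k + l)%N] = set0.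
Proof. by apply/seteqP; split=> // n /= [/andP[_ nl] nE]; rewrite nE ltnn in nl. Qed.

Lemma gensI {Q Q'} : Q `&` Q' = set0 -> gens Q `&` gens Q' = set0.
Proof.
by move=> QQ'; apply/seteqP; split=> // k Qk; have : (Q `&` Q') (gen_of k) by []; rewrite QQ'.
Qed.

Lemma seqAS k l w : seqA k l.+1 w = rcons (seqA k l w) (A D (k + l) w).
Proof. by rewrite /seqA /mkseq -addn1 iotaD map_cat cats1. Qed.

Lemma dm_state k x l : dm (gens (block k l)) (state k x l).
Proof.
elim: l => [|l IH]; first exact: (@dmeas_cst _ _ _ _ _ _ (x, [::])).
have IH' : dm (gens (block k l.+1)) (state k x l).
  by refine (sub_dmeas IH _) => j /andP[kj jl]; apply/andP; split=> //; rewrite addnS ltnS ltnW.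
have sub : gens [set (k + l)%N] `<=` gens (block k l.+1).
  by move=> j; rewrite /gens /block /= => ->; rewrite leq_addr addnS ltnS leqnn.
rewrite /state; under eq_fun do rewrite seqAS.
apply: (dmeas_comp (fun z => (z.2.1, rcons z.1.2 z.2.2))
  (f := fun w => (state k x l w, (step (k + l) (state k x l w).1 w, A D (k + l) w)))).
apply: (dmeas_pair IH').
apply: (dmeas_diag
  (h := fun s w => (step (k + l) s.1 w, A D (k + l) w)) IH') => s.
apply: dmeas_pair; first by refine (sub_dmeas (dm_step _ _) _).
by refine (sub_dmeas (dm_A_gens _) _).
Qed.

(** Time homogeneity: each induction step appends one generation by [eqlaw_diag], with the current
    state as frozen index. *)
Lemma eqlaw_state k k' x l : eqlaw P (state k x l) (state k' x l).
Proof.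
elim: l => [|l IH] //.
have dm_h j s : dm (gens [set (j + l)%N])
    (fun w => (step (j + l) s w, A D (j + l) w)).
  by apply: dmeas_pair; [exact: dm_step|exact: dm_A_gens].
have := eqlaw_diag devents_indep devents_setT devents_setI devents_meas
  (gensI (blockD k l)) (gensI (blockD k' l)) (dm_state k x l)
  (fun s => dm_h k s.1) (dm_state k' x l) (fun s => dm_h k' s.1) IH.
move=> /(_ _) H Y; have {}H := H (fun s => _) => /=.
rewrite /state; under eq_fun do rewrite seqAS; under [in RHS]eq_fun do rewrite seqAS.
apply: (H _ [set z | Y (z.2.1, rcons z.1.2 z.2.2)]) => s Z.
exact: (eqlaw_obs (k + l) (k' + l) s.1 (fun z => Z (z.2, z.1.1.1))).
Qed.

Lemma X_Xs x n w : X D x n w = Xs 0 x n w.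
Proof. by elim: n => //= n ->. Qed.

Lemma XsD k x l l' w : Xs k x (l + l') w = Xs (k + l) (Xs k x l w) l' w.
Proof. by elim: l' => [|l' IH]; rewrite ?addn0// addnS /= IH addnA. Qed.

Lemma dm_X x n : dm (gens [set j | (j < n)%N]) (X D x n).
Proof.
rewrite (_ : X D x n = fun w => (state 0 x n w).1); last by apply/funext => w; rewrite X_Xs.
by refine (sub_dmeas (dmeas_comp fst (dm_state 0 x n)) _) => j.
Qed.

Lemma X_meas x n Y : measurable (X D x n @^-1` Y).
Proof. exact: (dm_meas Y (dm_X x n)). Qed.

Lemma obs_meas n x Y : measurable (obs n x @^-1` Y).
Proof. exact: (dm_meas Y (dm_obs n x)). Qed.

Lemma dis_lt n : gens [set j | (j < n)%N] `&` gens [set n] = set0.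
Proof. by apply: gensI; apply/seteqP; split=> // j /= [jn jE]; rewrite jE ltnn in jn. Qed.

(** The Markov property: [X D x n] uses only generations before [n], while [obs] uses generation
    [n], whose law is that of generation 0. *)
Lemma markov_prob x n (Y : set (nat * (nat * nat * nat * nat))) :
  P [set w | Y (X D x n w, obs n (X D x n w) w)] =
  (\sum_(k <oo) P (X D x n @^-1` [set k]) * P [set w | Y (k, obs 0 k w)])%E.
Proof.
rewrite (prob_freeze devents_indep devents_setT devents_setI devents_meas
  (h := fun k w => (k, obs n k w)) Y (dis_lt n) (dm_X x n)).
  by apply: eq_eseriesr => k _; congr (_ * _)%E; exact: (eqlaw_obs n 0 k (fun z => Y (k, z))).
by move=> k; exact: (dmeas_comp (pair k) (dm_obs n k)).
Qed.

Lemma markov_integral x n (G : nat -> nat -> \bar R) : (forall k y, 0 <= G k y)%E ->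
  (\int[P]_w G (X D x n w) (X D x n.+1 w) =
   \sum_(k <oo) P (X D x n @^-1` [set k]) * \int[P]_w G k (step 0 k w))%E.
Proof.
move=> G0; rewrite [LHS](integral_freeze devents_indep devents_setT devents_setI
  devents_meas (dis_lt n) (h := step n) G0 (dm_X x n))//; last by move=> k; exact: dm_step.
apply: eq_eseriesr => k _; congr (_ * _)%E.
apply: integral_eqlaw => //.
- by move=> s; exact: (dm_meas _ (dm_step n k)).
- by move=> s; exact: (dm_meas _ (dm_step 0 k)).
- by move=> Y; exact: (eqlaw_obs n 0 k (fun z => Y z.2)).
Qed.

End Chain.

(** * One-step failure bounds *)

Section ProbabilityBounds.
Context {d : measure_display} {T : measurableType d} {R : realType}.
Variable P : probability T R.
Local Open Scope ereal_scope.

Lemma integral_nat (V : T -> nat) (g : nat -> \bar R) :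
  (forall n, measurable (V @^-1` [set n])) -> (forall n, 0 <= g n) ->
  \int[P]_w g (V w) = \sum_(n <oo) P (V @^-1` [set n]) * g n.
Proof.
move=> mV g0; rewrite (integral_fibers_nat P mV)//; last exact: measurable_discrete.
apply: eq_eseriesr => n _; rewrite setTI muleC -integral_cst//.
by apply: eq_integral => w; rewrite inE => /= ->.
Qed.

Lemma markov_le (g : T -> R) (t : R) : (0 < t)%R -> measurable_fun setT g ->
  (forall w, 0 <= g w)%R ->
  P [set w | (t <= g w)%R] <= t^-1%:E * \int[P]_w (g w)%:E.
Proof.
move=> t0 mg g0.
have mE : measurable [set w | (t <= g w)%R].
  have := mg measurableT _ (measurable_itv `[t, +oo[); rewrite setTI.
  by rewrite (_ : _ @^-1` _ = [set w | (t <= g w)%R])//; apply/seteqP; split=> w /=;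
    rewrite in_itv/= andbT.
have mgE : measurable_fun setT (EFin \o g) by exact/measurable_EFinP.
rewrite -lee_pdivrMl ?invr_gt0// invrK -integral_cst//.
apply: (@le_trans _ _ (\int[P]_(w in [set w | (t <= g w)%R]) (g w)%:E)).
  apply: ge0_le_integral => //.
  - by move=> w _; rewrite lee_fin ltW.
  - exact: (measurable_funTS mgE).
apply: ge0_subset_integral => //.
by move=> w _; rewrite lee_fin.
Qed.

Lemma prob_le (E F : set T) : measurable E -> measurable F -> E `<=` F -> P E <= P F.
Proof. by move=> mE mF EF; apply: le_measure; rewrite ?inE. Qed.

End ProbabilityBounds.

Section Moments.
Context {d : measure_display} {T : measurableType d} {R : realType}.
Context {P : probability T R}.
Variable D : cbp P.
Local Open Scope ereal_scope.

Notation dm := (dmeas (devents D)).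

Lemma xi_meas n j Y : measurable (xi D n j @^-1` Y).
Proof. exact: (dm_meas D Y (dm_xi D (J := setT) I)). Qed.

Lemma xisum_meas n u Y : measurable (xisum D n u @^-1` Y).
Proof. exact: (dm_meas D Y (dm_xisum D n u)). Qed.

Lemma measurable_xi_real n j (g : R -> R) :
  measurable_fun setT (fun w => (g (xi D n j w)%:R)).
Proof.
exact: (@measurable_discrete _ _ _ (xi D n j) _ _ (fun k => g k%:R)
  (fun s => xi_meas n j [set s])).
Qed.

Lemma integrable_xi_centered :
  P.-integrable setT (fun w => ((xi D 0 0 w)%:R - m D)%:E) /\
  \int[P]_w ((xi D 0 0 w)%:R - m D)%:E = 0.
Proof.
have mxi : measurable_fun setT (fun w => ((xi D 0 0 w)%:R : R)%:E).
  by apply/measurable_EFinP; exact: (measurable_xi_real 0 0 id).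
have mean : \int[P]_w ((xi D 0 0 w)%:R : R)%:E = (m D)%:E.
  by rewrite -(mean_xi D) unlock.
have ixi : P.-integrable setT (fun w => ((xi D 0 0 w)%:R : R)%:E).
  apply/integrableP; split=> //.
  under eq_integral do rewrite abse_EFin ger0_norm//.
  by rewrite mean ltry.
have icst : P.-integrable setT (EFin \o cst (- m D)%R).
  exact: finite_measure_integrable_cst.
split; first by have := integrableD measurableT ixi icst; apply.
under eq_integral do rewrite EFinB.
rewrite (integralD measurableT ixi icst) mean.
rewrite (_ : \int[P]_w (EFin \o cst (- m D)%R) w = (- m D)%:E) ?subee//.
by rewrite -[RHS]mule1 -(probability_setT P) -integral_cst.
Qed.

(** Integration of [powR_normD_le] in [y = xi - m]: the linear term vanishes and [y^2 <= 1 + |y|^p]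
    absorbs the second moment, giving [b = c * (1 + beta)] with [beta] the [p]-th absolute
    moment. *)
Lemma xi_shifted_moment p : (2 <= p)%R ->
  'E_P[fun w => (`|(xi D 0 0 w)%:R - m D| `^ p)%R] < +oo ->
  exists2 b : R, (0 <= b)%R & forall x : R,
    \int[P]_w (`|x + ((xi D 0 0 w)%:R - m D)| `^ p)%:E <=
    (`|x| `^ p + b * `|x| `^ (p - 2) + b)%:E.
Proof.
move=> p2; rewrite unlock => fin.
have [c c1 h] := @powR_normD_le R p p2.
set Y := fun w => ((xi D 0 0 w)%:R - m D)%R.
have mY (g : R -> R) : measurable_fun setT (fun w => g (Y w)).
  exact: (measurable_xi_real 0 0 (fun z => g (z - m D)%R)).
have iYp : P.-integrable setT (fun w => (`|Y w| `^ p)%:E).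
  apply/integrableP; split; first by apply/measurable_EFinP; exact: (mY (fun y => `|y| `^ p)%R).
  by under eq_integral do rewrite abse_EFin ger0_norm ?powR_ge0//.
have [beta betaE] : exists beta : R, \int[P]_w (`|Y w| `^ p)%:E = beta%:E.
  exists (fine (\int[P]_w (`|Y w| `^ p)%:E)); rewrite fineK// ge0_fin_numE//.
  by apply: integral_ge0 => w _; rewrite lee_fin powR_ge0.
have beta0 : (0 <= beta)%R.
  by rewrite -lee_fin -betaE; apply: integral_ge0 => w _; rewrite lee_fin powR_ge0.
exists (c * (1 + beta))%R; first by nra.
move=> x; have [l hl] := h x.
have xp : (0 <= `|x| `^ (p - 2))%R := powR_ge0 _ _.
pose k0 : R := (`|x| `^ p + c * `|x| `^ (p - 2))%R.
pose k1 : R := (c * (`|x| `^ (p - 2) + 1))%R.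
have k10 : (0 <= k1)%R by rewrite /k1; nra.
have [iY Y0] := integrable_xi_centered.
have i0 : P.-integrable setT (EFin \o cst k0) by exact: finite_measure_integrable_cst.
have i1 : P.-integrable setT (fun w => l%:E * (Y w)%:E) by exact: integrableZl.
have i2 : P.-integrable setT (fun w => k1%:E * (`|Y w| `^ p)%:E) by exact: integrableZl.
have i01 := integrableD measurableT i0 i1.
have i012 := integrableD measurableT i01 i2.
apply: (@le_trans _ _ (\int[P]_w ((EFin \o cst k0) \+ (fun w => l%:E * (Y w)%:E)
    \+ (fun w => k1%:E * (`|Y w| `^ p)%:E)) w)).
  apply: ge0_le_integral => //.
  - by apply/measurable_EFinP; exact: (mY (fun y => `|x + y| `^ p)%R).
  - by move/integrableP : i012 => [].
  - move=> w _ /=; rewrite -!EFinM -!EFinD lee_fin.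
    apply: le_trans (hl (Y w)) _; rewrite /k0 /k1.
    have := sqr_le_1DpowR (Y w) p2.
    move=> /(ler_wpM2l xp) H; have {H} := ler_wpM2l (le_trans ler01 c1) H.
    lra.
rewrite (integralD measurableT i01 i2) (integralD measurableT i0 i1).
rewrite integralZl// Y0 mule0 adde0 integralZl// betaE.
rewrite (_ : \int[P]_w (EFin \o cst k0) w = k0%:E); last first.
  by rewrite -[RHS]mule1 -(probability_setT P) -integral_cst.
rewrite -EFinM -EFinD lee_fin /k0 /k1.
have : (0 <= beta * c)%R by nra.
have : (0 <= c)%R by lra.
nra.
Qed.

End Moments.

Section AffineIntegral.
Context {d : measure_display} {T : measurableType d} {R : realType}.
Variable P : probability T R.
Local Open Scope ereal_scope.

Lemma integral_prob_cst (c : R) : \int[P]_w c%:E = c%:E.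
Proof. by rewrite -[RHS]mule1 -(probability_setT P) -integral_cst. Qed.

Lemma integral_affine (g : T -> R) (a c : R) : (0 <= a)%R -> (0 <= c)%R ->
  measurable_fun setT g -> (forall w, 0 <= g w)%R ->
  \int[P]_w (a * g w + c)%:E = a%:E * (\int[P]_w (g w)%:E) + c%:E.
Proof.
move=> a0 c0 mg g0.
have mgE : measurable_fun setT (EFin \o g) by exact/measurable_EFinP.
under eq_integral do rewrite EFinD EFinM.
rewrite ge0_integralD//.
- rewrite ge0_integralZl_EFin//; last by move=> w _; rewrite lee_fin.
  by rewrite integral_prob_cst.
- by move=> w _; rewrite mule_ge0// lee_fin.
- exact: measurable_funeM.
Qed.

End AffineIntegral.

Section SumMoments.
Context {d : measure_display} {T : measurableType d} {R : realType}.
Context {P : probability T R}.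
Variable D : cbp P.
Local Open Scope ereal_scope.

Notation dm := (dmeas (devents D)).

Definition dev (u : nat) (v : nat) : R := (v%:R - m D * u%:R)%R.

Lemma measurable_xisum n u {d'} {T' : measurableType d'} (g : nat -> T') :
  measurable_fun setT (fun w => g (xisum D n u w)).
Proof.
exact: (@measurable_discrete _ _ _ (xisum D n u) _ _ g
  (fun s => xisum_meas D n u [set s])).
Qed.

Lemma xisum_moment_step p b u : (0 <= b)%R ->
  (forall x : R, \int[P]_w (`|x + ((xi D 0 0 w)%:R - m D)| `^ p)%:E <=
    (`|x| `^ p + b * `|x| `^ (p - 2) + b)%:E) ->
  \int[P]_w (`|dev u.+1 (xisum D 0 u.+1 w)| `^ p)%:E <=
  \int[P]_w (`|dev u (xisum D 0 u w)| `^ p +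
             b * `|dev u (xisum D 0 u w)| `^ (p - 2) + b)%:E.
Proof.
move=> b0 hb.
pose J : set driving_index := [set k | exists2 j, (j < u)%N & k = inl (inl (0%N, j))].
pose J' : set driving_index := [set inl (inl (0%N, u))].
have JJ' : J `&` J' = set0.
  by apply/seteqP; split=> // k [[j ju ->]] [jE]; rewrite jE ltnn in ju.
have mJ : dm J (xisum D 0 u).
  apply: (dmeas_sum (f := fun j => xi D 0 j)) => j ju.
  by apply: dm_xi; exists j.
have mJ' : dm J' (xi D 0 u) by exact: dm_xi.
pose G v y : \bar R := (`|dev u v + (y%:R - m D)| `^ p)%:E.
have G0 v y : 0 <= G v y by rewrite lee_fin powR_ge0.
have -> : \int[P]_w (`|dev u.+1 (xisum D 0 u.+1 w)| `^ p)%:E =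
    \int[P]_w G (xisum D 0 u w) (xi D 0 u w).
  apply: eq_integral => w _; congr (`| _ | `^ _)%:E.
  by rewrite /dev /xisum big_ord_recr /= natrD -natr1; ring.
rewrite (integral_freeze (devents_indep D) (devents_setT D) (devents_setI D)
  (devents_meas D) JJ' (h := fun=> xi D 0 u) G0 mJ (fun=> mJ')).
rewrite (@integral_nat _ _ _ P (xisum D 0 u)
   (fun v => (`|dev u v| `^ p + b * `|dev u v| `^ (p - 2) + b)%:E)); last 2 first.
- by move=> n; exact: xisum_meas.
- by move=> n; rewrite lee_fin !addr_ge0// ?mulr_ge0// powR_ge0.
apply: lee_nneseries => v _; first by rewrite mule_ge0// integral_ge0.
apply: lee_wpmul2l => //.
rewrite (integral_eqlaw (V := xi D 0 u) (V' := xi D 0 0))//; first exact: hb.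
- by move=> s; exact: xi_meas.
- by move=> s; exact: xi_meas.
- exact: eqlaw_xi.
Qed.

(** A Marcinkiewicz-Zygmund bound by induction on [u]. By interpolation, one more summand adds at
    most order [u^(q - 1)], which the increment of [u^q] pays for. *)
Lemma xisum_moment p : (2 <= p)%R ->
  'E_P[fun w => (`|(xi D 0 0 w)%:R - m D| `^ p)%R] < +oo ->
  exists2 H : R, (0 <= H)%R & forall u : nat,
    \int[P]_w (`|dev u (xisum D 0 u w)| `^ p)%:E <= (H * u%:R `^ (p / 2))%:E.
Proof.
move=> p2 /(xi_shifted_moment D p p2) [b b0 hb].
pose q : R := (p / 2)%R; have q1 : (1 <= q)%R by rewrite /q; lra.
(* [kap] ensures [b / kap <= 1/2], so the feedback of the [p]-th moment costs at most half of [H];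
   the other half of [H] is exactly the remaining coefficient. *)
pose kap : R := (2 * b + 1)%R; have kap0 : (0 < kap)%R by rewrite /kap; lra.
have kq0 : (0 <= kap `^ (q - 1))%R := powR_ge0 _ _.
pose H : R := (2 * b * (kap `^ (q - 1) + 1))%R.
have H0 : (0 <= H)%R by rewrite /H; nra.
exists H => //; elim=> [|u IH].
  under eq_integral.
    move=> w _; rewrite /dev /xisum big_ord0 mulr0 subrr normr0 powR0; last by lra.
    over.
  by rewrite integral0 lee_fin mulr_ge0 ?powR_ge0.
apply: le_trans (xisum_moment_step p b u b0 hb) _.
have pw0 (x y : R) : (0 <= x `^ y)%R := powR_ge0 x y.
have [->|u0] := posnP u.
  apply: (@le_trans _ _ (2 * b)%:E); last first.
    by rewrite lee_fin powR1 mulr1 /H; nra.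
  rewrite -[leRHS]mule1 -(probability_setT P) -integral_cst//.
  apply: ge0_le_integral => //.
  - by move=> w _; rewrite lee_fin !addr_ge0// mulr_ge0.
  - apply/measurable_EFinP.
    exact: (measurable_xisum 0 0 (fun v => `|dev 0 v| `^ p + b * `|dev 0 v| `^ (p - 2) + b)%R).
  move=> w _; rewrite lee_fin /dev /xisum big_ord0 mulr0 subrr normr0 powR0; last by lra.
  (* For [p = 2] this is [powR] of 0 at exponent 0, which equals 1. *)
  have : ((0 : R) `^ (p - 2) <= 1)%R.
    by rewrite /powR eqxx; case: (_ == _).
  by move=> h; rewrite add0r; nra.
pose t : R := (kap * u%:R)%R.
have uR : (0 < u%:R :> R)%R by rewrite ltr0n.
have t0 : (0 < t)%R by rewrite mulr_gt0.
have tq0 : (0 <= b * t `^ (q - 1) + b)%R by rewrite addr_ge0// mulr_ge0.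
have bt0 : (0 <= 1 + b * t^-1)%R by rewrite addr_ge0// mulr_ge0// invr_ge0 ltW.
apply: (@le_trans _ _ (\int[P]_w ((1 + b * t^-1) * `|dev u (xisum D 0 u w)| `^ p +
   (b * t `^ (q - 1) + b))%:E)).
  apply: ge0_le_integral => //.
  - by move=> w _; rewrite lee_fin !addr_ge0// mulr_ge0.
  - apply/measurable_EFinP.
    exact: (measurable_xisum 0 u (fun v => `|dev u v| `^ p + b * `|dev u v| `^ (p - 2) + b)%R).
  - apply/measurable_EFinP.
    exact: (measurable_xisum 0 u (fun v => (1 + b * t^-1) * `|dev u v| `^ p +
      (b * t `^ (q - 1) + b))%R).
  move=> w _; rewrite lee_fin.
  have := powR_interpolate p2 t0 (normr_ge0 (dev u (xisum D 0 u w))).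
  move=> /(ler_wpM2l b0); rewrite -/q; lra.
rewrite integral_affine//; last exact: (measurable_xisum 0 u (fun v => `|dev u v| `^ p)%R).
apply: (@le_trans _ _ ((1 + b * t^-1) * (H * u%:R `^ q) + (b * t `^ (q - 1) + b))%:E).
  rewrite [leRHS]EFinD [in leRHS]EFinM; apply: leeD => //.
  by apply: lee_wpmul2l => //; rewrite lee_fin.
rewrite lee_fin.
have := powR_succ_ge q1 u0; move=> /(ler_wpM2l H0); apply: le_trans.
have -> : (u%:R `^ q = u%:R * u%:R `^ (q - 1) :> R)%R.
  by rewrite mulr_powRB1//; lra.
have -> : (t `^ (q - 1) = kap `^ (q - 1) * u%:R `^ (q - 1))%R.
  by rewrite powRM// ltW.
set U := (u%:R `^ (q - 1))%R.
have U1 : (1 <= U)%R.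
  rewrite /U -[leLHS](powRr0 u%:R); apply: ler_powR; last by lra.
  by rewrite ler1n.
have -> : ((1 + b * t^-1) * (H * (u%:R * U)) = H * (u%:R * U) + b / kap * H * U)%R.
  by rewrite /t; field; rewrite !gt_eqF.
have hk : (b / kap * H <= 2^-1 * H)%R.
  by rewrite ler_wpM2r// ler_pdivrMr// /kap; lra.
have := ler_wpM2r (le_trans ler01 U1) hk.
have : (b <= b * U)%R by rewrite ler_peMr.
rewrite /H mulrDr; nra.
Qed.

End SumMoments.

Section OneStepBounds.
Context {d : measure_display} {T : measurableType d} {R : realType}.
Context {P : probability T R}.
Variable D : cbp P.
Local Open Scope ereal_scope.

Notation dm := (dmeas (devents D)).

Definition obs_phi (o : nat * nat * nat * nat) : nat :=
  (o.1.1.1 * o.1.2 + o.1.1.2)%N.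

Definition bad1 (eps : R) (k : nat) : set (nat * nat * nat * nat) :=
  [set o | (`|(obs_phi o)%:R / k%:R - lambda D * (o.1.1.1)%:R| > eps)%R].

Definition bad2 (eps : R) (k : nat) : set (nat * nat * nat * nat) :=
  [set o | (`|(o.2)%:R / k%:R - m D * lambda D * (o.1.1.1)%:R| > eps)%R].

Definition bad3 (eps : R) (k : nat) : set (nat * nat * nat * nat) :=
  [set o | obs_phi o = 0%N \/
    ((0 < obs_phi o)%N /\ (`|(o.2)%:R / (obs_phi o)%:R - m D| > eps)%R)].

Lemma dm_phi n k : dm (ctl_slot n `|` ell_slots n) (phi D n k).
Proof.
exact: (dmeas_comp (fun z : nat * nat * nat => z.1.1 * z.2 + z.1.2)%N
  (dm_ctl_Lsum D n k)).
Qed.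

Lemma phi_meas n k Y : measurable (phi D n k @^-1` Y).
Proof. exact: (dm_meas D Y (dm_phi n k)). Qed.

Lemma measurable_phi_fun n k {d'} {T' : measurableType d'} (g : nat -> T') :
  measurable_fun setT (fun w => g (phi D n k w)).
Proof.
exact: (@measurable_discrete _ _ _ (phi D n k) _ _ g (fun s => phi_meas n k [set s])).
Qed.

Lemma measurable_obs_fun n k {d'} {T' : measurableType d'}
    (g : nat * nat * nat * nat -> T') :
  measurable_fun setT (fun w => g (obs D n k w)).
Proof.
exact: (@measurable_discrete _ _ _ (obs D n k) _ _ g (fun s => obs_meas D n k [set s])).
Qed.

Lemma prob_phi_xisum k (Y : nat -> set nat) :
  P [set w | Y (phi D 0 k w) (step D 0 k w)] =
  \sum_(u <oo) P (phi D 0 k @^-1` [set u]) * P (xisum D 0 u @^-1` Y u).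
Proof.
rewrite [LHS](prob_freeze (devents_indep D) (devents_setT D) (devents_setI D)
  (devents_meas D) (h := fun u w => (u, xisum D 0 u w))
  [set z | Y z.1 z.2] (dis_xi 0%N) (dm_phi 0%N k))// => u.
refine (dmeas_comp (pair u) (dm_xisum D 0%N u)).
Qed.

Lemma xisum_tail p H u t :
  (forall u : nat, \int[P]_w (`|dev D u (xisum D 0 u w)| `^ p)%:E <=
     (H * u%:R `^ (p / 2))%:E) -> (0 < p)%R -> (0 < t)%R ->
  P [set w | (t <= `|dev D u (xisum D 0 u w)|)%R] <= (t `^ (- p) * (H * u%:R `^ (p / 2)))%:E.
Proof.
move=> hH p0 t0.
have mg : measurable_fun setT (fun w => `|dev D u (xisum D 0 u w)| `^ p)%R.
  exact: (measurable_xisum D 0 u (fun v => `|dev D u v| `^ p)%R).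
have tp0 : (0 < t `^ p)%R by rewrite powR_gt0.
have pw0 w : (0 <= `|dev D u (xisum D 0 u w)| `^ p)%R := powR_ge0 _ _.
have -> : [set w | (t <= `|dev D u (xisum D 0 u w)|)%R] =
    [set w | (t `^ p <= `|dev D u (xisum D 0 u w)| `^ p)%R].
  apply/seteqP; split=> w /= h.
    by apply: ge0_ler_powR => //; rewrite ?nnegrE ?(ltW t0) ?(ltW p0).
  rewrite leNgt; apply/negP => h'; move: h; apply/negP; rewrite -ltNge.
  by apply: gt0_ltr_powR => //; rewrite nnegrE// ltW.
apply: le_trans (markov_le P _ _ tp0 mg pw0) _.
rewrite EFinM powRN; apply: lee_wpmul2l => //.
by rewrite lee_fin invr_ge0 ltW.
Qed.

Variables (p q K : R).
Hypotheses (p2 : (2 <= p)%R) (qp : q = (p / 2)%R) (mb : moment_bounds D p q K).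

Let q1 : (1 <= q)%R. Proof. by rewrite qp ler_pdivlMr// mul1r. Qed.
Let pw0 (x y : R) : (0 <= x `^ y)%R := powR_ge0 x y.

Lemma phi_moments : exists2 C : R, (0 <= C)%R & forall k, (0 < k)%N ->
  [/\ \int[P]_w ((phi D 0 k w)%:R `^ q)%:E <= (C * k%:R `^ q)%:E,
      \int[P]_w (`|(phi D 0 k w)%:R - lambda D * (A D 0 w)%:R * k%:R| `^ p)%:E <=
        (C * k%:R `^ q)%:E,
      P [set w | phi D 0 k w = 0%N] <= (C * k%:R `^ (- q))%:E &
      \int[P]_(w in [set w | (0 < phi D 0 k w)%N]) ((phi D 0 k w)%:R `^ (- q))%:E <=
        (C * k%:R `^ (- q))%:E].
Proof.
have [_ h1 h2] := mb; have q1' := q1.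
(* [K] comes without a sign, hence the absolute value; the factor 2 uses that [k^q >= 1]. *)
exists (2 * `|K|)%R; first by rewrite mulr_ge0.
move=> k k0; have /= {}h1 := h1 k k0; have {}h2 := h2 k k0.
rewrite unlock in h1.
have kq : (1 <= k%:R `^ q :> R)%R.
  by rewrite -[leLHS](powRr0 k%:R); apply: ler_powR; rewrite ?ler1n//; lra.
have le1 : (K * (1 + k%:R `^ q) <= 2 * `|K| * k%:R `^ q)%R.
  by have := ler_norm K; have := normr_ge0 K; nra.
have le2 : (K * k%:R `^ (- q) <= 2 * `|K| * k%:R `^ (- q))%R.
  by apply: ler_wpM2r => //; have := ler_norm K; have := normr_ge0 K; lra.
have a0 : 0 <= \int[P]_w ((phi D 0 k w)%:R `^ q)%:E.
  by apply: integral_ge0 => w _; rewrite lee_fin.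
have b0 : 0 <= \int[P]_w (`|(phi D 0 k w)%:R - lambda D * (A D 0 w)%:R * k%:R| `^ p)%:E.
  by apply: integral_ge0 => w _; rewrite lee_fin.
have c0 : 0 <= \int[P]_(w in [set w | (0 < phi D 0 k w)%N])
    ((phi D 0 k w)%:R `^ (- q))%:E.
  by apply: integral_ge0 => w _; rewrite lee_fin.
move: le1 le2; rewrite -!lee_fin => le1 le2.
split.
- by apply: le_trans le1; apply: le_trans h1; rewrite leeDl.
- by apply: le_trans le1; apply: le_trans h1; rewrite leeDr.
- by apply: le_trans le2; apply: le_trans h2; rewrite leeDl.
- by apply: le_trans le2; apply: le_trans h2; rewrite leeDr.
Qed.

Let powNp k : (0 < k)%N -> (k%:R `^ (- p) * k%:R `^ q = k%:R `^ (- q) :> R)%R.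
Proof.
move=> k0; rewrite -powRD; last by rewrite pnatr_eq0 -lt0n k0 implybT.
by congr (_ `^ _)%R; rewrite qp; field.
Qed.

(** Markov's inequality at order [p], using [p = 2 q]. The dependence on [delta] is explicit because
    [step_inv_moment] later lets the level shrink with [k]. *)
Lemma bad1_bound : exists2 C : R, (0 <= C)%R & forall (delta : R) k, (0 < delta)%R ->
  (0 < k)%N -> P (obs D 0 k @^-1` bad1 delta k) <=
  (C * delta `^ (- p) * k%:R `^ (- q))%:E.
Proof.
have [C C0 hC] := phi_moments; have p2' := p2; exists C => // delta k d0 k0.
have kR : (0 < k%:R :> R)%R by rewrite ltr0n.
pose g (o : nat * nat * nat * nat) : R :=
  (`|(obs_phi o)%:R - lambda D * (o.1.1.1)%:R * k%:R| `^ p)%R.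
have t0 : (0 < (delta * k%:R) `^ p)%R by rewrite powR_gt0// mulr_gt0.
apply: (@le_trans _ _ (P [set w | ((delta * k%:R) `^ p <= g (obs D 0 k w))%R])).
  apply: prob_le.
  - exact: obs_meas.
  - exact: (obs_meas D 0 k [set o | ((delta * k%:R) `^ p <= g o)%R]).
  move=> w /= h; apply: ge0_ler_powR; rewrite ?nnegrE ?mulr_ge0 ?(ltW d0)//; first by lra.
  apply: ltW; rewrite -ltr_pdivlMr// -[(k%:R^-1)%R]gtr0_norm ?invr_gt0// -normrM.
  by rewrite mulrBl mulfK ?gt_eqF.
apply: le_trans (markov_le P _ _ t0 (measurable_obs_fun 0 k g) _) _; first by move=> w; exact: pw0.
have [_ h _ _] := hC k k0.
apply: (@le_trans _ _ (((delta * k%:R) `^ p)^-1%:E * (C * k%:R `^ q)%:E)).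
  by apply: lee_wpmul2l => //; rewrite lee_fin invr_ge0 ltW.
rewrite -EFinM lee_fin -powRN powRM ?(ltW d0)// -(powNp k k0).
by rewrite le_eqVlt; apply/orP; left; apply/eqP; ring.
Qed.

(** The deviation is the centred offspring sum over [k], plus [m] times the deviation of [bad1];
    each receives half of [delta]. Given [N = u] the first has [p]-th moment of order [u^q], and
    averaging over [u] uses the moment of order [q] of [N]. *)
Lemma bad2_bound : exists2 C : R, (0 <= C)%R & forall (delta : R) k, (0 < delta)%R ->
  (0 < k)%N -> P (obs D 0 k @^-1` bad2 delta k) <=
  (C * delta `^ (- p) * k%:R `^ (- q))%:E.
Proof.
have [C1 C10 hC1] := bad1_bound; have [C C0 hC] := phi_moments.
have [fin _ _] := mb; have [H H0 hH] := xisum_moment D p p2 fin.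
have m0 := m_gt0 D; have p2' := p2.
pose D1 := (C1 * (2 * m D)^-1 `^ (- p) + 2^-1 `^ (- p) * H * C)%R.
exists D1; first by rewrite /D1 addr_ge0// !mulr_ge0.
move=> delta k d0 k0.
have kR : (0 < k%:R :> R)%R by rewrite ltr0n.
pose Y u : set nat := [set v | (delta * k%:R / 2 <= `|dev D u v|)%R].
have t0 : (0 < delta * k%:R / 2)%R by rewrite divr_gt0// mulr_gt0.
have mY : measurable [set w | Y (phi D 0 k w) (step D 0 k w)].
  exact: (obs_meas D 0 k [set o | Y (obs_phi o) o.2]).
apply: (@le_trans _ _ (P (obs D 0 k @^-1` bad1 (delta / (2 * m D)) k) +
    P [set w | Y (phi D 0 k w) (step D 0 k w)])).
  apply: le_trans (measureU2 _ _ _) => //; last exact: obs_meas.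
  apply: prob_le; [exact: obs_meas|by apply: measurableU => //; exact: obs_meas|].
  move=> w; rewrite /bad2 /bad1 /= => h.
  have [h1|h1] := ltP (delta / (2 * m D))%R
    `|(obs_phi (obs D 0 k w))%:R / k%:R - lambda D * (A D 0 w)%:R|%R; first by left.
  right; rewrite /Y /= -ler_pdivlMr//.
  have E : ((step D 0 k w)%:R / k%:R - m D * lambda D * (A D 0 w)%:R =
      dev D (phi D 0 k w) (step D 0 k w) / k%:R +
      m D * ((phi D 0 k w)%:R / k%:R - lambda D * (A D 0 w)%:R) :> R)%R.
    by rewrite /dev; field; rewrite gt_eqF.
  move: h; rewrite E => h; have := le_lt_trans _ (lt_le_trans h (ler_normD _ _)).
  rewrite !normrM (gtr0_norm m0) normfV (gtr0_norm kR) => /(_ _ (lexx _)) h2.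
  have h1' : (`|(phi D 0 k w)%:R / k%:R - lambda D * (A D 0 w)%:R| <= delta / (2 * m D))%R.
    exact: h1.
  have := ler_wpM2l (ltW m0) h1'.
  rewrite (_ : (m D * (delta / (2 * m D)) = delta / 2)%R); last by field; rewrite gt_eqF.
  rewrite ler_pdivlMr// => h3.
  rewrite -(@ler_pM2r _ k%:R^-1)%R ?invr_gt0//.
  by rewrite (_ : (delta * k%:R / 2 / k%:R = delta / 2)%R); [lra|field; rewrite gt_eqF].
have b1 : P (obs D 0 k @^-1` bad1 (delta / (2 * m D)) k) <=
    (C1 * (2 * m D)^-1 `^ (- p) * delta `^ (- p) * k%:R `^ (- q))%:E.
  have d1 : (0 < delta / (2 * m D))%R by rewrite divr_gt0// mulr_gt0.
  apply: le_trans (hC1 _ k d1 k0) _; rewrite lee_fin powRM ?(ltW d0)//.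
    by rewrite le_eqVlt; apply/orP; left; apply/eqP; ring.
  by rewrite invr_ge0 mulr_ge0// ltW.
have b2 : P [set w | Y (phi D 0 k w) (step D 0 k w)] <=
    (2^-1 `^ (- p) * H * C * delta `^ (- p) * k%:R `^ (- q))%:E.
  rewrite prob_phi_xisum.
  pose c := ((delta * k%:R / 2) `^ (- p) * H)%R.
  have c0 : (0 <= c)%R by rewrite mulr_ge0.
  apply: (@le_trans _ _ (\sum_(u <oo) P (phi D 0 k @^-1` [set u]) *
      (c * u%:R `^ q)%:E)).
    apply: lee_nneseries => u _; first by rewrite mule_ge0.
    apply: lee_wpmul2l => //; rewrite /c -mulrA qp.
    by apply: (xisum_tail p H u _ hH) => //; lra.
  rewrite -(@integral_nat _ _ _ P (phi D 0 k) (fun u => (c * u%:R `^ q)%:E)); last 2 first.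
  - by move=> n; exact: phi_meas.
  - by move=> n; rewrite lee_fin mulr_ge0.
  under eq_integral do rewrite EFinM.
  rewrite ge0_integralZl_EFin//; last first.
    by apply/measurable_EFinP; exact: (measurable_phi_fun 0 k (fun u => u%:R `^ q)%R).
  have [h _ _ _] := hC k k0.
  apply: (@le_trans _ _ (c%:E * (C * k%:R `^ q)%:E)).
    by apply: lee_wpmul2l => //; rewrite lee_fin.
  rewrite -EFinM lee_fin /c -(powNp k k0).
  rewrite !powRM ?(ltW d0) ?invr_ge0 ?mulr_ge0 ?(ltW d0)//.
  by rewrite le_eqVlt; apply/orP; left; apply/eqP; ring.
apply: le_trans (leeD b1 b2) _; rewrite -EFinD lee_fin /D1.
by rewrite le_eqVlt; apply/orP; left; apply/eqP; ring.
Qed.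

(** The offspring deviation is measured against [N] itself, so given [N = u > 0] its tail is of
    order [u^(- q)]. This is where the negative moment of [N] enters. *)
Lemma bad3_bound (delta : R) : (0 < delta)%R ->
  exists2 C : R, (0 <= C)%R & forall k,
  (0 < k)%N -> P (obs D 0 k @^-1` bad3 delta k) <= (C * k%:R `^ (- q))%:E.
Proof.
move=> d0; have [C C0 hC] := phi_moments; have p2' := p2.
have [fin _ _] := mb; have [H H0 hH] := xisum_moment D p p2 fin.
exists (C + delta `^ (- p) * H * C)%R; first by rewrite addr_ge0// !mulr_ge0.
move=> k k0; have [_ _ h3 h4] := hC k k0.
pose Y u : set nat := [set v | (0 < u)%N /\ (delta * u%:R <= `|dev D u v|)%R].
have mY : measurable [set w | Y (phi D 0 k w) (step D 0 k w)].
  exact: (obs_meas D 0 k [set o | Y (obs_phi o) o.2]).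
have m0 : measurable [set w | phi D 0 k w = 0%N].
  exact: (phi_meas 0 k [set 0%N]).
apply: (@le_trans _ _ (P [set w | phi D 0 k w = 0%N] +
    P [set w | Y (phi D 0 k w) (step D 0 k w)])).
  apply: le_trans (measureU2 _ _ _) => //.
  apply: prob_le; [exact: obs_meas|exact: measurableU|].
  move=> w [h|[u0 h]]; [by left|right; split=> //].
  have uR : (0 < (phi D 0 k w)%:R :> R)%R by rewrite ltr0n.
  rewrite -ler_pdivlMr// -[((phi D 0 k w)%:R^-1)%R]gtr0_norm ?invr_gt0// -normrM.
  by rewrite /dev mulrBl mulfK ?gt_eqF// ltW.
rewrite mulrDl EFinD; apply: leeD => //.
rewrite prob_phi_xisum.
pose c := (delta `^ (- p) * H)%R.
have c0 : (0 <= c)%R by rewrite mulr_ge0.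
pose g u : R := if (0 < u)%N then (u%:R `^ (- q))%R else 0%R.
have g0 u : (0 <= g u)%R by rewrite /g; case: ifP.
apply: (@le_trans _ _ (\sum_(u <oo) P (phi D 0 k @^-1` [set u]) * (c * g u)%:E)).
  apply: lee_nneseries => u _; first by rewrite mule_ge0.
  apply: lee_wpmul2l => //; rewrite /g; case: ifPn => [u0|u0]; last first.
    rewrite (_ : _ @^-1` _ = set0) ?measure0 ?mulr0//.
    by apply/seteqP; split=> // w [u0']; rewrite u0' in u0.
  have uR : (0 < u%:R :> R)%R by rewrite ltr0n.
  apply: (@le_trans _ _ (P [set w | (delta * u%:R <= `|dev D u (xisum D 0 u w)|)%R])).
    apply: prob_le; [exact: xisum_meas|exact: (xisum_meas D 0 u [set v | (delta * u%:R <= `|dev D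
      u v|)%R])|].
    by move=> w [].
  have t0 : (0 < delta * u%:R)%R by rewrite mulr_gt0.
  have p0 : (0 < p)%R by lra.
  apply: le_trans (xisum_tail p H u _ hH p0 t0) _.
  rewrite lee_fin /c -qp -(powNp u u0) powRM ?(ltW d0)//.
  by rewrite le_eqVlt; apply/orP; left; apply/eqP; ring.
rewrite -(@integral_nat _ _ _ P (phi D 0 k) (fun u => (c * g u)%:E)); last 2 first.
- by move=> n; exact: phi_meas.
- by move=> n; rewrite lee_fin mulr_ge0.
under eq_integral do rewrite EFinM.
rewrite ge0_integralZl_EFin//; last 2 first.
- by move=> w _; exact: g0.
- by apply/measurable_EFinP; exact: (measurable_phi_fun 0 k g).
rewrite -mulrA -/c [leRHS]EFinM; apply: lee_wpmul2l; first by rewrite lee_fin.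
apply: le_trans h4.
rewrite [leRHS]integral_mkcond le_eqVlt; apply/orP; left; apply/eqP.
apply: eq_integral => w _; rewrite /g patchE.
by case: ifPn => [u0|u0]; [rewrite mem_set|rewrite memNset//=; exact/negP].
Qed.

End OneStepBounds.

(** * The nondecreasing case *)

Section ProductFormula.
Context {d : measure_display} {T : measurableType d} {R : realType}.
Variable P : probability T R.
Variables (I : eqType) (F : I -> set (set T)).

Hypothesis indepF : mutually_independent P F.
Hypothesis F_setT : forall k, F k setT.
Hypothesis F_setI : forall k, setI_closed (F k).
Hypothesis F_meas : forall k, F k `<=` measurable.

(** A sum of naturals vanishes exactly when all its terms do, so this is the product formula for a
    conjunction. It is applied to [xi] and to the indicators of [xi] or [ell] differing from 1. *)
Lemma prob_sum_eq0 (e : nat -> I) (f : nat -> T -> nat) (a : R) u : injective e ->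
  (forall j, dmeas F [set e j] (f j)) -> (forall j, P (f j @^-1` [set 0%N]) = a%:E) ->
  P [set w | (\sum_(j < u) f j w = 0)%N] = (a ^+ u)%:E.
Proof.
move=> ie mf fa; elim: u => [|u IH].
  rewrite (_ : [set w | _] = setT) ?probability_setT//.
  by apply/seteqP; split=> // w _ /=; rewrite big_ord0.
have dis : [set e j | j in [set j | (j < u)%N]] `&` [set e u] = set0.
  by apply/seteqP; split=> // _ [[j /= ju <-] /ie jE]; rewrite jE ltnn in ju.
have part : dmeas F [set e j | j in [set j | (j < u)%N]] (fun w => \sum_(j < u) f j w)%N.
  apply: dmeas_sum => // j ju.
  by refine (sub_dmeas (mf j) _) => _ ->; exists j.
have := dmeas_indep indepF F_setT F_setI F_meas [set 0%N] [set 0%N] dis part (mf u).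
rewrite fa [X in (X * _)%E]IH -EFinM -exprSr => <-; congr (P _).
apply/seteqP; split=> w /=; rewrite big_ord_recr /=.
  by move/eqP; rewrite addn_eq0 => /andP[/eqP-> /eqP->].
by move=> [-> ->].
Qed.

End ProductFormula.

Section AlmostSure.
Context {d : measure_display} {T : measurableType d} {R : realType}.
Variable P : probability T R.

Lemma prob_le_null (E F Z : set T) : measurable E -> measurable F -> measurable Z ->
  P Z = 0%E -> E `<=` F `|` Z -> (P E <= P F)%E.
Proof.
move=> mE mF mZ PZ EFZ.
apply: (@le_trans _ _ (P (F `|` Z))).
  by apply: prob_le => //; exact: measurableU.
by rewrite -[leRHS]adde0 -PZ; exact: measureU2.
Qed.

(** Off the null event [V = 0], the sum of [V] and the indicator of [V = 1] is at least 2. *)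
Lemma mean_ge_nat (V : T -> nat) (mu : R) :
  (forall n, measurable (V @^-1` [set n])) -> P (V @^-1` [set 0%N]) = 0%E ->
  (\int[P]_w ((V w)%:R)%:E)%E = mu%:E ->
  2 - fine (P (V @^-1` [set 1%N])) <= mu.
Proof.
move=> mV P0 EV.
have mV1 : measurable (V @^-1` [set 1%N]) by [].
have mD : measurable (~` (V @^-1` [set 0%N])) by exact: measurableC.
have mg (g : nat -> \bar R) : measurable_fun setT (fun w => g (V w)).
  exact: measurable_discrete.
have pD : P (~` (V @^-1` [set 0%N])) = 1%E.
  rewrite probability_setC//; transitivity (1 - 0 : \bar R)%E; last by rewrite sube0.
  by congr (_ - _)%E.
have h1 : ((2 : R)%:E <= \int[P]_w (((V w)%:R)%:E + (\1_(V @^-1` [set 1%N]) w)%:E))%E.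
  apply: (@le_trans _ _ (\int[P]_(w in ~` (V @^-1` [set 0%N]))
      (((V w)%:R)%:E + (\1_(V @^-1` [set 1%N]) w)%:E))%E).
    have -> : ((2 : R)%:E = \int[P]_(w in ~` (V @^-1` [set 0%N])) (cst (2 : R)%:E) w)%E.
      by rewrite integral_cst//; transitivity ((2 : R)%:E * 1)%E; [rewrite mule1|congr (_ * _)%E].
    apply: ge0_le_integral => //.
    - by move=> w _; rewrite lee_fin.
    - apply: measurable_funTS; apply: emeasurable_funD; first exact: (mg (fun n => (n%:R)%:E)).
      by apply/measurable_EFinP; exact: measurable_indic.
    move=> w /= /eqP Vw; rewrite -EFinD lee_fin indicE.
    have [V1|V1] := eqVneq (V w) 1%N; first by rewrite mem_set//= V1.
    rewrite memNset/=; last by move/eqP; apply/negP.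
    rewrite addr0 ler_nat; case: (V w) Vw V1 => [|[|]]//.
  apply: ge0_subset_integral => //.
  - apply: emeasurable_funD; first exact: (mg (fun n => (n%:R)%:E)).
    by apply/measurable_EFinP; exact: measurable_indic.
  - by move=> w _; rewrite adde_ge0// lee_fin.
move: h1; rewrite ge0_integralD//; last 2 first.
- exact: (mg (fun n => (n%:R)%:E)).
- by apply/measurable_EFinP; exact: measurable_indic.
rewrite EV integral_indic// setIT => h.
have pf : P (V @^-1` [set 1%N]) \is a fin_num by exact: fin_num_measure.
by move: h; rewrite -[X in (_ + X)%E](fineK pf) -EFinD lee_fin; lra.
Qed.

End AlmostSure.

Section NondecreasingCase.
Context {d : measure_display} {T : measurableType d} {R : realType}.
Context {P : probability T R}.
Variable D : cbp P.

Notation dm := (dmeas (devents D)).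

Definition prob_xi1 : R := fine (P [set w | xi D 0 0 w = 1%N]).
Definition prob_ell1 : R := fine (P [set w | ell D 0 0 w = 1%N]).
Definition prob_ctl10 : R := fine (P [set w | A D 0 w = 1%N /\ B D 0 w = 0%N]).

Lemma ell_meas n j Y : measurable (ell D n j @^-1` Y).
Proof. exact: (dm_meas D Y (dm_ell D (J := setT) I)). Qed.

Lemma ctl_meas n Y : measurable (ctl D n @^-1` Y).
Proof. exact: (dm_meas D Y (dm_ctl D (J := setT) I)). Qed.

Lemma prob_xi_all (c : nat -> nat) u :
  P [set w | (\sum_(j < u) c (xi D 0 j w) = 0)%N] =
  (fine (P [set w | c (xi D 0 0 w) = 0%N]) ^+ u)%:E.
Proof.
refine (prob_sum_eq0 P driving_index (devents D) (devents_indep D) (devents_setT D)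
  (devents_setI D) (devents_meas D) (fun j => inl (inl (0%N, j)))
  (fun j w => c (xi D 0 j w)) _ u _ _ _).
- by move=> i j [].
- by move=> j; apply: (dmeas_comp c); exact: dm_xi.
- move=> j; rewrite fineK; last by apply: fin_num_measure; exact: (xi_meas D 0 0 [set x | c x =
    0%N]).
  exact: (eqlaw_xi D 0 j 0 0 [set x | c x = 0%N]).
Qed.

Lemma prob_ell_all (c : nat -> nat) u :
  P [set w | (\sum_(j < u) c (ell D 0 j w) = 0)%N] =
  (fine (P [set w | c (ell D 0 0 w) = 0%N]) ^+ u)%:E.
Proof.
refine (prob_sum_eq0 P driving_index (devents D) (devents_indep D) (devents_setT D)
  (devents_setI D) (devents_meas D) (fun j => inl (inr (0%N, j)))
  (fun j w => c (ell D 0 j w)) _ u _ _ _).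
- by move=> i j [].
- by move=> j; apply: (dmeas_comp c); exact: dm_ell.
- move=> j; rewrite fineK; last by apply: fin_num_measure; exact: (ell_meas 0 0 [set x | c x =
    0%N]).
  exact: (eqlaw_ell D 0 j 0 0 [set x | c x = 0%N]).
Qed.

Lemma prob_xisum_ell (a : nat) (Y : set nat) :
  P [set w | Y (\sum_(r < a * ell D 0 0 w) xi D 0 r w)%N] =
  (\sum_(l <oo) P (ell D 0 0 @^-1` [set l]) * P (xisum D 0 (a * l) @^-1` Y))%E.
Proof.
have dis : ell_slots 0%N `&` xi_slots 0%N = set0.
  by apply/seteqP; split=> // k [[? ->] []].
apply: (prob_freeze (devents_indep D) (devents_setT D) (devents_setI D)
  (devents_meas D) (f := ell D 0 0) (h := fun l => xisum D 0 (a * l)) Y dis).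
- by apply: dm_ell; exists 0%N.
- by move=> l; exact: dm_xisum.
Qed.

Lemma nneseries_eq0 (u : nat -> \bar R) n : (forall k, 0 <= u k)%E ->
  (\sum_(k <oo) u k = 0)%E -> u n = 0%E.
Proof.
move=> u0 us; apply/eqP; rewrite eq_le u0 andbT -us.
apply: le_trans (nneseries_lim_ge (m := 0%N) n.+1 _) => //.
rewrite big_nat_recr//= leeDr// sume_ge0//.
Qed.

Hypothesis H1 : condH1 D.

(** At a single environment with [p_0 = 0], split the composite offspring number over [ell = l]. The
    term [l = 0] gives the claim for [ell]; any [l] of positive probability gives that a power of
    [P(xi = 0)] is 0. *)
Lemma positive_offspring : P [set w | xi D 0 0 w = 0%N] = 0%E /\
  P [set w | ell D 0 0 w = 0%N] = 0%E.
Proof.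
have [[Z [mZ PZ subZ]] _] := H1.
have [w Zw] : exists w, ~ Z w.
  apply: contrapT => /forallNP h.
  have : P setT = 0%E.
    rewrite -PZ; congr (P _); apply/seteqP; split=> // w _.
    by apply: contrapT => /(h w).
  by rewrite probability_setT => /eqP; rewrite onee_eq0.
have /= : offspring_pr D 0 w = 0 by apply: contrapT => hw; apply: Zw; exact: subZ.
rewrite /offspring_pr /offspring_law; set a := A D 0 w => offs.
have a0 : (0 < a)%N by exact: A_gt0.
have mS : measurable [set w | (\sum_(r < a * ell D 0 0 w) xi D 0 r w)%N = 0%N].
  have dis : ell_slots 0%N `|` xi_slots 0%N `<=` setT by [].
  have mm : dm setT (fun w => \sum_(r < a * ell D 0 0 w) xi D 0 r w)%N.
    apply: (dmeas_diag (h := fun l => xisum D 0 (a * l))); first exact: dm_ell.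
    by move=> l; refine (sub_dmeas (dm_xisum D 0%N _) _).
  exact: (dm_meas D [set 0%N] mm).
have off0 : P [set w | (\sum_(r < a * ell D 0 0 w) xi D 0 r w)%N = 0%N] = 0%E.
  by rewrite -[LHS]fineK ?fin_num_measure//; congr (_%:E).
rewrite (prob_xisum_ell a [set 0%N]) in off0.
have term l := nneseries_eq0 _ l (fun k => mule_ge0 (measure_ge0 P _) (measure_ge0 P _)) off0.
have ell0 : P [set w | ell D 0 0 w = 0%N] = 0%E.
  have := term 0%N; rewrite muln0.
  rewrite [X in (_ * P X)%E](_ : _ = setT) ?probability_setT ?mule1//.
  by apply/seteqP; split=> // w' _ /=; rewrite /xisum big_ord0.
split=> //.
have [l Pl] : exists l, P (ell D 0 0 @^-1` [set l]) != 0%E.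
  apply: contrapT => /forallNP h.
  have : P setT = 0%E.
    rewrite (prob_fibers_nat P (V := ell D 0 0))//; last by move=> n; exact: ell_meas.
    rewrite eseries0// => k _ _; rewrite setTI.
    by apply/eqP; apply: contrapT => hk; apply: (h k); exact/negP.
  by rewrite probability_setT => /eqP; rewrite onee_eq0.
have := term l => /eqP; rewrite mule_eq0 (negbTE Pl)/= => /eqP.
rewrite [X in X = _ -> _](prob_xi_all id) => -[].
move/eqP; rewrite expf_eq0 => /andP[_ /eqP h].
rewrite -[LHS]fineK ?h//; apply: fin_num_measure; exact: (xi_meas D 0 0 [set 0%N]).
Qed.

(** Only generation 0 is covered: the Markov property transfers every one-step estimate to that
    generation. *)
Definition null_set : set T :=
  (\bigcup_j (xi D 0 j @^-1` [set 0%N])) `|` (\bigcup_j (ell D 0 j @^-1` [set 0%N])).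

Lemma null_set_meas : measurable null_set.
Proof.
by apply: measurableU; apply: bigcup_measurable => j _; [exact: xi_meas|exact: ell_meas].
Qed.

Lemma null_set0 : P null_set = 0%E.
Proof.
have [xi0 ell0] := positive_offspring.
apply/eqP; rewrite eq_le measure_ge0 andbT.
apply: le_trans (measureU2 _ _ _) _.
- by apply: bigcup_measurable => j _; exact: xi_meas.
- by apply: bigcup_measurable => j _; exact: ell_meas.
have null0 (f : nat -> T -> nat) : (forall j, measurable (f j @^-1` [set 0%N])) ->
    (forall j, P (f j @^-1` [set 0%N]) = 0%E) -> P (\bigcup_j (f j @^-1` [set 0%N])) = 0%E.
  move=> mf f0; apply/eqP; rewrite eq_le measure_ge0 andbT.
  apply: le_trans (generalized_Boole_inequality P mf _) _.
    exact: bigcup_measurable.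
  by rewrite eseries0// => k _ _; exact: f0.
apply: (@le_trans _ _ (0 + 0)%E); last by rewrite adde0.
apply: leeD; rewrite le_eqVlt; apply/orP; left; apply/eqP.
- apply: (null0 (fun j => xi D 0 j)) => j; first exact: xi_meas.
  by rewrite (eqlaw_xi D 0 j 0 0).
- apply: (null0 (fun j => ell D 0 j)) => j; first exact: ell_meas.
  by rewrite (eqlaw_ell D 0 j 0 0).
Qed.

End NondecreasingCase.

Section NondecreasingStep.
Context {d : measure_display} {T : measurableType d} {R : realType}.
Context {P : probability T R}.
Variable D : cbp P.

Notation dm := (dmeas (devents D)).

Hypothesis H1 : condH1 D.

Lemma off_null w : ~ null_set D w -> forall j, (0 < xi D 0 j w)%N /\ (0 < ell D 0 j w)%N.
Proof.
move=> nw j; rewrite !lt0n; split; apply/eqP => h; apply: nw; [left|right]; by exists j.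
Qed.

(** Keeps count of the terms exceeding 1, so that equality of the sum with [k] forces every term to
    be 1. *)
Lemma sum_pos_ge (f : nat -> nat) k : (forall j, (0 < f j)%N) ->
  (k + \sum_(j < k) (f j != 1%N) <= \sum_(j < k) f j)%N.
Proof.
move=> f0; elim: k => [|k IH]; first by rewrite !big_ord0.
rewrite !big_ord_recr /=; have := f0 k; move: IH; case: eqP => /=; lia.
Qed.

Lemma xisum_ge w u : ~ null_set D w -> (u <= xisum D 0 u w)%N.
Proof.
move=> /off_null h; apply: leq_trans (sum_pos_ge (fun j => xi D 0 j w) u _).
  exact: leq_addr.
by move=> j; have [] := h j.
Qed.

Lemma phi_ge w k : ~ null_set D w -> (A D 0 w * k <= phi D 0 k w)%N.
Proof.
move=> /off_null h; apply: leq_trans (leq_addr _ _); rewrite leq_mul2l; apply/orP; right.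
apply: leq_trans (sum_pos_ge (fun j => ell D 0 j w) k _); first exact: leq_addr.
by move=> j; have [] := h j.
Qed.

Lemma step_ge w k : ~ null_set D w -> (A D 0 w * k <= step D 0 k w)%N.
Proof. by move=> nw; apply: leq_trans (phi_ge w k nw) (xisum_ge w _ nw). Qed.

Lemma step_ge_id w k : ~ null_set D w -> (k <= step D 0 k w)%N.
Proof.
by move=> nw; apply: leq_trans (step_ge w k nw); rewrite leq_pmull// A_gt0.
Qed.

Lemma step_meas n k Y : measurable (step D n k @^-1` Y).
Proof. exact: (dm_meas D Y (dm_step D n k)). Qed.

(** Off the null set, neither the [ell] stage nor the [xi] stage decreases the population. Staying
    at [k > 0] thus forces [A = 1], [B = 0] and [k] variables of each family equal to 1, which are
    independent requirements. *)
Lemma prob_step_diag k : (0 < k)%N -> (P [set w | step D 0 k w = k] <=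
  (prob_ctl10 D * (prob_ell1 D * prob_xi1 D) ^+ k)%:E)%E.
Proof.
move=> k0; pose c (x : nat) : nat := (x != 1%N).
pose Ec : set (nat * nat) := [set z | z.1 = 1%N /\ z.2 = 0%N].
pose fl w := (\sum_(j < k) c (ell D 0 j w))%N.
pose fx w := (\sum_(j < k) c (xi D 0 j w))%N.
have mfl : dm (ell_slots 0%N) fl.
  apply: (dmeas_sum (f := fun j w => c (ell D 0 j w))) => j _; apply: (dmeas_comp c).
  by apply: dm_ell; exists j.
have mfx : dm (xi_slots 0%N) fx.
  apply: (dmeas_sum (f := fun j w => c (xi D 0 j w))) => j _; apply: (dmeas_comp c).
  by apply: dm_xi; exists j.
have mctl : dm (ctl_slot 0%N) (ctl D 0) by exact: dm_ctl.
have mcl : dm (ctl_slot 0%N `|` ell_slots 0%N) (fun w => (ctl D 0 w, fl w)).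
  by apply: dmeas_pair; [refine (sub_dmeas mctl _) => ?; left|refine (sub_dmeas mfl _) => ?; right].
have cE1 (V : T -> nat) : [set w | c (V w) = 0%N] = [set w | V w = 1%N].
  by apply/seteqP; split=> w /=; rewrite /c; case: eqP.
have pl : P (fl @^-1` [set 0%N]) = (prob_ell1 D ^+ k)%:E.
  by rewrite [LHS](prob_ell_all D c k) cE1.
have px : P (fx @^-1` [set 0%N]) = (prob_xi1 D ^+ k)%:E.
  by rewrite [LHS](prob_xi_all D c k) cE1.
have pc : P (ctl D 0 @^-1` Ec) = (prob_ctl10 D)%:E.
  by rewrite fineK//; apply: fin_num_measure; exact: (ctl_meas D 0 Ec).
have i1 := dmeas_indep (devents_indep D) (devents_setT D) (devents_setI D)
  (devents_meas D) Ec [set 0%N] (dis_ctl_Lsum 0%N) mctl mfl.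
have i2 := dmeas_indep (devents_indep D) (devents_setT D) (devents_setI D)
  (devents_meas D) (Ec `*` [set 0%N]) [set 0%N] (dis_xi 0%N) mcl mfx.
have i1' : P ((fun w => (ctl D 0 w, fl w)) @^-1` (Ec `*` [set 0%N])) =
    (prob_ctl10 D * prob_ell1 D ^+ k)%:E.
  by rewrite EFinM -pc -pl; exact: i1.
have -> : (prob_ctl10 D * (prob_ell1 D * prob_xi1 D) ^+ k)%:E =
    P ((fun w => (ctl D 0 w, fl w)) @^-1` (Ec `*` [set 0%N]) `&` fx @^-1` [set 0%N]).
  by rewrite i2 i1' px -EFinM exprMn mulrA.
apply: (prob_le_null P _ _ (null_set D)).
- exact: (step_meas 0 k [set k]).
- apply: measurableI; first exact: (dm_meas D _ mcl).
  exact: (dm_meas D _ mfx).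
- exact: null_set_meas.
- exact: null_set0.
move=> w /= sk; have [nw|nw] := pselect (null_set D w); [by right|left].
have [h1 h2] : (forall j, (0 < ell D 0 j w)%N) /\ (forall j, (0 < xi D 0 j w)%N).
  by split=> j; have [] := off_null w nw j.
have s1 := sum_pos_ge _ k h1; have s2 := sum_pos_ge _ (phi D 0 k w) h2.
have A0 : (0 < A D 0 w)%N := A_gt0 D 0 w.
move: s1 s2 sk; rewrite /step -/(xisum D 0 _ w) -/(Lsum D 0 k w) => s1 s2 sk.
rewrite sk in s2.
have phiE : phi D 0 k w = (A D 0 w * Lsum D 0 k w + B D 0 w)%N by [].
have LA : (Lsum D 0 k w <= A D 0 w * Lsum D 0 k w)%N by rewrite leq_pmull.
have phik : phi D 0 k w = k by lia.
have Lk : Lsum D 0 k w = k by lia.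
have Ak : (A D 0 w * k <= k)%N by rewrite Lk in LA phiE; lia.
have A1 : A D 0 w = 1%N.
  by apply/eqP; rewrite eqn_leq A0 andbT -(leq_pmul2r k0) mul1n.
have B0 : B D 0 w = 0%N by rewrite A1 in phiE; lia.
split; last first.
  by move: s2; rewrite phik -[X in (_ <= X)%N]addn0 leq_add2l leqn0 => /eqP.
split; first by [].
by move: s1; rewrite Lk -[X in (_ <= X)%N]addn0 leq_add2l leqn0 => /eqP.
Qed.

Lemma off_null_Y (Y : nat -> Prop) (a : nat) :
  [set w | Y (\sum_(r < a * ell D 0 0 w) xi D 0 r w)%N] =
  [set w | Y (xisum D 0 (a * ell D 0 0 w) w)].
Proof. by []. Qed.

Lemma xisum_ell_meas a (Y : set nat) :
  measurable [set w | Y (xisum D 0 (a * ell D 0 0 w) w)].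
Proof.
have mm : dm setT (fun w => xisum D 0 (a * ell D 0 0 w) w).
  apply: (dmeas_diag (h := fun l => xisum D 0 (a * l))); first exact: dm_ell.
  by move=> l; refine (sub_dmeas (dm_xisum D 0%N _) _).
exact: (dm_meas D Y mm).
Qed.

Lemma prob_ell_xi1 :
  P [set w | ell D 0 0 w = 1%N /\ xi D 0 0 w = 1%N] = (prob_ell1 D * prob_xi1 D)%:E.
Proof.
have dis : ell_slots 0%N `&` xi_slots 0%N = set0.
  by apply/seteqP; split=> // k [[? ->] []].
have m1 : dm (ell_slots 0%N) (ell D 0 0) by apply: dm_ell; exists 0%N.
have m2 : dm (xi_slots 0%N) (xi D 0 0) by apply: dm_xi; exists 0%N.
have := dmeas_indep (devents_indep D) (devents_setT D) (devents_setI D)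
  (devents_meas D) [set 1%N] [set 1%N] dis m1 m2.
move=> i; rewrite EFinM !fineK; last 2 first.
- by apply: fin_num_measure; exact: (xi_meas D 0 0 [set 1%N]).
- by apply: fin_num_measure; exact: (ell_meas D 0 0 [set 1%N]).
exact: i.
Qed.

(** As [xi] and [ell] are positive, [h_0 > 0] forces [B = 0] and [p_1 > 0] forces [A = 1]. For
    [A = 1] the number [p_1] is [P(L = 1) P(xi = 1)], so the bounds on [p_1] pass to that
    product. *)
Lemma condH2_consequences : condH2 D ->
  0 < prob_ctl10 D /\ 0 < prob_ell1 D * prob_xi1 D < 1.
Proof.
move=> H2; rewrite /condH2 in H2.
set E := [set w | _] in H2.
have [w0 Ew0] : exists w, E w.
  apply: contrapT => /forallNP h; move: H2; rewrite (_ : E = set0) ?measure0 ?ltxx//.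
  by apply/seteqP; split=> // w /h.
have key w : E w -> [/\ A D 0 w = 1%N, B D 0 w = 0%N & 0 < prob_ell1 D * prob_xi1 D < 1].
  move=> [immig /andP[off0 off1]].
  have B0 : B D 0 w = 0%N.
    move: immig; rewrite /immigration_pr /immigration_law.
    have := prob_xi_all D id (B D 0 w) => /= ->.
    rewrite (positive_offspring D H1).1 /=; case: (B D 0 w) => //= b.
    by rewrite expr0n ltxx.
  rewrite /offspring_pr /offspring_law in off0 off1.
  rewrite (off_null_Y [set 1%N]) in off0 off1.
  have mS a := xisum_ell_meas a [set 1%N].
  have A1 : A D 0 w = 1%N.
    apply/eqP; rewrite eqn_leq A_gt0 andbT leqNgt; apply/negP => A2.
    suff h : (P [set w' | [set 1%N] (xisum D 0 (A D 0 w * ell D 0 0 w') w')] <= P set0)%E.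
      rewrite measure0 in h.
      have h0 : P [set w' | [set 1%N] (xisum D 0 (A D 0 w * ell D 0 0 w') w')] = 0%E.
        by apply/eqP; rewrite eq_le h measure_ge0.
      by rewrite h0 ltxx in off0.
    apply: (prob_le_null P _ _ (null_set D)) => //.
    - exact: null_set_meas.
    - exact: null_set0.
    move=> w' /= xe; right; apply: contrapT => nw.
    have := xisum_ge w' (A D 0 w * ell D 0 0 w') nw; rewrite xe.
    have [_ l0] := off_null w' nw 0%N.
    by rewrite leqNgt (leq_trans A2)// leq_pmulr.
  split=> //; rewrite A1 in off0 off1.
  have pE : P [set w' | [set 1%N] (xisum D 0 (1 * ell D 0 0 w') w')] =
      (prob_ell1 D * prob_xi1 D)%:E.
    have m11 : measurable [set w | ell D 0 0 w = 1%N /\ xi D 0 0 w = 1%N].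
      by apply: measurableI; [exact: (ell_meas D 0 0 [set 1%N])|exact: (xi_meas D 0 0 [set 1%N])].
    rewrite -prob_ell_xi1; apply/eqP; rewrite eq_le; apply/andP; split; last first.
      apply: prob_le => // w' [/= -> x1].
      by rewrite /xisum mul1n big_ord_recr big_ord0 /= x1.
    apply: (prob_le_null P _ _ (null_set D)) => //.
    - exact: null_set_meas.
    - exact: null_set0.
    move=> w' /= xe; have [nw|nw] := pselect (null_set D w'); [by right|left].
    have := xisum_ge w' (1 * ell D 0 0 w') nw; rewrite xe mul1n => l1.
    have [x0 l0] := off_null w' nw 0%N.
    have lE : ell D 0 0 w' = 1%N by apply/eqP; rewrite eqn_leq l1.
    by move: xe; rewrite lE /xisum mul1n big_ord_recr big_ord0 /= => <-.
  by rewrite pE in off0 off1; rewrite off0.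
have [_ _ b] := key w0 Ew0; split=> //.
pose Ec : set (nat * nat) := [set z | z.1 = 1%N /\ z.2 = 0%N].
have mc : measurable [set w | A D 0 w = 1%N /\ B D 0 w = 0%N] by exact: (ctl_meas D 0 Ec).
have mE : measurable E.
  pose Y : set (nat * nat) := [set z | (0 < fine (immigration_law D z.2 [set 0%N]))%R /\
    (0 < fine (offspring_law D z.1 [set 1%N]) < 1)%R].
  exact: (ctl_meas D 0 Y).
rewrite /prob_ctl10 fine_gt0//; apply/andP; split.
  apply: lt_le_trans H2 _; apply: prob_le => // w /key [].
  by [].
by rewrite ltey_eq fin_num_measure.
Qed.

(** By [mean_ge_nat] the two means are at least [2 - P(xi = 1)] and [2 - P(L = 1)], and these two
    probabilities are not both 1. Hence [M] exceeds 1 in every environment. *)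
Lemma condH2_mean : condH2 D -> 1 < m D * lambda D.
Proof.
move=> /condH2_consequences [_ /andP[b0 b1]].
have [xi0 ell0] := positive_offspring D H1.
have hm : 2 - prob_xi1 D <= m D.
  apply: (mean_ge_nat P (xi D 0 0)) => //; first by move=> n; exact: xi_meas.
  by rewrite -(mean_xi D) unlock.
have hl : 2 - prob_ell1 D <= lambda D.
  apply: (mean_ge_nat P (ell D 0 0)) => //; first by move=> n; exact: ell_meas.
  by rewrite -(mean_ell D) unlock.
have le1 (E : set T) : measurable E -> 0 <= fine (P E) <= 1.
  move=> mE; have pf := fin_num_measure P _ mE.
  by rewrite -lee_fin -[X in (_ && X)]lee_fin fineK// measure_ge0 probability_le1.
have /andP[x0 x1] : 0 <= prob_xi1 D <= 1 by apply: le1; exact: (xi_meas D 0 0 [set 1%N]).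
have /andP[l0 l1] : 0 <= prob_ell1 D <= 1 by apply: le1; exact: (ell_meas D 0 0 [set 1%N]).
have ml : (2 - prob_xi1 D) * (2 - prob_ell1 D) <= m D * lambda D.
  by apply: ler_pM => //; lra.
by nra.
Qed.

End NondecreasingStep.

(** * Harmonic moments and the Lyapunov function *)

Section HarmonicMoments.
Context {d : measure_display} {T : measurableType d} {R : realType}.
Context {P : probability T R}.
Variable D : cbp P.
Local Open Scope ereal_scope.

Notation dm := (dmeas (devents D)).

Lemma X_fun_measurable i n {d'} {T' : measurableType d'} (g : nat -> T') :
  measurable_fun setT (fun w => g (X D i n w)).
Proof.
exact: (@measurable_discrete _ _ _ (X D i n) _ _ g (fun s => X_meas D i n [set s])).
Qed.

Lemma step_fun_measurable n k {d'} {T' : measurableType d'} (g : nat -> T') :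
  measurable_fun setT (fun w => g (step D n k w)).
Proof.
exact: (@measurable_discrete _ _ _ (step D n k) _ _ g (fun s => step_meas D n k [set s])).
Qed.

Lemma A_fun_measurable n {d'} {T' : measurableType d'} (g : nat -> T') :
  measurable_fun setT (fun w => g (A D n w)).
Proof.
exact: (@measurable_discrete _ _ _ (ctl D n) _ _ (fun z => g z.1)
  (fun s => ctl_meas D n [set s])).
Qed.

Lemma integral_affine_indic (E : set T) (a c : R) : measurable E ->
  (0 <= a)%R -> (0 <= c)%R -> \int[P]_w (a * \1_E w + c)%:E = a%:E * P E + c%:E.
Proof.
move=> mE a0 c0; rewrite integral_affine//.
by rewrite integral_indic// setIT.
Qed.

Hypothesis H1 : condH1 D.

Lemma integral_le_off_null (f g : T -> \bar R) :
  measurable_fun setT f -> measurable_fun setT g ->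
  (forall w, 0 <= f w) -> (forall w, 0 <= g w) ->
  (forall w, ~ null_set D w -> f w <= g w) -> \int[P]_w f w <= \int[P]_w g w.
Proof.
move=> mf mg f0 g0 fg; apply: ae_ge0_le_integral => //.
exists (null_set D); split; [exact: null_set_meas|exact: null_set0|].
move=> w /= h; apply: contrapT => nw; apply: h => _; exact: fg.
Qed.

Hypothesis H2 : condH2 D.

Lemma M_ge1 n w : (m D * lambda D <= M D n w)%R /\ (1 <= M D n w)%R.
Proof.
have h := condH2_mean D H1 H2.
have A1 : (1 <= (A D n w)%:R :> R)%R by rewrite ler1n; exact: A_gt0.
suff h' : (m D * lambda D <= M D n w)%R by split=> //; apply: le_trans h'; exact: ltW.
by rewrite /M ler_peMr//; apply: ltW; apply: lt_trans h.
Qed.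

Lemma M_pow_measurable s : measurable_fun setT (fun w => (M D 0 w `^ (- s))%R).
Proof. exact: (A_fun_measurable 0 (fun a => (m D * lambda D * a%:R) `^ (- s))%R). Qed.

Lemma cqE s : (0 <= s)%R -> \int[P]_w (M D 0 w `^ (- s))%:E = (cq D s)%:E.
Proof.
move=> s0; rewrite /cq unlock fineK// ge0_fin_numE; last first.
  by apply: integral_ge0 => w _; rewrite lee_fin powR_ge0.
apply: (@le_lt_trans _ _ 1); last exact: ltry.
rewrite -(integral_prob_cst P 1); apply: ge0_le_integral => //.
- by move=> w _; rewrite lee_fin powR_ge0.
- by apply/measurable_EFinP; exact: M_pow_measurable.
move=> w _; rewrite lee_fin powRN; have [_ M1] := M_ge1 0 w.
rewrite invf_le1 ?powR_gt0//; last exact: lt_le_trans M1.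
by rewrite -[leLHS](powRr0 (M D 0 w)); apply: ler_powR.
Qed.

Lemma cq_gt0 s : (0 <= s)%R -> (0 < cq D s)%R.
Proof.
move=> s0; rewrite -lte_fin -cqE//.
pose E := [set w | A D 0 w = 1%N /\ B D 0 w = 0%N].
have mE : measurable E by exact: (ctl_meas D 0 [set z | z.1 = 1%N /\ z.2 = 0%N]).
have [a0 _] := condH2_consequences D H1 H2.
have ml0 : (0 < m D * lambda D)%R by apply: lt_trans (condH2_mean D H1 H2).
apply: (@lt_le_trans _ _ (((m D * lambda D) `^ (- s))%:E * P E)).
  rewrite mule_gt0// ?lte_fin ?powR_gt0//.
  by rewrite -[P E]fineK ?fin_num_measure// lte_fin.
rewrite -integral_cst//.
apply: (@le_trans _ _ (\int[P]_(w in E) (M D 0 w `^ (- s))%:E)).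
  apply: ge0_le_integral => //.
  - by move=> w _; rewrite lee_fin powR_ge0.
  - apply: measurable_funTS; apply/measurable_EFinP; exact: M_pow_measurable.
  by move=> w [A1 _]; rewrite lee_fin /M A1 mulr1.
apply: ge0_subset_integral => //.
- by apply/measurable_EFinP; exact: M_pow_measurable.
- by move=> w _; rewrite lee_fin powR_ge0.
Qed.

(** Uses [M >= m * lambda] pointwise, from [A >= 1]. With [m * lambda > 1] it separates
    [c_(q + 1/4)] from [c_q]. *)
Lemma cq_decr s t : (0 <= s)%R -> (0 <= t)%R ->
  (cq D (s + t) <= (m D * lambda D) `^ (- t) * cq D s)%R.
Proof.
move=> s0 t0; rewrite -lee_fin EFinM -!cqE ?addr_ge0//.
have ml0 : (0 < m D * lambda D)%R by apply: lt_trans (condH2_mean D H1 H2).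
rewrite -ge0_integralZl_EFin//; last 3 first.
- by move=> w _; rewrite lee_fin powR_ge0.
- by apply/measurable_EFinP; exact: M_pow_measurable.
- exact: powR_ge0.
apply: ge0_le_integral => //.
- by move=> w _; rewrite lee_fin powR_ge0.
- by apply/measurable_EFinP; exact: M_pow_measurable.
- by apply: measurable_funeM; apply/measurable_EFinP; exact: M_pow_measurable.
move=> w _; have [M1 M2] := M_ge1 0 w.
have M0 : (0 < M D 0 w)%R by apply: lt_le_trans M2.
rewrite lee_fin opprD powRD; last by rewrite (gt_eqF M0) implybT.
rewrite mulrC ler_wpM2r ?powR_ge0// !powRN lef_pV2 ?posrE ?powR_gt0//.
by apply: ge0_ler_powR => //; rewrite nnegrE ltW.
Qed.

Lemma step_inv_moment p q K : (2 <= p)%R -> q = (p / 2)%R -> moment_bounds D p q K ->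
  forall s, (0 < s)%R -> exists2 C : R, (0 <= C)%R & forall k, (0 < k)%N ->
  \int[P]_w ((step D 0 k w)%:R `^ (- s))%:E <=
  ((cq D s + C * k%:R `^ (- 4^-1)) * k%:R `^ (- s))%:E.
Proof.
move=> p2 qp mb s s0; have [C C0 hC] := bad2_bound D p q K p2 qp mb.
exists (s + C)%R; first by lra.
move=> k k0; have kR : (0 < k%:R :> R)%R by rewrite ltr0n.
(* At this level the bound [delta^(- p) k^(- q)] equals [k^(- q / 2)], which is at most [delta]
   because [q >= 1]. *)
pose delta := (k%:R `^ (- 4^-1) : R)%R.
have delta0 : (0 < delta)%R by rewrite powR_gt0.
set E := obs D 0 k @^-1` bad2 D delta k.
have mE : measurable E by exact: obs_meas.
have pE : P E <= (C * delta)%:E.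
  apply: le_trans (hC delta k delta0 k0) _; rewrite lee_fin -mulrA ler_wpM2l//.
  rewrite /delta -powRrM -powRD; last by rewrite (gt_eqF kR) implybT.
  by apply: ler_powR; [rewrite ler1n|rewrite qp; lra].
have ks0 : (0 <= k%:R `^ (- s) :> R)%R := powR_ge0 _ _.
pose g1 w := (k%:R `^ (- s) * M D 0 w `^ (- s) + 0)%R.
pose g2 w := (k%:R `^ (- s) * \1_E w + k%:R `^ (- s) * (s * delta))%R.
have g10 w : (0 <= g1 w)%R by rewrite /g1 addr0 mulr_ge0 ?powR_ge0.
have sd0 : (0 <= k%:R `^ (- s) * (s * delta))%R by rewrite !mulr_ge0// ltW.
have g20 w : (0 <= g2 w)%R by rewrite /g2 addr_ge0// mulr_ge0.
have mg1 : measurable_fun setT (EFin \o g1).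
  apply/measurable_EFinP.
  exact: (A_fun_measurable 0
    (fun a => k%:R `^ (- s) * (m D * lambda D * a%:R) `^ (- s) + 0)%R).
have mg2 : measurable_fun setT (EFin \o g2).
  apply/measurable_EFinP; apply: measurable_funD => //.
  by apply: measurable_funM => //; exact: measurable_indic.
apply: (@le_trans _ _ (\int[P]_w ((g1 w)%:E + (g2 w)%:E))).
  apply: integral_le_off_null.
  - by apply/measurable_EFinP; exact: (step_fun_measurable 0 k (fun y => y%:R `^ (- s))%R).
  - exact: emeasurable_funD.
  - by move=> w; rewrite lee_fin powR_ge0.
  - by move=> w; rewrite adde_ge0// lee_fin.
  move=> w nw; rewrite -EFinD lee_fin.
  have [_ M1] := M_ge1 0 w.
  have x1 : (1 <= (step D 0 k w)%:R / k%:R :> R)%R.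
    by rewrite ler_pdivlMr// mul1r ler_nat; exact: step_ge_id.
  have -> : ((step D 0 k w)%:R `^ (- s) =
      k%:R `^ (- s) * ((step D 0 k w)%:R / k%:R) `^ (- s) :> R)%R.
    by rewrite -powRM ?divr_ge0// mulrCA divff ?gt_eqF// mulr1.
  rewrite /g1 /g2 addr0 -!mulrDr ler_wpM2l// indicE.
  have Ms0 : (0 <= M D 0 w `^ (- s))%R := powR_ge0 _ _.
  (* On [E] only [step / k >= 1] is known, so the negative power is at most 1. Off [E] the ratio is
     within [delta] of [M], and the negative power is Lipschitz on values at least 1. *)
  have [wE|wE] := pselect (E w).
    rewrite mem_set//= addrA; apply: ler_wpDr; first by rewrite mulr_ge0// ltW.
    apply: ler_wpDl => //; rewrite powRN invf_le1 ?powR_gt0//; last by lra.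
    rewrite -[leLHS](powRr0 ((step D 0 k w)%:R / k%:R)%R).
    by apply: ler_powR => //; exact: ltW.
  rewrite memNset//= add0r; apply: le_trans (powRN_lipschitz s0 x1 M1) _.
  rewrite lerD2l ler_wpM2l ?(ltW s0)// leNgt; apply/negP => h; apply: wE.
  exact: h.
rewrite ge0_integralD//; last 2 first.
- by move=> w _; rewrite lee_fin; exact: g10.
- by move=> w _; rewrite lee_fin; exact: g20.
rewrite integral_affine_indic// (integral_affine P (fun w => M D 0 w `^ (- s))%R)//; last 2 first.
- exact: M_pow_measurable.
- by move=> w; exact: powR_ge0.
rewrite cqE ?(ltW s0)// adde0.
apply: (@le_trans _ _ ((k%:R `^ (- s))%:E * (cq D s)%:E +
  ((k%:R `^ (- s))%:E * (C * delta)%:E + (k%:R `^ (- s) * (s * delta))%:E))).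
  by apply: leeD => //; apply: leeD => //; apply: lee_wpmul2l => //; rewrite lee_fin.
rewrite -!EFinM -!EFinD lee_fin le_eqVlt; apply/orP; left; apply/eqP; rewrite /delta; ring.
Qed.

End HarmonicMoments.

Section Lyapunov.
Context {d : measure_display} {T : measurableType d} {R : realType}.
Context {P : probability T R}.
Variable D : cbp P.
Variable i : nat.
Local Open Scope ereal_scope.

Lemma X_ge_initial n : nondecreasing_bprei D -> P [set w | (X D i n w < i)%N] = 0.
Proof.
move=> nd; elim: n => [|n IH].
  by rewrite (_ : [set w | _] = set0) ?measure0//; apply/seteqP; split=> // w; rewrite /= ltnn.
have [Z [mZ PZ subZ]] := nd i n.
apply/eqP; rewrite eq_le measure_ge0 andbT -IH.
apply: (prob_le_null P _ _ Z) => //.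
- exact: (X_meas D i n.+1 [set x | (x < i)%N]).
- exact: (X_meas D i n [set x | (x < i)%N]).
move=> w Xi; have [Zw|Zw] := pselect (Z w); [by right|left].
have XX : (X D i n w <= X D i n.+1 w)%N by apply: contrapT => h; apply: Zw; exact: subZ.
exact: leq_ltn_trans XX Xi.
Qed.

Hypothesis nd : nondecreasing_bprei D.

Lemma prob_X_lt n k : (k < i)%N -> P (X D i n @^-1` [set k]) = 0.
Proof.
move=> ki; apply/eqP; rewrite eq_le measure_ge0 andbT -(X_ge_initial n nd).
apply: prob_le.
- exact: X_meas.
- exact: (X_meas D i n [set x | (x < i)%N]).
by move=> w /= ->.
Qed.

Lemma X_integral_le n (f g : nat -> R) : (forall k, 0 <= f k)%R -> (forall k, 0 <= g k)%R ->
  (forall k, (i <= k)%N -> (f k <= g k)%R) ->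
  \int[P]_w (f (X D i n w))%:E <= \int[P]_w (g (X D i n w))%:E.
Proof.
move=> f0 g0 fg.
rewrite (@integral_nat _ _ _ P (X D i n) (fun k => (f k)%:E)); last 2 first.
- by move=> k; exact: X_meas.
- by move=> k; rewrite lee_fin.
rewrite (@integral_nat _ _ _ P (X D i n) (fun k => (g k)%:E)); last 2 first.
- by move=> k; exact: X_meas.
- by move=> k; rewrite lee_fin.
apply: lee_nneseries => k _; first by rewrite mule_ge0// lee_fin.
have [ik|ki] := leqP i k; first by apply: lee_wpmul2l => //; rewrite lee_fin fg.
by rewrite prob_X_lt// !mul0e.
Qed.

(** The Markov property turns a one-step inequality into one for the chain. States below [i] have no
    mass, so the drift is required only from [i] on. *)
Lemma X_integral_step n (f g : nat -> R) : (forall k, 0 <= f k)%R -> (forall k, 0 <= g k)%R ->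
  (forall k, (i <= k)%N -> \int[P]_w (f (step D 0 k w))%:E <= (g k)%:E) ->
  \int[P]_w (f (X D i n.+1 w))%:E <= \int[P]_w (g (X D i n w))%:E.
Proof.
move=> f0 g0 fg.
rewrite (markov_integral D i n (fun _ y => (f y)%:E)); last by move=> k y; rewrite lee_fin.
rewrite (@integral_nat _ _ _ P (X D i n) (fun k => (g k)%:E)); last 2 first.
- by move=> k; exact: X_meas.
- by move=> k; rewrite lee_fin.
apply: lee_nneseries => k _.
  by rewrite mule_ge0// integral_ge0// => w _; rewrite lee_fin.
have [ik|ki] := leqP i k; first by apply: lee_wpmul2l => //; exact: fg.
by rewrite prob_X_lt// !mul0e.
Qed.

Hypothesis H1 : condH1 D.
Hypothesis H2 : condH2 D.

Let al0 : (0 < prob_ctl10 D)%R.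
Proof. by have [] := condH2_consequences D H1 H2. Qed.

Let be01 : (0 < prob_ell1 D * prob_xi1 D < 1)%R.
Proof. by have [] := condH2_consequences D H1 H2. Qed.

Lemma gammai_gt0 : (0 < gammai D i)%R.
Proof. by have /andP[b0 _] := be01; rewrite mulr_gt0// exprn_gt0. Qed.

Lemma gammai_succ_lt : (gammai D i.+1 < gammai D i)%R.
Proof.
have /andP[b0 b1] := be01.
by rewrite /gammai ltr_pM2l// exprS gtr_pMl// exprn_gt0.
Qed.

Lemma prob_step_diag_gammai k j : (0 < k)%N -> (j <= k)%N ->
  P [set w | step D 0 k w = k] <= (gammai D j)%:E.
Proof.
move=> k0 jk; have /andP[b0 b1] := be01.
apply: le_trans (prob_step_diag D H1 k k0) _; rewrite lee_fin ler_wpM2l ?(ltW al0)//.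
by apply: ler_wiXn2l => //; exact: ltW.
Qed.

Definition lyapunov (s Theta : R) (k0 k : nat) : R :=
  if (k < k0)%N then (Theta ^+ (k0 - k))%R else (k%:R `^ (- s))%R.

Section LyapunovDrift.
Variables (s Theta rho C : R) (k0 : nat).

Lemma lyapunov_ge0 k : (1 <= Theta)%R -> (0 <= lyapunov s Theta k0 k)%R.
Proof.
move=> t1; rewrite /lyapunov; case: ifP => _; last exact: powR_ge0.
by rewrite exprn_ge0// (le_trans ler01).
Qed.

Lemma lyapunov_le k j : (0 < s)%R -> (1 <= Theta)%R -> (k0 - k <= j)%N ->
  (lyapunov s Theta k0 k <= Theta ^+ j)%R.
Proof.
move=> s0 t1 kj; rewrite /lyapunov; case: ifP => _.
  by apply: ler_weXn2l.
by apply: le_trans (powRN_le1 k s0) _; exact: exprn_ege1.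
Qed.

Lemma lyapunov_ge k : (0 < s)%R -> (1 <= Theta)%R ->
  (k%:R `^ (- s) <= lyapunov s Theta k0 k)%R.
Proof.
move=> s0 t1; rewrite /lyapunov; case: ifP => // _.
by apply: le_trans (powRN_le1 k s0) _; exact: exprn_ege1.
Qed.

(** Below [k0] the state stays put with probability at most [gamma_(i+1)], and any move up divides
    the function by at least [Theta]. Contraction by [rho] thus amounts to
    [Theta * (rho - gamma_(i+1)) >= 1], whence the choice of [Theta]. Above [k0] the moment estimate
    applies directly. *)
Lemma lyapunov_drift k : (0 < s)%R -> (gammai D i.+1 < rho)%R ->
  Theta = (1 + (rho - gammai D i.+1)^-1)%R ->
  (forall k, (0 < k)%N -> \int[P]_w ((step D 0 k w)%:R `^ (- s))%:E <=
    ((cq D s + C * k%:R `^ (- 4^-1)) * k%:R `^ (- s))%:E) ->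
  (forall k, (k0 <= k)%N -> (cq D s + C * k%:R `^ (- 4^-1) <= rho)%R) ->
  (i < k)%N ->
  \int[P]_w (lyapunov s Theta k0 (step D 0 k w))%:E <= (rho * lyapunov s Theta k0 k)%:E.
Proof.
move=> s0 grho TE hs hk0 ik; have kpos : (0 < k)%N by apply: leq_ltn_trans ik.
have g0 : (0 <= gammai D i.+1)%R.
  have /andP[b0 _] := be01; have a0 := al0.
  by rewrite mulr_ge0 ?exprn_ge0 ?(ltW b0) ?(ltW a0).
have ig : (0 < (rho - gammai D i.+1)^-1)%R by rewrite invr_gt0 subr_gt0.
have t1 : (1 <= Theta)%R by rewrite TE; lra.
have mV : measurable_fun setT (fun w => (lyapunov s Theta k0 (step D 0 k w))%:E).
  exact: (step_fun_measurable D 0 k (fun y => (lyapunov s Theta k0 y)%:E)).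
have V0 w : 0 <= (lyapunov s Theta k0 (step D 0 k w))%:E by rewrite lee_fin lyapunov_ge0.
have [kk0|k0k] := ltnP k k0; last first.
  apply: (@le_trans _ _ (\int[P]_w ((step D 0 k w)%:R `^ (- s))%:E)).
    apply: (integral_le_off_null D H1) => //.
      exact: (step_fun_measurable D 0 k (fun y => (y%:R `^ (- s))%:E)).
    move=> w nw; rewrite lee_fin /lyapunov ltnNge.
    by rewrite (leq_trans k0k (step_ge_id D w k nw)).
  apply: le_trans (hs k kpos) _; rewrite lee_fin.
  by rewrite /lyapunov ltnNge k0k /= ler_wpM2r ?powR_ge0// hk0.
set E := [set w | step D 0 k w = k].
have mE : measurable E by exact: (step_meas D 0 k [set k]).
have th0 j : (0 <= Theta ^+ j)%R by rewrite exprn_ge0// (le_trans ler01).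
apply: (@le_trans _ _ (\int[P]_w (Theta ^+ (k0 - k) * \1_E w + Theta ^+ (k0 - k).-1)%:E)).
  apply: (integral_le_off_null D H1) => //.
  - apply/measurable_EFinP; apply: measurable_funD => //; exact: measurable_funM.
  - by move=> w; rewrite lee_fin addr_ge0// mulr_ge0.
  move=> w nw; rewrite lee_fin indicE.
  have [sk|sk] := eqVneq (step D 0 k w) k.
    rewrite mem_set//= mulr1 sk; apply: ler_wpDr => //.
    by apply: lyapunov_le.
  rewrite memNset; last by move=> /= h; rewrite h eqxx in sk.
  rewrite mulr0 add0r; apply: lyapunov_le => //.
  have : (k < step D 0 k w)%N by rewrite ltn_neqAle eq_sym sk step_ge_id.
  lia.
rewrite integral_affine_indic//.
apply: (@le_trans _ _ ((Theta ^+ (k0 - k))%:E * (gammai D i.+1)%:E +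
    (Theta ^+ (k0 - k).-1)%:E)).
  by apply: leeD => //; apply: lee_wpmul2l; [rewrite lee_fin|exact: prob_step_diag_gammai].
rewrite -EFinM -EFinD lee_fin /lyapunov kk0.
have -> : (k0 - k = (k0 - k).-1.+1)%N by lia.
rewrite exprS /=; set t := (Theta ^+ _)%R.
have t0 : (0 <= t)%R by exact: th0.
have TG : (Theta * (rho - gammai D i.+1) >= 1)%R.
  by rewrite TE mulrDl mul1r mulVf ?gt_eqF ?subr_gt0//; lra.
have := ler_wpM2l t0 TG; lra.
Qed.

End LyapunovDrift.

End Lyapunov.

Section HarmonicBound.
Context {d : measure_display} {T : measurableType d} {R : realType}.
Context {P : probability T R}.
Variable D : cbp P.
Variable i : nat.
Local Open Scope ereal_scope.

Hypothesis i0 : (0 < i)%N.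
Hypothesis nd : nondecreasing_bprei D.
Hypothesis H1 : condH1 D.
Hypothesis H2 : condH2 D.

(** Off the null set no state above [i] returns to [i], so each step at [i] costs a factor
    [gamma_i]. *)
Lemma prob_stay n : \int[P]_w ((X D i n w == i)%:R : R)%:E <= (gammai D i ^+ n)%:E.
Proof.
have g0 : (0 <= gammai D i)%R by exact: ltW (gammai_gt0 D i H1 H2).
elim: n => [|n IH].
  under eq_integral do rewrite /= eqxx.
  by rewrite integral_prob_cst expr0.
apply: (@le_trans _ _ (\int[P]_w (gammai D i * ((X D i n w == i)%:R) + 0)%:E)).
  apply: (X_integral_step D i nd n (fun k => (k == i)%:R) (fun k => (gammai D i * ((k == i)%:R) +
    0)%R)).
  - by [].
  - by move=> k; rewrite addr0 mulr_ge0.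
  move=> k ik; rewrite addr0.
  have [kE|ki] := eqVneq k i.
    rewrite mulr1 {}kE.
    apply: le_trans (prob_step_diag_gammai D H1 H2 i i i0 (leqnn i)).
    rewrite (_ : P _ = \int[P]_w (\1_[set w | step D 0 i w = i] w)%:E); last first.
      by rewrite integral_indic// ?setIT//; exact: (step_meas D 0 i [set i]).
    rewrite le_eqVlt; apply/orP; left; apply/eqP; apply: eq_integral => w _.
    rewrite indicE; congr (_%:R)%:E; case: eqP => h; first by rewrite mem_set.
    by rewrite memNset.
  rewrite mulr0 -(integral_prob_cst P 0).
  apply: (integral_le_off_null D H1) => //.
    exact: (step_fun_measurable D 0 k (fun y => ((y == i)%:R : R)%:E)).
  move=> w nw; rewrite lee_fin gtn_eqF//.
  by apply: leq_trans (step_ge_id D w k nw); rewrite ltn_neqAle eq_sym ki.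
have mI : measurable_fun setT (fun w => ((X D i n w == i)%:R : R)).
  exact: (X_fun_measurable D i n (fun k => (k == i)%:R : R)).
rewrite (integral_affine P (fun w => ((X D i n w == i)%:R : R)))//.
by rewrite adde0 exprS [leRHS]EFinM; apply: lee_wpmul2l => //; rewrite lee_fin.
Qed.

Lemma harmonic_bound p q K s rho : (2 <= p)%R -> q = (p / 2)%R -> moment_bounds D p q K ->
  (0 < s)%R -> (cq D s < rho)%R -> (gammai D i <= rho)%R ->
  exists2 C : R, (0 <= C)%R & forall n,
    \int[P]_w ((X D i n w)%:R `^ (- s))%:E <= (C * rho ^+ n)%:E.
Proof.
move=> p2 qp mb s0 crho grho.
have [C C0 hC] := step_inv_moment D H1 H2 p q K p2 qp mb s s0.
have gg := gammai_succ_lt D i H1 H2.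
have gp := gammai_gt0 D i H1 H2.
have cp := cq_gt0 D H1 H2 s (ltW s0).
pose mx := Num.max (cq D s) (gammai D i.+1).
have mxrho : (mx < rho)%R by rewrite gt_max crho (lt_le_trans gg grho).
have cmx : (cq D s <= mx)%R by rewrite le_max lexx.
have gmx : (gammai D i.+1 <= mx)%R by rewrite le_max lexx orbT.
pose rho' : R := ((mx + rho) / 2)%R.
have rr : (rho' < rho)%R by rewrite /rho'; lra.
have mr : (mx < rho')%R by rewrite /rho'; lra.
have [k0 hk0] : exists k0 : nat, forall k, (k0 <= k)%N ->
    (cq D s + C * k%:R `^ (- 4^-1) <= rho')%R.
  have e0 : (0 < rho' - cq D s)%R by lra.
  have t0 : (0 < 4^-1 :> R)%R by [].
  have [k0 h] := powRN_small C0 e0 t0.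
  by exists k0 => k /h; lra.
pose Theta := (1 + (rho' - gammai D i.+1)^-1)%R.
have t1 : (1 <= Theta)%R.
  have : (0 <= (rho' - gammai D i.+1)^-1)%R by rewrite invr_ge0; lra.
  by rewrite /Theta; lra.
pose V := lyapunov s Theta k0.
have V0 k : (0 <= V k)%R by exact: lyapunov_ge0.
have VT k : (V k <= Theta ^+ k0)%R by apply: lyapunov_le => //; exact: leq_subr.
have T0 : (0 <= Theta ^+ k0)%R by rewrite exprn_ge0// (le_trans ler01).
have drift k : (i < k)%N -> \int[P]_w (V (step D 0 k w))%:E <= (rho' * V k)%:E.
  by apply: (lyapunov_drift D i H1 H2 s Theta rho' C k0) => //; lra.
(* The drift fails at [i] itself, so the Lyapunov function is cut there and the state [i] is
   accounted for by [stay]. *)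
pose W k : R := if (i < k)%N then V k else 0%R.
have W0 k : (0 <= W k)%R by rewrite /W; case: ifP.
have WV k : (W k <= V k)%R by rewrite /W; case: ifP.
have mVs k : measurable_fun setT (fun w => (V (step D 0 k w))%:E).
  exact: (step_fun_measurable D 0 k (fun y => (V y)%:E)).
have mWs k : measurable_fun setT (fun w => (W (step D 0 k w))%:E).
  exact: (step_fun_measurable D 0 k (fun y => (W y)%:E)).
have r'0 : (0 <= rho')%R by lra.
(* Chosen so that [B * rho = rho' * B + Theta ^+ k0]: contraction plus the source reproduces the
   bound at the next time. *)
pose B := (Theta ^+ k0 / (rho - rho'))%R.
have B0 : (0 <= B)%R by rewrite divr_ge0//; lra.
have mW n : measurable_fun setT (fun w => W (X D i n w)).
  exact: (X_fun_measurable D i n W).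
have mI n : measurable_fun setT (fun w => ((X D i n w == i)%:R : R)).
  exact: (X_fun_measurable D i n (fun k => (k == i)%:R : R)).
have stay n : \int[P]_w ((X D i n w == i)%:R : R)%:E <= (rho ^+ n)%:E.
  apply: le_trans (prob_stay n) _; rewrite lee_fin.
  by apply: lerXn2r => //; rewrite nnegrE; lra.
have boundW n : \int[P]_w (W (X D i n w))%:E <= (B * rho ^+ n)%:E.
  elim: n => [|n IH].
    under eq_integral do rewrite /= /W ltnn.
    by rewrite integral_prob_cst expr0 mulr1 lee_fin.
  apply: (@le_trans _ _ (\int[P]_w (rho' * W (X D i n w) +
      Theta ^+ k0 * (X D i n w == i)%:R)%:E)).
    apply: (X_integral_step D i nd n W
      (fun k => (rho' * W k + Theta ^+ k0 * (k == i)%:R)%R)) => //.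
    - by move=> k; rewrite addr_ge0// mulr_ge0.
    move=> k ik; have [kE|ki] := eqVneq k i.
      have Wi : W i = 0%R by rewrite /W ltnn.
      rewrite mulr1 kE Wi mulr0 add0r -(integral_prob_cst P (Theta ^+ k0)).
      apply: ge0_le_integral => //.
      - by move=> w _; rewrite lee_fin W0.
      by move=> w _; rewrite lee_fin; apply: le_trans (WV _) (VT _).
    have ik' : (i < k)%N by rewrite ltn_neqAle eq_sym ki.
    have Wk : W k = V k by rewrite /W ik'.
    rewrite mulr0 addr0 Wk; apply: le_trans (drift k ik').
    apply: ge0_le_integral => //.
    - by move=> w _; rewrite lee_fin W0.
    - by move=> w _; rewrite lee_fin WV.
  under eq_integral do rewrite EFinD.
  rewrite ge0_integralD//; last 4 first.
  - by move=> w _; rewrite lee_fin mulr_ge0.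
  - by apply/measurable_EFinP; exact: measurable_funM.
  - by move=> w _; rewrite lee_fin mulr_ge0.
  - by apply/measurable_EFinP; exact: measurable_funM.
  under eq_integral do rewrite EFinM.
  under [X in _ + X <= _]eq_integral do rewrite EFinM.
  rewrite !ge0_integralZl_EFin//; last 3 first.
  - exact/measurable_EFinP.
  - by move=> w _; rewrite lee_fin W0.
  - exact/measurable_EFinP.
  apply: (@le_trans _ _ (rho'%:E * (B * rho ^+ n)%:E + (Theta ^+ k0)%:E * (rho ^+ n)%:E)).
    by apply: leeD; apply: lee_wpmul2l => //; rewrite lee_fin.
  rewrite -!EFinM -EFinD lee_fin exprS.
  rewrite le_eqVlt; apply/orP; left; apply/eqP; rewrite /B; field.
  by rewrite subr_eq0 gt_eqF.
exists (B + 1)%R; first by lra.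
move=> n; apply: (@le_trans _ _ (\int[P]_w ((W (X D i n w))%:E + ((X D i n w == i)%:R)%:E))).
  under [X in _ <= X]eq_integral do rewrite -EFinD.
  apply: (X_integral_le D i nd n (fun k => k%:R `^ (- s))%R (fun k => (W k + (k == i)%:R)%R)).
  - by move=> k; exact: powR_ge0.
  - by move=> k; rewrite addr_ge0.
  move=> k ik; have [->|ki] := eqVneq k i.
    by rewrite /W ltnn add0r; exact: powRN_le1.
  have ik' : (i < k)%N by rewrite ltn_neqAle eq_sym ki.
  by rewrite addr0 /W ik'; exact: lyapunov_ge.
rewrite ge0_integralD//; last 3 first.
- by move=> w _; rewrite lee_fin W0.
- exact/measurable_EFinP.
- exact/measurable_EFinP.
by rewrite mulrDl mul1r EFinD; apply: leeD.
Qed.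

End HarmonicBound.

(** * Failure probabilities *)

Section FailureProbabilities.
Context {d : measure_display} {T : measurableType d} {R : realType}.
Context {P : probability T R}.
Variable D : cbp P.
Variable i : nat.
Local Open Scope ereal_scope.

Definition fail_event (Y : nat -> set (nat * nat * nat * nat)) (n : nat) : set T :=
  [set w | (0 < X D i n w)%N /\ Y (X D i n w) (obs D n (X D i n w) w)].

Lemma fail_event_prob Y n : P (fail_event Y n) =
  \sum_(k <oo) P (X D i n @^-1` [set k]) *
    (if (0 < k)%N then P (obs D 0 k @^-1` Y k) else 0).
Proof.
rewrite [LHS](markov_prob D i n [set z | (0 < z.1)%N /\ Y z.1 z.2]).
apply: eq_eseriesr => k _; congr (_ * _); case: ifPn => k0.
  by congr (P _); apply/seteqP; split=> [w []//|w Yw]; split.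
rewrite (_ : [set w | _] = set0) ?measure0//.
by apply/seteqP; split=> // w [/= kp]; rewrite kp in k0.
Qed.

Lemma fail_event_meas Y n : measurable (fail_event Y n).
Proof.
have mm : dmeas (devents D) setT (fun w => (X D i n w, obs D n (X D i n w) w)).
  have mX : dmeas (devents D) setT (X D i n).
    by refine (sub_dmeas (dm_X D i n) _).
  apply: dmeas_pair => //; apply: dmeas_diag => // k.
  by refine (sub_dmeas (dm_obs D n k) _).
exact: (dm_meas D [set z | (0 < z.1)%N /\ Y z.1 z.2] mm).
Qed.

Lemma fail_event_le Y n (C q : R) : (0 <= C)%R ->
  (forall k, (0 < k)%N -> P (obs D 0 k @^-1` Y k) <= (C * k%:R `^ (- q))%:E) ->
  P (fail_event Y n) <= C%:E * \int[P]_w ((X D i n w)%:R `^ (- q))%:E.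
Proof.
move=> C0 hY; rewrite fail_event_prob -ge0_integralZl_EFin//; last first.
  by apply/measurable_EFinP; exact: (X_fun_measurable D i n (fun k => k%:R `^ (- q) : R)%R).
rewrite (@integral_nat _ _ _ P (X D i n) (fun k => C%:E * (k%:R `^ (- q))%:E)); last 2 first.
- by move=> k; exact: X_meas.
- by move=> k; rewrite mule_ge0// lee_fin powR_ge0.
apply: lee_nneseries => k _; first by rewrite mule_ge0//; case: ifP.
apply: lee_wpmul2l => //; case: ifPn => [k0|_]; first exact: hY.
by rewrite mule_ge0// lee_fin powR_ge0.
Qed.

Lemma Rfail1E eps n : Rfail1 D i eps n = fine (P (fail_event (bad1 D eps) n)).
Proof. by []. Qed.

Lemma Rfail2E eps n : Rfail2 D i eps n = fine (P (fail_event (bad2 D eps) n)).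
Proof. by []. Qed.

Lemma Rfail3E eps n : Rfail3 D i eps n = fine (P (fail_event (bad3 D eps) n)).
Proof. by []. Qed.

End FailureProbabilities.

Section PartOne.
Context {d : measure_display} {T : measurableType d} {R : realType}.
Context {P : probability T R}.
Variable D : cbp P.
Variable i : nat.
Local Open Scope ereal_scope.

(** The error factor [k^(- 1/4)] of the one-step estimate raises the order of the harmonic moment to
    [q + 1/4], for which a better exponential rate is available. *)
Lemma harmonic_recursion n (q c C1 : R) : nondecreasing_bprei D -> (0 < i)%N ->
  (0 <= c)%R -> (0 <= C1)%R ->
  (forall k, (0 < k)%N -> \int[P]_w ((step D 0 k w)%:R `^ (- q))%:E <=
    ((c + C1 * k%:R `^ (- 4^-1)) * k%:R `^ (- q))%:E) ->
  \int[P]_w ((X D i n.+1 w)%:R `^ (- q))%:E <=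
  c%:E * \int[P]_w ((X D i n w)%:R `^ (- q))%:E +
  C1%:E * \int[P]_w ((X D i n w)%:R `^ (- (q + 4^-1)))%:E.
Proof.
move=> nd i0 c0 C10 h.
have pw0 (x y : R) : (0 <= x `^ y)%R := powR_ge0 x y.
have mX s : measurable_fun setT (fun w => ((X D i n w)%:R `^ s : R)%R).
  exact: (X_fun_measurable D i n (fun k => k%:R `^ s : R)%R).
rewrite -!ge0_integralZl_EFin//; last 2 first.
- by apply/measurable_EFinP; exact: mX.
- by apply/measurable_EFinP; exact: mX.
rewrite -ge0_integralD//; last 4 first.
- by move=> w _; rewrite mule_ge0 ?lee_fin.
- by apply: measurable_funeM; apply/measurable_EFinP; exact: mX.
- by move=> w _; rewrite mule_ge0 ?lee_fin.
- by apply: measurable_funeM; apply/measurable_EFinP; exact: mX.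
under [X in _ <= X]eq_integral do rewrite -!EFinM -EFinD.
apply: (X_integral_step D i nd n (fun k => k%:R `^ (- q))%R
  (fun k => c * k%:R `^ (- q) + C1 * k%:R `^ (- (q + 4^-1)))%R) => //.
- by move=> k; rewrite addr_ge0// mulr_ge0.
move=> k ik; have k0 : (0 < k)%N by apply: leq_trans ik.
apply: le_trans (h k k0) _; rewrite lee_fin mulrDl -mulrA -powRD.
  by rewrite opprD [(- q - _)%R]addrC.
by rewrite pnatr_eq0 -lt0n k0 implybT.
Qed.

Hypothesis i0 : (0 < i)%N.
Hypothesis nd : nondecreasing_bprei D.
Hypothesis H1 : condH1 D.
Hypothesis H2 : condH2 D.

Lemma bsc_gt0 q n : (0 < q)%R -> (0 < n)%N -> (0 < bsc D i q n)%R.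
Proof.
move=> q0 n0; have gp := gammai_gt0 D i H1 H2; have cp := cq_gt0 D H1 H2 q (ltW q0).
rewrite /bsc; case: ifPn => _; first exact: exprn_gt0.
by case: ifPn => _; [rewrite mulr_gt0 ?ltr0n// exprn_gt0|rewrite exprn_gt0].
Qed.

Lemma harmonic_rate p q K : (2 <= p)%R -> q = (p / 2)%R -> moment_bounds D p q K ->
  exists2 B : R, (0 <= B)%R & forall n, (0 < n)%N ->
    \int[P]_w ((X D i n w)%:R `^ (- q))%:E <= (B * bsc D i q n)%:E.
Proof.
move=> p2 qp mb; have q1 : (1 <= q)%R by rewrite qp; lra.
have q0 : (0 < q)%R by lra.
have gp := gammai_gt0 D i H1 H2; have cp := cq_gt0 D H1 H2 q (ltW q0).
have q'0 : (0 < q + 4^-1 :> R)%R by lra.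
have c'c : (cq D (q + 4^-1) < cq D q)%R.
  have ml := condH2_mean D H1 H2.
  have h4 : (0 < 4^-1 :> R)%R by [].
  apply: le_lt_trans (cq_decr D H1 H2 q _ (ltW q0) (ltW h4)) _.
  rewrite gtr_pMl// powRN invf_lt1 ?powR_gt0//; last by apply: lt_trans ml.
  suff : (1 `^ 4^-1 < (m D * lambda D) `^ 4^-1 :> R)%R by rewrite powR1.
  apply: gt0_ltr_powR => //; rewrite nnegrE//.
  by apply: ltW; apply: lt_trans ml.
have [C1 C10 hC1] := step_inv_moment D H1 H2 p q K p2 qp mb q q0.
have rec n := harmonic_recursion n q (cq D q) C1 nd i0 (ltW cp) C10 hC1.
have init : \int[P]_w ((X D i 0 w)%:R `^ (- q))%:E <= 1%:E.
  by rewrite /= integral_prob_cst lee_fin powRN_le1.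
rewrite /bsc; have [cg|gc|gc] := ltgtP (cq D q) (gammai D i).
- have [B B0 hB] := harmonic_bound D i i0 nd H1 H2 p q K q (gammai D i) p2 qp mb q0 cg (lexx _).
  by exists B.
(* Case [c_q > gamma_i]: the moment of order [q + 1/4] decays at a rate [rho] strictly below [c_q],
   so its total effect is a convergent geometric sum. *)
- pose mx := Num.max (gammai D i) (cq D (q + 4^-1)).
  pose rho : R := ((mx + cq D q) / 2)%R.
  have mxc : (mx < cq D q)%R by rewrite gt_max gc c'c.
  have gmx : (gammai D i <= mx)%R by rewrite le_max lexx.
  have cmx : (cq D (q + 4^-1) <= mx)%R by rewrite le_max lexx orbT.
  have h1 : (cq D (q + 4^-1) < rho)%R by rewrite /rho; lra.
  have h2 : (gammai D i <= rho)%R by rewrite /rho; lra.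
  have h3 : (rho < cq D q)%R by rewrite /rho; lra.
  have [C' C'0 hC'] := harmonic_bound D i i0 nd H1 H2 p q K _ rho p2 qp mb q'0 h1 h2.
  (* The value for which the bound in [claim] solves the recursion with source [C1 * C' * rho ^+ n]
     exactly. *)
  pose E := (C1 * C' / (cq D q - rho))%R.
  have E0 : (0 <= E)%R by rewrite divr_ge0 ?mulr_ge0//; lra.
  have rho0 : (0 <= rho)%R by lra.
  have claim n : \int[P]_w ((X D i n w)%:R `^ (- q))%:E <=
      ((1 + E) * cq D q ^+ n - E * rho ^+ n)%:E.
    elim: n => [|n IH]; first by apply: le_trans init _; rewrite lee_fin !expr0; lra.
    apply: le_trans (rec n) _.
    apply: (@le_trans _ _ ((cq D q)%:E * ((1 + E) * cq D q ^+ n - E * rho ^+ n)%:E +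
        C1%:E * (C' * rho ^+ n)%:E)).
      by apply: leeD; apply: lee_wpmul2l => //; rewrite lee_fin ltW.
    rewrite -!EFinM -EFinD lee_fin !exprS.
    rewrite le_eqVlt; apply/orP; left; apply/eqP; rewrite /E; field.
    by rewrite subr_eq0 gt_eqF.
  exists (1 + E)%R; first by lra.
  move=> n _; apply: le_trans (claim n) _; rewrite lee_fin.
  by rewrite gerBl mulr_ge0// exprn_ge0.
(* Boundary case: the source now decays at the same rate [gamma_i] as the homogeneous solution, and
   this resonance produces the factor [n]. *)
- rewrite gc in c'c *.
  have [C' C'0 hC'] := harmonic_bound D i i0 nd H1 H2 p q K _ (gammai D i) p2 qp mb q'0 c'c (lexx
    _).
  pose E := (C1 * C' / gammai D i)%R.
  have E0 : (0 <= E)%R by apply: divr_ge0; [exact: mulr_ge0|exact: ltW].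
  have claim n : \int[P]_w ((X D i n w)%:R `^ (- q))%:E <=
      ((1 + n%:R * E) * gammai D i ^+ n)%:E.
    elim: n => [|n IH].
      by apply: le_trans init _; rewrite lee_fin expr0 mul0r addr0 mulr1.
    apply: le_trans (rec n) _; rewrite gc.
    apply: (@le_trans _ _ ((gammai D i)%:E * ((1 + n%:R * E) * gammai D i ^+ n)%:E +
        C1%:E * (C' * gammai D i ^+ n)%:E)).
      by apply: leeD; apply: lee_wpmul2l => //; rewrite lee_fin ltW.
    rewrite -!EFinM -EFinD lee_fin !exprS -natr1.
    rewrite le_eqVlt; apply/orP; left; apply/eqP; rewrite /E; field.
    by rewrite gt_eqF.
  exists (1 + E)%R; first by lra.
  move=> n n0; apply: le_trans (claim n) _; rewrite lee_fin mulrA ler_wpM2r ?exprn_ge0 ?(ltW gp)//.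
  have n1 : (1 <= n%:R :> R)%R by rewrite ler1n.
  by rewrite mulrDl mul1r lerD// mulrC.
Qed.

Lemma limn_esup_lty (u : nat -> R) (C : R) : (forall n, u n <= C)%R ->
  limn_esup (fun n => (u n)%:E) < +oo.
Proof.
move=> uC; apply: (@le_lt_trans _ _ C%:E); last exact: ltry.
rewrite limn_esup_lim; apply: lime_le; first exact: is_cvg_esups.
apply: nearW => n; apply: ge_ereal_sup => _ [k _ <-].
by rewrite lee_fin.
Qed.

Lemma failure_rate_nondecreasing p q K eps : (2 <= p)%R -> q = (p / 2)%R ->
  moment_bounds D p q K -> (0 < eps)%R ->
  limn_esup (fun n => (Rfail D i eps n / bsc D i q n)%:E) < +oo.
Proof.
move=> p2 qp mb e0.
have q0 : (0 < q)%R by rewrite qp; lra.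
have [B B0 hB] := harmonic_rate p q K p2 qp mb.
have [C1 C10 h1] := bad1_bound D p q K p2 qp mb.
have [C2 C20 h2] := bad2_bound D p q K p2 qp mb.
have [C3 C30 h3] := bad3_bound D p q K p2 qp mb eps e0.
have pw0 : (0 <= eps `^ (- p))%R := powR_ge0 _ _.
pose C := (C1 * eps `^ (- p) + C2 * eps `^ (- p) + C3)%R.
have C0 : (0 <= C)%R by rewrite !addr_ge0// mulr_ge0.
have bnd Y c n : (0 <= c)%R ->
    (forall k, (0 < k)%N -> P (obs D 0 k @^-1` Y k) <= (c * k%:R `^ (- q))%:E) ->
    (0 < n)%N -> (fine (P (fail_event D i Y n)) <= c * (B * bsc D i q n))%R.
  move=> c0 hY n0; rewrite -lee_fin fineK; last first.
    by apply: fin_num_measure; exact: fail_event_meas.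
  apply: le_trans (fail_event_le D i Y n c q c0 hY) _.
  by rewrite EFinM lee_wpmul2l// hB.
have le1 (E : set T) : measurable E -> (0 <= fine (P E) <= 1)%R.
  move=> mE; have pf := fin_num_measure P _ mE.
  by rewrite -lee_fin -[X in (_ && X)]lee_fin fineK// measure_ge0 probability_le1.
(* The boundary rate vanishes at [n = 0], so this one term is put into the uniform bound by hand. *)
apply: (limn_esup_lty _ (Num.max (C * B) (Rfail D i eps 0 / bsc D i q 0))%R) => n.
rewrite le_max; case: n => [|n]; first by rewrite lexx orbT.
have b0 := bsc_gt0 q n.+1 q0 (ltn0Sn n).
apply/orP; left; rewrite ler_pdivrMr// /Rfail Rfail1E Rfail2E Rfail3E.
have e1 : (0 <= C1 * eps `^ (- p))%R by rewrite mulr_ge0.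
have e2 : (0 <= C2 * eps `^ (- p))%R by rewrite mulr_ge0.
have b1 := bnd _ _ n.+1 e1 (fun k k0 => h1 eps k e0 k0) (ltn0Sn n).
have b2 := bnd _ _ n.+1 e2 (fun k k0 => h2 eps k e0 k0) (ltn0Sn n).
have b3 := bnd _ _ n.+1 C30 h3 (ltn0Sn n).
rewrite /C; lra.
Qed.

End PartOne.

(** * Fluctuations of the associated walk *)

Section WalkPaths.
Context {d : measure_display} {T : measurableType d} {R : realType}.
Context {P : probability T R}.
Variable D : cbp P.

Notation dm := (dmeas (devents D)).

Definition lnS (s : seq nat) : R := \sum_(a <- s) ln (m D * lambda D * a%:R).

Definition prodA (s : seq nat) : nat := (\prod_(a <- s) a)%N.

(** Strict here and weak in [nonneg_path]: the asymmetry encodes that [tau] selects the first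
    minimum. *)
Definition min_end (s : seq nat) : bool :=
  all (fun j => lnS s < lnS (take j s)) (iota 0 (size s)).

Definition nonneg_path (s : seq nat) : bool :=
  all (fun j => 0 <= lnS (take j s)) (iota 0 (size s).+1).

Lemma size_seqA k l w : size (seqA D k l w) = l.
Proof. exact: size_mkseq. Qed.

Lemma seqA_cat k l l' w : seqA D k (l + l') w = seqA D k l w ++ seqA D (k + l) l' w.
Proof.
rewrite /seqA /mkseq iotaD map_cat; congr (_ ++ _).
rewrite add0n -[l in iota l]addn0 iotaDl -map_comp.
by apply: eq_map => j /=; rewrite addnA.
Qed.

Lemma take_seqA k l j w : (j <= l)%N -> take j (seqA D k l w) = seqA D k j w.
Proof.
by move=> jl; rewrite -(subnKC jl) seqA_cat take_size_cat ?size_seqA.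
Qed.

Lemma lnS_cat s t : lnS (s ++ t) = lnS s + lnS t.
Proof. by rewrite /lnS big_cat. Qed.

Lemma prodA_cat s t : prodA (s ++ t) = (prodA s * prodA t)%N.
Proof. by rewrite /prodA big_cat. Qed.

Lemma prodA_gt0 k l w : (0 < prodA (seqA D k l w))%N.
Proof.
rewrite /prodA /seqA /mkseq big_map; elim/big_rec: _ => // j x _ x0.
by rewrite muln_gt0 x0 andbT; exact: A_gt0.
Qed.

Lemma walk_lnS n w : walk D n w = lnS (seqA D 0 n w).
Proof.
rewrite /walk -(big_mkord predT (fun j => ln (M D j w))) /index_iota subn0.
by rewrite /lnS /seqA /mkseq big_map.
Qed.

Lemma lnS_seqA k l w : lnS (seqA D k l w) = walk D (k + l) w - walk D k w.
Proof. by rewrite !walk_lnS seqA_cat lnS_cat; lra. Qed.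

(** The sign of the walk read off the index (length, product), as [lnS_prodA] justifies. *)
Definition negz (z : nat * nat) : bool :=
  z.1%:R * ln (m D * lambda D) + ln (z.2%:R : R) < 0.

Lemma lnS_prodA k l w :
  lnS (seqA D k l w) = l%:R * ln (m D * lambda D) + ln ((prodA (seqA D k l w))%:R : R).
Proof.
elim: l => [|l IH].
  by rewrite /lnS /prodA !big_nil mul0r ln1 addr0.
rewrite seqAS -cats1 lnS_cat prodA_cat IH.
have p0 := prodA_gt0 k l w; have a0 : (0 < A D (k + l) w)%N := A_gt0 D (k + l) w.
have -> : prodA [:: A D (k + l) w] = A D (k + l) w by rewrite /prodA big_seq1.
have -> : lnS [:: A D (k + l) w] = ln (m D * lambda D) + ln ((A D (k + l) w)%:R : R).
  by rewrite /lnS big_seq1 lnM ?posrE ?ltr0n// mulr_gt0 ?m_gt0 ?lambda_gt0.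
rewrite natrM [ln (_%:R * _)]lnM ?posrE ?ltr0n// -natr1; lra.
Qed.

Lemma lnS_negz k l w : (lnS (seqA D k l w) < 0) = negz (l, prodA (seqA D k l w)).
Proof. by rewrite lnS_prodA. Qed.

Lemma bigminn_spec (s : seq nat) (p : pred nat) n :
  (forall j, j \in s -> p j -> (\big[minn/n]_(j <- s | p j) j <= j)%N) /\
  (\big[minn/n]_(j <- s | p j) j = n \/
   (\big[minn/n]_(j <- s | p j) j \in s /\ p (\big[minn/n]_(j <- s | p j) j))).
Proof.
elim: s => [|x s [IH1 IH2]]; first by rewrite !big_nil; split=> //; left.
rewrite big_cons; case: ifPn => px; last first.
  split=> [j|]; first by rewrite inE => /orP[/eqP->|/IH1//]; rewrite (negbTE px).
  by case: IH2 => [->|[h1 h2]]; [left|right; rewrite inE h1 orbT].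
set r := \big[minn/n]_(j <- s | p j) j in IH1 IH2 *.
split=> [j|].
  rewrite inE => /orP[/eqP->|js] pj; first exact: geq_minl.
  by apply: leq_trans (geq_minr _ _) _; exact: IH1.
rewrite /minn; case: ifPn => _; first by right; rewrite inE eqxx.
by case: IH2 => [->|[h1 h2]]; [left|right; rewrite inE h1 orbT].
Qed.

Lemma walk_min_spec n w :
  (forall j, (j <= n)%N -> walk_min D n w <= walk D j w) /\
  (exists2 j, (j <= n)%N & walk_min D n w = walk D j w).
Proof.
have E : walk_min D n w = \big[Num.min/walk D 0 w]_(j <- iota 0 n.+1) walk D j w.
  by rewrite -[in RHS](subn0 n.+1) -/(index_iota 0 n.+1) big_mkord.
have : (forall j, j \in iota 0 n.+1 -> walk_min D n w <= walk D j w) /\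
    (walk_min D n w = walk D 0 w \/
     (exists2 j, j \in iota 0 n.+1 & walk_min D n w = walk D j w)).
  rewrite E; elim: (iota 0 n.+1) => [|x s [IH1 IH2]].
    by rewrite big_nil; split=> //; left.
  rewrite big_cons; set r := \big[Num.min/_]_(j <- s) _ in IH1 IH2 *; split=> [j|].
    rewrite inE => /orP[/eqP->|/IH1 h]; first by rewrite ge_min lexx.
    by rewrite ge_min h orbT.
  rewrite /Num.min; case: ifPn => _; first by right; exists x => //; rewrite inE eqxx.
  by case: IH2 => [->|[j js ->]]; [left|right; exists j => //; rewrite inE js orbT].
move=> [h1 h2]; split=> [j jn|]; first by apply: h1; rewrite mem_iota.
case: h2 => [h|[j]]; first by exists 0%N.
by rewrite mem_iota => /andP[_ jn] ->; exists j.
Qed.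

Lemma tau_spec n w :
  [/\ (tau D n w <= n)%N, forall j, (j < tau D n w)%N -> walk D (tau D n w) w < walk D j w &
      forall j, (j <= n)%N -> walk D (tau D n w) w <= walk D j w].
Proof.
have [m1 [j0 j0n m2]] := walk_min_spec n w.
have E : tau D n w = (\big[minn/n]_(j <- iota 0 n.+1 | walk D j w == walk_min D n w) j)%N.
  by rewrite -[in RHS](subn0 n.+1) -/(index_iota 0 n.+1) big_mkord.
have [t1 t2] := bigminn_spec (iota 0 n.+1) (fun j => walk D j w == walk_min D n w) n.
rewrite -E in t1 t2.
have tj0 : (tau D n w <= j0)%N.
  by apply: t1; [rewrite mem_iota|rewrite m2].
have tn : (tau D n w <= n)%N by apply: leq_trans tj0 j0n.
have tmin : walk D (tau D n w) w = walk_min D n w.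
  (* If the default [n] is returned, then [n <= j0 <= n], so [n] is itself a minimizer. *)
  case: t2 => [tE|[_ /eqP//]].
  have j0E : j0 = n by apply/eqP; rewrite eqn_leq j0n -tE tj0.
  by rewrite tE m2 j0E.
split=> // [j jt|j jn]; last by rewrite tmin; exact: m1.
have jn : (j <= n)%N by apply: leq_trans tn; exact: ltnW.
rewrite tmin lt_neqAle m1// andbT; apply/eqP => h.
move: jt; rewrite ltnNge => /negP; apply; apply: t1; first by rewrite mem_iota.
by rewrite h.
Qed.

Lemma min_endP k w :
  reflect (forall j, (j < k)%N -> walk D k w < walk D j w) (min_end (seqA D 0 k w)).
Proof.
apply: (iffP allP) => h j.
  by move=> jk; have := h j; rewrite mem_iota size_seqA jk take_seqA ?(ltnW jk)// !walk_lnS; apply.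
by rewrite mem_iota size_seqA => jk; rewrite take_seqA ?(ltnW jk)// -!walk_lnS; exact: h.
Qed.

Lemma nonneg_pathP k l w :
  reflect (forall j, (j <= l)%N -> walk D k w <= walk D (k + j) w)
    (nonneg_path (seqA D k l w)).
Proof.
apply: (iffP allP) => h j.
  move=> jl; have := h j; rewrite mem_iota size_seqA ltnS jl take_seqA// lnS_seqA subr_ge0.
  exact.
rewrite mem_iota size_seqA ltnS => jl; rewrite take_seqA// lnS_seqA subr_ge0; exact: h.
Qed.

(** The event becomes an intersection of conditions on two disjoint blocks of generations, which are
    independent. *)
Lemma tau_eqP n k w : (k <= n)%N ->
  tau D n w = k <-> min_end (seqA D 0 k w) /\ nonneg_path (seqA D k (n - k) w).
Proof.
move=> kn; have [tn t1 t2] := tau_spec n w; split=> [tE|[/min_endP h1 /nonneg_pathP h2]].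
  rewrite tE in t1 t2; split; first exact/min_endP.
  by apply/nonneg_pathP => j jl; apply: t2; rewrite -(subnKC kn) leq_add2l.
apply/eqP; rewrite eqn_leq; apply/andP; split; rewrite leqNgt; apply/negP => h.
  by have := t1 k h; rewrite ltNge => /negP; apply; have := h2 (tau D n w - k)%N;
    rewrite subnKC ?(ltnW h)//; apply; exact: leq_sub2r.
by have := h1 _ h; rewrite ltNge => /negP; apply; exact: t2.
Qed.

Lemma walk_min_nonneg l w : (0 <= walk_min D l w) = nonneg_path (seqA D 0 l w).
Proof.
have [m1 [j0 j0l m2]] := walk_min_spec l w.
have w0 : walk D 0 w = 0 by rewrite /walk big_ord0.
apply/idP/nonneg_pathP => [h j jl|h]; first by rewrite w0 add0n (le_trans h)// m1.
by rewrite m2 -w0 -[j0]add0n; exact: h.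
Qed.

End WalkPaths.

(** * Spitzer's identity for strict minima *)

Section Spitzer.
Context {d : measure_display} {T : measurableType d} {R : realType}.
Context {P : probability T R}.
Variable D : cbp P.

Notation dm := (dmeas (devents D)).

Lemma dm_seqA k l : dm (gens (block k l)) (seqA D k l).
Proof. exact: (dmeas_comp snd (dm_state D k 0 l)). Qed.

Lemma eqlaw_seqA k k' l : eqlaw P (seqA D k l) (seqA D k' l).
Proof. by move=> Y; exact: (eqlaw_state D k k' 0 l (fun z => Y z.2)). Qed.

Lemma seqA_meas k l Y : measurable (seqA D k l @^-1` Y).
Proof. exact: (dm_meas D Y (dm_seqA k l)). Qed.

Lemma block_disjoint k l : gens (block 0 k) `&` gens (block k l) = set0.
Proof.
apply: gensI; apply/seteqP; split=> // n /= [/andP[_ nk] /andP[kn _]].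
by move: nk; rewrite add0n ltnNge kn.
Qed.

Lemma block_indep k l (Y Y' : set (seq nat)) :
  P (seqA D 0 k @^-1` Y `&` seqA D k l @^-1` Y') =
  (P (seqA D 0 k @^-1` Y) * P (seqA D 0 l @^-1` Y'))%E.
Proof.
rewrite -(eqlaw_seqA k 0 l Y').
exact: (dmeas_indep (devents_indep D) (devents_setT D) (devents_setI D)
  (devents_meas D) _ _ (block_disjoint k l) (dm_seqA 0 k) (dm_seqA k l)).
Qed.

Lemma block_meas k l (Y Y' : set (seq nat)) :
  measurable (seqA D 0 k @^-1` Y `&` seqA D k l @^-1` Y').
Proof. by apply: measurableI; exact: seqA_meas. Qed.

Lemma fine_prob_fibers (V : T -> nat) (E : set T) b :
  (forall n, measurable (V @^-1` [set n])) -> measurable E ->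
  (forall w, E w -> (V w < b)%N) ->
  fine (P E) = \sum_(u < b) fine (P (E `&` V @^-1` [set (u : nat)])).
Proof.
move=> mV mE Vb; rewrite (prob_fibers_nat P mV mE) (nneseries_split 0%N b)//.
rewrite add0n [X in (_ + X)%E](_ : _ = 0%E) ?adde0.
  rewrite big_mkord sum_fine// => u _; apply: fin_num_measure; exact: measurableI.
rewrite eseries0// => u bu _.
rewrite (_ : _ `&` _ = set0) ?measure0//.
by apply/seteqP; split=> // w [/Vb + /= Vw]; rewrite Vw ltnNge bu.
Qed.

Definition path_prob (Q : pred (seq nat)) (z : nat * nat) : R :=
  fine (P [set w | Q (seqA D 0 z.1 w) /\ prodA (seqA D 0 z.1 w) = z.2]).

Definition split_path_prob (Q Q' : pred (seq nat)) (k l v : nat) : R :=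
  fine (P [set w | (Q (seqA D 0 k w) /\ Q' (seqA D k l w)) /\
                   prodA (seqA D 0 (k + l) w) = v]).

Lemma split_path_meas (Q Q' : pred (seq nat)) k l v :
  measurable [set w | (Q (seqA D 0 k w) /\ Q' (seqA D k l w)) /\
                   prodA (seqA D 0 (k + l) w) = v].
Proof.
apply: measurableI; first exact: (block_meas k l (fun s => Q s) (fun s => Q' s)).
exact: (seqA_meas 0 (k + l) [set s | prodA s = v]).
Qed.

(** The products of the two blocks divide [v > 0], hence lie below [b]. The blocks are independent
    and the second has the law of a block started at time 0. *)
Lemma split_path_prob_conv Q Q' k l v b : (0 < v < b)%N ->
  split_path_prob Q Q' k l v = \sum_(u < b) \sum_(x < b) ((u * x)%N == v)%:R * (path_prob Q (k,
    val u) * path_prob Q' (l, val x)).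
Proof.
move=> /andP[v0 vb]; rewrite /split_path_prob.
have bnd w : prodA (seqA D 0 (k + l) w) = v ->
    (prodA (seqA D 0 k w) < b)%N /\ (prodA (seqA D k l w) < b)%N.
  rewrite seqA_cat prodA_cat add0n => h; split; apply: leq_ltn_trans vb; rewrite -h.
    by rewrite leq_pmulr// prodA_gt0.
  by rewrite leq_pmull// prodA_gt0.
rewrite (fine_prob_fibers (fun w => prodA (seqA D 0 k w)) _ b); first last.
- by move=> w [_ /bnd[]].
- exact: split_path_meas.
- by move=> n; exact: (seqA_meas 0 k [set s | prodA s = n]).
apply: eq_bigr => u _.
rewrite (fine_prob_fibers (fun w => prodA (seqA D k l w)) _ b); first last.
- by move=> w [[_ /bnd[]]].
- apply: measurableI; first exact: split_path_meas.
  exact: (seqA_meas 0 k [set s | prodA s = (u : nat)]).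
- by move=> n; exact: (seqA_meas k l [set s | prodA s = n]).
apply: eq_bigr => x _.
have [ux|ux] := eqVneq (u * x)%N v; last first.
  rewrite mul0r (_ : _ `&` _ = set0) ?measure0//.
  apply/seteqP; split=> // w [[[_ pw] /= pu] /= px]; case/negP: ux.
  by rewrite -pw seqA_cat prodA_cat add0n pu px.
rewrite mul1r /path_prob -fineM ?fin_num_measure//; last 2 first.
- exact: (seqA_meas 0 k [set s | Q s /\ prodA s = u]).
- exact: (seqA_meas 0 l [set s | Q' s /\ prodA s = x]).
rewrite /= -(block_indep k l [set s | Q s /\ prodA s = u] [set s | Q' s /\ prodA s = x]).
congr (fine (P _)); apply/seteqP; split=> [w [[[[h1 h2] h3] h4] h5]|w [[h1 h2] [h3 h4]]] //.
split=> //; split=> //; split=> //.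
by rewrite seqA_cat prodA_cat add0n h2 h4.
Qed.

Lemma sum_antidiagonal a n (t : nat -> nat -> R) : (n < a)%N ->
  \sum_(j < a) \sum_(k < a) ((j + k)%N == n)%:R * t j k = \sum_(j < n.+1) t j (n - j)%N.
Proof.
move=> na; rewrite (big_ord_widen_cond a predT (fun j => t j (n - j)%N) na).
rewrite [RHS]big_mkcond; apply: eq_bigr => j _ /=; case: ifPn => [jn|nj].
  have kb : (n - j < a)%N by apply: leq_ltn_trans na; exact: leq_subr.
  rewrite (bigD1 (Ordinal kb))//= subnKC// eqxx mul1r big1 ?addr0// => k kn.
  case: eqP => [jk|_]; last by rewrite mul0r.
  by case/negP: kn; apply/eqP/val_inj => /=; rewrite -jk addKn.
rewrite big1// => k _; case: eqP => [jk|_]; last by rewrite mul0r.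
by move: nj; rewrite ltnS -jk leq_addr.
Qed.

Lemma conv_path_prob a b Q Q' n v : inrange a b (n, v) ->
  conv a b (path_prob Q) (path_prob Q') (n, v) = \sum_(j < n.+1) split_path_prob Q Q' j (n - j) v.
Proof.
move=> /andP[/= na vb]; rewrite -(sum_antidiagonal a n (fun j k => split_path_prob Q Q' j k v) na).
under [RHS]eq_bigr => j _ do under eq_bigr => k _ do rewrite (split_path_prob_conv _ _ _ _ _ b vb).
rewrite /conv -(pair_bigA _ (fun (j : 'I_a) (u : 'I_b) => \sum_(y : 'I_a * 'I_b)
  (pmul (pval (j, u)) (pval y) == (n, v))%:R *
  (path_prob Q (pval (j, u)) * path_prob Q' (pval y)))) /=.
apply: eq_bigr => j _.
under eq_bigr => u _.
  rewrite -(pair_bigA _ (fun (k : 'I_a) (x : 'I_b) => (pmul (pval (j, u)) (pval (k, x)) == (n,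
    v))%:R *
    (path_prob Q (pval (j, u)) * path_prob Q' (pval (k, x))))) /=.
  over.
rewrite exchange_big /=; apply: eq_bigr => k _.
rewrite mulr_sumr; apply: eq_bigr => u _; rewrite mulr_sumr; apply: eq_bigr => x _.
by rewrite [RHS]mulrA -natrM mulnb; congr (_%:R * _).
Qed.

Definition min_end_prob n : R := fine (P (seqA D 0 n @^-1` [set s | min_end D s])).

Definition neg_walk_prob n : R := fine (P [set w | walk D n w < 0]).

Lemma min_end_prob_dminus n : min_end_prob n = dminus D n.
Proof.
congr (fine (P _)); apply/seteqP; split=> w /=.
  move=> h; apply/(tau_eqP D n n w (leqnn n)); split=> //.
  by apply/nonneg_pathP => j; rewrite subnn leqn0 => /eqP ->; rewrite addn0.
by move/(tau_eqP D n n w (leqnn n)) => [].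
Qed.

Lemma neg_walk_prob_lnS n : neg_walk_prob n = fine (P (seqA D 0 n @^-1` [set s | lnS D s < 0])).
Proof. by congr (fine (P _)); apply/seteqP; split=> w /=; rewrite walk_lnS. Qed.

Definition neg_sum (s : seq nat) : bool := lnS D s < 0.
Definition pos_sum (s : seq nat) : bool := (0 < size s)%N && (0 <= lnS D s).

(** [graded_factorization] with [F] the law of all paths, [D] those ending at a strict minimum, [E]
    those staying nonnegative, and [Fn], [Fp] the nonempty paths of negative and nonnegative sum.
    The box sizes [n + 1] and [v + 1] are the least that contain the index. *)
Lemma spitzer_graded n v : (0 < v)%N ->
  n%:R * path_prob (min_end D) (n, v) = \sum_(j < n.+1) split_path_prob neg_sum (min_end D) j (n
    - j) v.
Proof.
move=> v0; pose a := n.+1; pose b := v.+1.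
have nvr : inrange a b (n, v) by rewrite /inrange /= ltnSn v0 ltnSn.
rewrite -(conv_path_prob a b neg_sum (min_end D) n v nvr).
have path_prob0 (Q : pred (seq nat)) z : (forall w, Q (seqA D 0 z.1 w) -> prodA (seqA D 0 z.1 w)
  = z.2 -> False) ->
    path_prob Q z = 0.
  move=> h; rewrite /path_prob (_ : [set w | _] = set0) ?measure0//.
  by apply/seteqP; split=> // w [/h].
have path_prob1 (Q : pred (seq nat)) z : Q [::] -> z.1 = 0%N -> path_prob Q z = conv1 z.
  case: z => k x /= Q0 -> ; rewrite /path_prob /conv1 /=.
  have [->|x1] := eqVneq x 1%N.
    rewrite eqxx (_ : [set w | _] = setT) ?probability_setT//.
    by apply/seteqP; split=> // w _; split=> //; rewrite /prodA /seqA /= big_nil.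
  rewrite xpair_eqE /= (negbTE x1) (_ : [set w | _] = set0) ?measure0//.
  apply/seteqP; split=> // w [_ /= h]; case/negP: x1; rewrite -h.
  by rewrite /prodA /seqA /= big_nil.
have lnxy (x y : nat) : (0 < x)%N -> (0 < y)%N -> ln (x * y)%:R = ln x%:R + ln y%:R :> R.
  by move=> x0 y0; rewrite natrM lnM// posrE ltr0n.
have main := @graded_factorization R a b (negz D) (path_prob predT) (path_prob (min_end D))
  (path_prob (nonneg_path D)) (path_prob neg_sum) (path_prob pos_sum).
apply: main nvr => //.
(* The factorization [F = D * E]: partition by the value of [tau], then cut there. *)
- move=> [k x] kxr; rewrite conv_path_prob//.
  rewrite [LHS](fine_prob_fibers (tau D k) _ k.+1); first last.
  + by move=> w _; have [] := tau_spec D k w.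
  + exact: (seqA_meas 0 k [set s | true /\ prodA s = x]).
  + by move=> j; have := measurable_tau D k measurableT (Y := [set j]) I; rewrite setTI.
  apply: eq_bigr => j _; congr (fine (P _)); have jk : (j <= k)%N by rewrite -ltnS.
  apply/seteqP; split=> w /=.
    by move=> [[_ pw] /(tau_eqP D k j w jk)[h1 h2]]; rewrite subnKC.
  by rewrite subnKC// => -[[h1 h2] h3]; split=> //; apply/(tau_eqP D k j w jk).
(* [Fn + Fp] is the law of all nonempty blocks. Cutting off such a block at any of the [k] times
   [j >= 1] gives back the full path probability, so the convolution is [k] times [F]. *)
- move=> [k x] kxr.
  have -> : conv a b (fun z => path_prob neg_sum z + path_prob pos_sum z) (path_prob predT) (k, x) =
      conv a b (path_prob (fun s => (0 < size s)%N)) (path_prob predT) (k, x).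
    apply: eq_conv => // z _; rewrite /path_prob -fineD ?fin_num_measure//; last 2 first.
    + exact: (seqA_meas 0 z.1 [set s | neg_sum s /\ prodA s = z.2]).
    + exact: (seqA_meas 0 z.1 [set s | pos_sum s /\ prodA s = z.2]).
    rewrite -measureU//; last 3 first.
    + exact: (seqA_meas 0 z.1 [set s | neg_sum s /\ prodA s = z.2]).
    + exact: (seqA_meas 0 z.1 [set s | pos_sum s /\ prodA s = z.2]).
    + apply/seteqP; split=> // w [[n1 _] [/andP[_ n2] _]].
      by move: n1; rewrite /neg_sum ltNge n2.
    congr (fine (P _)); apply/seteqP; split=> [w [[n1 n2]|[/andP[n1 _] n2]]|w [n1 n2]] //.
      split=> //; move: n1; rewrite /neg_sum; case: (seqA D 0 z.1 w) => //.
      by rewrite /lnS big_nil ltxx.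
    have [h|h] := ltP (lnS D (seqA D 0 z.1 w)) 0; first by left.
    by right; split=> //; rewrite /pos_sum n1.
  rewrite conv_path_prob// /grade /=.
  rewrite (eq_bigr (fun j : 'I_k.+1 => (0 < j)%N%:R * path_prob predT (k, x))).
    rewrite -mulr_suml; congr (_ * _); rewrite -natr_sum; congr (_%:R).
    rewrite big_ord_recl /= add0n (eq_bigr (fun=> 1%N)) ?sum1_card ?card_ord//.
  move=> j _; have jk : (j <= k)%N by rewrite -ltnS.
  have [->|j0] := posnP (val j).
    rewrite mul0r /split_path_prob (_ : [set w | _] = set0) ?measure0//.
    by apply/seteqP; split=> // w [[]].
  rewrite mul1r /split_path_prob /path_prob; congr (fine (P _)); apply/seteqP; split=> w /=;
    rewrite subnKC//.
    by move=> [_ h].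
  by move=> [_ h]; rewrite size_seqA j0.
- by move=> z _ z0; apply: path_prob1.
- move=> z _ z0; apply: path_prob1 => //.
  by rewrite /nonneg_path /= /lnS big_nil lexx.
- move=> z z0; apply: path_prob0 => w; rewrite z0 /neg_sum /seqA /= /lnS big_nil ltxx//.
- by move=> z z0; apply: path_prob0 => w; rewrite z0.
- move=> [k x] /= zn; apply: path_prob0 => w /= h1 h2; case/negP: zn.
  by rewrite -h2 -lnS_negz.
- move=> [k x] /= zn; apply: path_prob0 => w /= /andP[_ h1] h2.
  by move: zn; rewrite -h2 -lnS_negz ltNge h1.
- move=> [k x] _ /= k0 zn; apply: path_prob0 => w /= h1 h2; case/negP: zn.
  rewrite -h2 -lnS_negz; move/allP : h1 => /(_ 0%N).
  by rewrite mem_iota size_seqA k0 take0 {2}/lnS big_nil; apply.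
- move=> [k x] _ /= zn; apply: path_prob0 => w /= h1 h2.
  move: zn; rewrite -h2 -lnS_negz ltNge; move/allP : h1 => /(_ k).
  rewrite mem_iota size_seqA ltnSn take_oversize ?size_seqA// => -> //.
- move=> [k x] [l y] /andP[_ /andP[/= x0 _]] /andP[_ /andP[/= y0 _]]; rewrite /negz /pmul /=.
  by rewrite natrD (lnxy x y x0 y0) => h1 h2; lra.
- move=> [k x] [l y] /andP[_ /andP[/= x0 _]] /andP[_ /andP[/= y0 _]]; rewrite /negz /pmul /=.
  by rewrite natrD (lnxy x y x0 y0) -!leNgt => h1 h2; lra.
Qed.

(** Summation of [spitzer_graded] over the product [v]; the fibre [v = 0] is empty because
    [A >= 1]. *)
Lemma spitzer_recurrence n : n%:R * min_end_prob n = \sum_(j < n.+1) neg_walk_prob j *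
  min_end_prob (n - j)%N.
Proof.
have mE : measurable (seqA D 0 n @^-1` [set s | min_end D s]) by exact: seqA_meas.
have mV : forall v, measurable ((fun w => prodA (seqA D 0 n w)) @^-1` [set v]).
  by move=> v; exact: (seqA_meas 0 n [set s | prodA s = v]).
have mG (j : nat) : measurable (seqA D 0 j @^-1` [set s | neg_sum s] `&`
    seqA D j (n - j) @^-1` [set s | min_end D s]) by exact: block_meas.
have term v : (n%:R%:E * P (seqA D 0 n @^-1` [set s | min_end D s] `&`
      (fun w => prodA (seqA D 0 n w)) @^-1` [set v]) =
    \sum_(j < n.+1) P (seqA D 0 j @^-1` [set s | neg_sum s] `&`
      seqA D j (n - j) @^-1` [set s | min_end D s] `&`
      (fun w => prodA (seqA D 0 n w)) @^-1` [set v]))%E.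
  have [->|v0] := posnP v.
    have e0 (E : set T) : E `&` (fun w => prodA (seqA D 0 n w)) @^-1` [set 0%N] = set0.
      apply/seteqP; split=> // w [_ /= h].
      by have := prodA_gt0 D 0 n w; rewrite h.
    by rewrite e0 measure0 mule0 big1// => j _; rewrite e0 measure0.
  rewrite -[P (_ `&` _)]fineK; last by apply: fin_num_measure; exact: measurableI.
  rewrite -EFinM (spitzer_graded n v v0) -sumEFin; apply: eq_bigr => j _.
  have jn : (j <= n)%N by rewrite -ltnS.
  rewrite fineK; last by apply: fin_num_measure; exact: split_path_meas.
  by rewrite subnKC.
apply/EFin_inj; rewrite EFinM fineK ?fin_num_measure//.
rewrite (prob_fibers_nat P mV mE) -nneseriesZl//.
rewrite (eq_eseriesr (fun v _ => term v)).
rewrite nneseries_sum// -sumEFin; apply: eq_bigr => j _.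
rewrite -(prob_fibers_nat P mV (mG j)) block_indep neg_walk_prob_lnS EFinM !fineK//;
  by apply: fin_num_measure; exact: seqA_meas.
Qed.

End Spitzer.

(** * Vanishing of the atoms of the walk *)

Section ProductAtoms.
Context {d : measure_display} {T : measurableType d} {R : realType}.
Context {P : probability T R}.
Variable D : cbp P.

Definition atomA (a : nat) : R := fine (P (A D 0 @^-1` [set a])).

(** The argument is real so that dividing it by a value of [A] needs no divisibility; a nonintegral
    argument has mass 0. *)
Definition prod_at (n : nat) (x : R) : R :=
  fine (P (seqA D 0 n @^-1` [set s | (prodA s)%:R = x])).

Lemma seqA1 n w : seqA D n 1 w = [:: A D n w].
Proof. by rewrite /seqA /mkseq /= addn0. Qed.

Lemma atomAE n a : (atomA a)%:E = P (A D n @^-1` [set a]).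
Proof.
have E k : A D k @^-1` [set a] = seqA D k 1 @^-1` [set s | s = [:: a]].
  by apply/seteqP; split=> w; rewrite /= seqA1; [move=> ->|case].
rewrite /atomA fineK ?E; last by apply: fin_num_measure; exact: seqA_meas.
exact: (eqlaw_seqA D 0 n 1).
Qed.

Lemma atomA_ge0 a : 0 <= atomA a.
Proof. by rewrite -lee_fin (atomAE 0). Qed.

Lemma A_fiber_meas n (Y : set nat) : measurable (A D n @^-1` Y).
Proof. by have := measurable_A D n measurableT (Y := Y) I; rewrite setTI. Qed.

Lemma prod_atE n x : (prod_at n x)%:E = P (seqA D 0 n @^-1` [set s | (prodA s)%:R = x]).
Proof. by rewrite /prod_at fineK//; apply: fin_num_measure; exact: seqA_meas. Qed.

Lemma prod_at_ge0 n x : 0 <= prod_at n x.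
Proof. by rewrite -lee_fin prod_atE. Qed.

Lemma prodAS n w : prodA (seqA D 0 n.+1 w) = (prodA (seqA D 0 n w) * A D n w)%N.
Proof. by rewrite seqAS -cats1 prodA_cat add0n [prodA [:: _]]big_seq1. Qed.

Lemma prod_at_fiber n v x : (0 < v)%N ->
  P (seqA D 0 n.+1 @^-1` [set s | (prodA s)%:R = x] `&` A D n @^-1` [set v]) =
  (prod_at n (x / v%:R) * atomA v)%:E.
Proof.
move=> v0; rewrite EFinM prod_atE (atomAE 0).
have v0R : v%:R != 0 :> R by rewrite pnatr_eq0 -lt0n.
have -> : A D 0 @^-1` [set v] = seqA D 0 1 @^-1` [set s | s = [:: v]].
  by apply/seteqP; split=> w; rewrite /= seqA1; [move=> ->|case].
rewrite -block_indep; congr (P _); apply/seteqP; split=> w /=; rewrite prodAS seqA1.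
  by move=> [<- ->]; rewrite natrM mulfK.
by move=> [h [vE]]; rewrite vE natrM h divfK.
Qed.

(** Split on whether the last factor is [a]; otherwise the mass at [x] is a mixture of atoms of the
    shorter product, each at most [q]. *)
Lemma prod_at_step n a x q : (0 < a)%N -> (forall y, prod_at n y <= q) ->
  prod_at n.+1 x <= atomA a * prod_at n (x / a%:R) + (1 - atomA a) * q.
Proof.
move=> a0 Hq; have q0 : 0 <= q := le_trans (prod_at_ge0 n 0) (Hq 0).
pose E := seqA D 0 n.+1 @^-1` [set s | (prodA s)%:R = x].
have mE : measurable E by exact: seqA_meas.
have mV v : measurable (A D n @^-1` [set v]) by exact: A_fiber_meas.
have mC : measurable (A D n @^-1` (~` [set a])) by exact: A_fiber_meas.
have PC : P (A D n @^-1` (~` [set a])) = (1 - atomA a)%:E.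
  by rewrite -preimage_setC probability_setC// EFinB (atomAE n).
rewrite -lee_fin prod_atE -/E.
rewrite (_ : E = (E `&` A D n @^-1` [set a]) `|` (E `&` A D n @^-1` (~` [set a]))); last first.
  by rewrite -setIUr -preimage_setU setUv preimage_setT setIT.
have PU : P ((E `&` A D n @^-1` [set a]) `|` (E `&` A D n @^-1` (~` [set a]))) =
    (P (E `&` A D n @^-1` [set a]) + P (E `&` A D n @^-1` (~` [set a])))%E.
  apply: measureU; [exact: measurableI|exact: measurableI|].
  by apply/seteqP; split=> // w [[_ /= h] [_ /=]].
rewrite PU EFinD; apply: leeD; first by rewrite mulrC -(prod_at_fiber n a x a0).
rewrite EFinM muleC -PC (prob_fibers_nat P mV (measurableI _ _ mE mC)).
rewrite (prob_fibers_nat P mV mC) -nneseriesZl//.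
apply: lee_nneseries => // v _.
have [->|va] := eqVneq v a.
  rewrite (_ : _ `&` _ = set0) ?measure0; last first.
    by apply/seteqP; split=> // w [[_ /= h] /=].
  by rewrite mule_ge0.
have [->|v0] := posnP v.
  rewrite (_ : _ `&` _ = set0) ?measure0; last first.
    by apply/seteqP; split=> // w [[_ /= _] /= h]; have := A_gt0 D n w; rewrite -/(A D n w) h.
  by rewrite mule_ge0.
have -> : A D n @^-1` (~` [set a]) `&` A D n @^-1` [set v] = A D n @^-1` [set v].
  by apply/seteqP; split=> [w []//|w /= h]; split=> //=; rewrite h => /eqP; rewrite (negbTE va).
apply: (@le_trans _ _ (P (E `&` A D n @^-1` [set v]))).
  apply: le_measure; rewrite ?inE; last by move=> w [[h _] h']; split.
    by apply: measurableI => //; exact: measurableI.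
  exact: measurableI.
rewrite (prod_at_fiber n v x v0) EFinM (atomAE n) -(atomAE n).
by rewrite -!EFinM lee_fin ler_wpM2r ?atomA_ge0.
Qed.

Lemma atomA_gt0 a : atomA a != 0 -> (0 < a)%N.
Proof.
apply: contraNltn; rewrite leqn0 => /eqP ->; rewrite /atomA (_ : _ @^-1` _ = set0) ?measure0//.
by apply/seteqP; split=> // w /= h; have := A_gt0 D 0 w; rewrite -/(A D 0 w) h.
Qed.

Lemma exists_atom (Y : set nat) : (0 < P (A D 0 @^-1` Y))%E ->
  exists2 a, Y a & 0 < atomA a.
Proof.
move=> PY; apply: contrapT => no; move: PY.
rewrite (prob_fibers_nat P (fun v => A_fiber_meas 0 [set v]) (A_fiber_meas 0 Y)).
rewrite eseries0 ?ltxx// => v _ _.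
have [Yv|Yv] := pselect (Y v); last first.
  by rewrite (_ : _ `&` _ = set0) ?measure0//; apply/seteqP; split=> // w [/= h] e; apply: Yv;
    rewrite -e.
apply/eqP; rewrite eq_le measure_ge0 andbT.
apply: (@le_trans _ _ (P (A D 0 @^-1` [set v]))).
  apply: le_measure; rewrite ?inE; [|exact: A_fiber_meas|by move=> w []].
  by apply: measurableI; exact: A_fiber_meas.
rewrite -(atomAE 0) lee_fin leNgt; apply/negP => h; apply: no; by exists v.
Qed.

Lemma two_atoms : nondegenerate_walk D ->
  exists a b, [/\ a <> b, 0 < atomA a & 0 < atomA b].
Proof.
move=> nd; have [|a _ a0] := exists_atom setT.
  by rewrite preimage_setT probability_setT.
have [|b ba b0] := exists_atom (~` [set a]); last first.
  by exists a, b; split=> // /esym.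
rewrite -preimage_setC probability_setC ?sube_gt0; last exact: A_fiber_meas.
apply: le_lt_trans (nd (ln (m D * lambda D * a%:R))).
apply: le_measure; rewrite ?inE; [exact: A_fiber_meas| |by move=> w /= aw; rewrite /M aw].
exact: (A_fiber_meas 0 [set v | ln (m D * lambda D * v%:R) = ln (m D * lambda D * a%:R)]).
Qed.

Lemma prod_at_le1 n x : prod_at n x <= 1.
Proof.
by rewrite -lee_fin prod_atE; apply: probability_le1; exact: seqA_meas.
Qed.

Lemma prod_at_mono n q : (forall y, prod_at n y <= q) -> forall k y, prod_at (n + k) y <= q.
Proof.
move=> Hq; elim=> [|k IH] y; first by rewrite addn0.
have [|a _ a0] := exists_atom setT; first by rewrite preimage_setT probability_setT.
rewrite addnS; apply: le_trans (prod_at_step (n + k) a y q _ IH) _.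
  by apply: atomA_gt0; rewrite gt_eqF.
rewrite -lerBrDr -[leRHS]/(q - (1 - atomA a) * q) mulrBl mul1r subKr.
by rewrite ler_wpM2l ?atomA_ge0.
Qed.

Lemma prod_at_sum n k (x : nat -> R) : (forall i j, (i < k)%N -> (j < k)%N -> x i = x j -> i = j) ->
  \sum_(i < k) prod_at n (x i) <= 1.
Proof.
move=> xinj; rewrite -lee_fin -sumEFin.
under eq_bigr => i _ do rewrite prod_atE.
rewrite -(measure_bigsetU_ord P predT (fun i : 'I_k => _)) //.
- apply: probability_le1; apply: bigsetU_measurable => i _; exact: seqA_meas.
- by move=> i; exact: seqA_meas.
- move=> i j _ _ [w [/= h1 h2]]; apply: val_inj; apply: xinj; [exact: ltn_ord|exact: ltn_ord|].
  exact: etrans (esym h1) h2.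
Qed.

(** Let [Q] be the infimum of uniform atom bounds. If [Q > 0], an atom of nearly maximal mass at [x]
    forces nearly maximal atoms at [x / a] and [x / b] one step earlier. After [k] steps back there
    are [k + 1] distinct atoms of mass at least [Q / 2], more than total mass 1 allows. *)
Lemma prod_at_cvg0 : nondegenerate_walk D ->
  forall e, 0 < e -> exists n0, forall n x, (n0 <= n)%N -> prod_at n x <= e.
Proof.
move=> nd e e0; have [a [b [ab ga gb]]] := two_atoms nd.
have a0 : (0 < a)%N by apply: atomA_gt0; rewrite gt_eqF.
have b0 : (0 < b)%N by apply: atomA_gt0; rewrite gt_eqF.
pose U := [set q | exists n, forall x, prod_at n x <= q].
have U1 : U 1 by exists 0%N => x; exact: prod_at_le1.
have Ulb : lbound U 0 by move=> q [n /(_ 0)]; exact: le_trans (prod_at_ge0 n 0).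
have Uinf : has_inf U by split; [exists 1|exists 0].
pose Q := inf U.
have Q0 : 0 <= Q by apply: lb_le_inf => //; exists 1.
suff Qle0 : Q <= 0.
  have [q [n Hq] qe] := inf_adherent e0 Uinf.
  exists n => k x nk; rewrite -(subnKC nk); apply: le_trans (prod_at_mono n q Hq _ _) _.
  by apply: ltW; apply: lt_le_trans qe _; rewrite -/Q; lra.
rewrite leNgt; apply/negP => Qpos.
pose g := Num.min (atomA a) (atomA b); have g0 : 0 < g by rewrite lt_min ga gb.
have g1 : g <= 1.
  by rewrite ge_min -lee_fin (atomAE 0) probability_le1//; exact: A_fiber_meas.
(* The growth factor of the defect [Q - mass] per step back: at most twice the defect, divided by
   the probability of the factor removed. *)
pose c := 2 / g; have c1 : 1 <= c by rewrite /c ler_pdivlMr//; lra.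
have [k kQ] : exists k, 1 < k.+1%:R * (Q / 2).
  pose k := Num.bound (Q / 2)^-1; exists k.
  rewrite -ltr_pdivrMr; last by lra.
  rewrite mul1r; apply: lt_trans (archi_boundP _) _; last by rewrite ltr_nat.
  by rewrite invr_ge0; lra.
(* A starting defect that is still only [Q / 2] after [k] steps back. *)
have [ee eeE] : exists ee, ee = Q / 2 / c ^+ k by exists (Q / 2 / c ^+ k).
have ck0 : 0 < c ^+ k by rewrite exprn_gt0//; lra.
have ee0 : 0 < ee by rewrite eeE divr_gt0//; lra.
have [q [n Hq] qe] := inf_adherent ee0 Uinf.
have [x Hx] : exists x, Q - ee < prod_at (n + k) x.
  apply: contrapT => no; have : Q <= Q - ee.
    apply: ge_inf; first by exists 0.
    exists (n + k)%N => x; rewrite leNgt; apply/negP => h; apply: no; by exists x.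
  by lra.
have step l y h z : (z = a \/ z = b) -> ee <= h ->
    Q - h <= prod_at (n + l.+1) y -> Q - c * h <= prod_at (n + l) (y / z%:R).
  move=> zab eh hy.
  have z0 : (0 < z)%N by case: zab => ->.
  have gz : g <= atomA z by case: zab => ->; rewrite ge_min lexx ?orbT.
  have z1 : atomA z <= 1 by rewrite -lee_fin (atomAE 0) probability_le1//; exact: A_fiber_meas.
  have zpos : 0 < atomA z := lt_le_trans g0 gz.
  have Hq' w : prod_at (n + l) w <= Q + ee.
    by apply: le_trans (prod_at_mono n q Hq l w) _; exact: ltW.
  have := prod_at_step (n + l) z y _ z0 Hq'; rewrite -addnS => st.
  set f := prod_at (n + l) _ in st *.
  have gc : 2 <= atomA z * c.
    by rewrite /c mulrCA -[leLHS]mulr1 ler_pM2l// ler_pdivlMr// mul1r.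
  have h0 : 0 < h := lt_le_trans ee0 eh.
  rewrite -(ler_pM2l zpos) mulrBr mulrA.
  have : 2 * h <= atomA z * c * h by rewrite ler_pM2r.
  have : (1 - atomA z) * ee <= (1 - atomA z) * h by rewrite ler_wpM2l//; lra.
  have : 0 <= atomA z * h by rewrite mulr_ge0 ?ltW.
  by move: st; rewrite mulrDr; nra.
have desc j : (j <= k)%N -> forall i, (i <= j)%N ->
    Q - ee * c ^+ j <= prod_at (n + (k - j)) (x / (a%:R ^+ i * b%:R ^+ (j - i))).
  elim: j => [|j IH] jk i ij.
    move: ij; rewrite leqn0 => /eqP ->; rewrite !expr0 !mulr1 invr1 mulr1 subn0; exact: ltW.
  have kj : (k - j = (k - j.+1).+1)%N by rewrite subnSK.
  have eej : ee <= ee * c ^+ j by rewrite -{1}[ee]mulr1 ler_wpM2l ?exprn_ege1// ltW.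
  have -> : ee * c ^+ j.+1 = c * (ee * c ^+ j) by rewrite exprS mulrCA.
  have [ij'|] := leqP i j.
    have -> : x / (a%:R ^+ i * b%:R ^+ (j.+1 - i)) = x / (a%:R ^+ i * b%:R ^+ (j - i)) / b%:R.
      by rewrite subSn// exprSr mulrA [in LHS]invfM mulrA.
    apply: step => //; first by right.
    by rewrite -kj; apply: IH => //; exact: ltnW.
  move=> ji; have -> : i = j.+1 by apply/eqP; rewrite eqn_leq ij.
  have -> : x / (a%:R ^+ j.+1 * b%:R ^+ (j.+1 - j.+1)) = x / (a%:R ^+ j * b%:R ^+ (j - j)) / a%:R.
    by rewrite !subnn !mulr1 exprSr [in LHS]invfM mulrA.
  apply: step => //; first by left.
  by rewrite -kj; apply: IH => //; exact: ltnW.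
have x0 : x != 0.
  apply/eqP => x0; have : prod_at (n + k) x = 0.
    rewrite /prod_at (_ : _ @^-1` _ = set0) ?measure0//; apply/seteqP; split=> // w /= /eqP.
    by rewrite x0 pnatr_eq0 eqn0Ngt prodA_gt0.
  have : ee <= Q / 2 by rewrite eeE ler_pdivrMr// ler_peMr ?exprn_ege1//; lra.
  by move=> h1 h2; move: Hx; rewrite h2; lra.
have aR : a%:R != 0 :> R by rewrite pnatr_eq0 -lt0n.
have bR : b%:R != 0 :> R by rewrite pnatr_eq0 -lt0n.
have dist i j : (i <= k)%N -> (j <= k)%N -> (i < j)%N ->
    a%:R ^+ i * b%:R ^+ (k - i) <> a%:R ^+ j * b%:R ^+ (k - j) :> R.
  move=> ik jk ij h; have kj : (k - i = (j - i) + (k - j))%N.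
    by rewrite addnC addnBA ?(ltnW ij)// subnK.
  have : b%:R ^+ (j - i) = a%:R ^+ (j - i) :> R.
    apply: (mulfI (expf_neq0 i aR)); rewrite -exprD subnKC ?(ltnW ij)//.
    by apply: (mulIf (expf_neq0 (k - j) bR)); rewrite -mulrA -exprD -kj.
  move/eqP; rewrite -!natrX eqr_nat eqn_exp2r ?subn_gt0// => /eqP /esym; exact: ab.
have := prod_at_sum n k.+1 (fun i => x / (a%:R ^+ i * b%:R ^+ (k - i))).
(* Discharges the injectivity premise of [prod_at_sum], which is [dist], and leaves the mass bound
   to be contradicted. *)
have -> : forall B : Prop, ((forall i j, (i < k.+1)%N -> (j < k.+1)%N ->
   x / (a%:R ^+ i * b%:R ^+ (k - i)) = x / (a%:R ^+ j * b%:R ^+ (k - j)) -> i = j) -> B) = B.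
  move=> B; apply/propext; split=> [h|//]; apply: h => i j ik jk /(mulfI x0)/invr_inj h.
  have [ij|ji|//] := ltngtP i j.
    by case: (dist i j ik jk ij).
  by case: (dist j i jk ik ji).
apply/negP; rewrite -ltNge; apply: lt_le_trans kQ _.
rewrite -[X in X%:R * _]card_ord mulr_natl -sumr_const; apply: ler_sum => i _.
have := desc k (leqnn k) i; rewrite subnn addn0 -ltnS ltn_ord => /(_ isT).
by apply: le_trans; rewrite eeE divfK ?gt_eqF//; lra.
Qed.

End ProductAtoms.

(** * Regularity of sequences satisfying Spitzer's recurrence *)

Section Renewal.
Context {R : realType}.
Variables (d a : nat -> R) (theta : R).
Hypothesis d0 : d 0 = 1.
Hypothesis d_ge0 : forall n, 0 <= d n.
Hypothesis d_decr : forall n, d n.+1 <= d n.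
Hypothesis a0 : a 0 = 0.
Hypothesis a01 : forall n, 0 <= a n <= 1.
Hypothesis drec : forall n, n%:R * d n = \sum_(j < n.+1) a j * d (n - j)%N.
Hypothesis a_cvg : a n @[n --> \oo] --> theta.
Hypothesis theta01 : 0 < theta <= 1.

Let Dsum n : R := \sum_(j < n) d j.

Lemma renewal_mono k n : (k <= n)%N -> d n <= d k.
Proof. by move: k n; apply/nonincreasing_seqP. Qed.

Lemma Dsum_mono k n : (k <= n)%N -> Dsum k <= Dsum n.
Proof.
move: k n; apply/nondecreasing_seqP => n.
by rewrite /Dsum big_ord_recr /= lerDl.
Qed.

Lemma Dsum_lower n : n%:R * d n <= Dsum n.
Proof.
rewrite -[n in n%:R]card_ord mulr_natl -sumr_const; apply: ler_sum => j _.
by apply: renewal_mono; exact: ltnW.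
Qed.

Lemma Dsum_ge1 n : (0 < n)%N -> 1 <= Dsum n.
Proof. by move=> n0; apply: le_trans (Dsum_mono _ _ n0); rewrite /Dsum big_ord1 d0. Qed.

(** Replacing [a] by its limit costs [e / 2] of the partial sum, except for the first [N0] terms.
    Those are at most [N0 * d (n - N0)], which is small because monotonicity gives
    [k * d k <= Dsum k]. *)
Lemma renewal_ratio e : 0 < e ->
  \forall n \near \oo, `|n%:R * d n - theta * Dsum n| <= e * Dsum n.
Proof.
move=> e0; have e20 : 0 < e / 2 by lra.
have [N0 _ HN] := @cvgr_dist_le _ _ _ _ _ _ _ a_cvg _ e20.
near=> n; have nN : (N0 <= n)%N by near: n; exact: nbhs_infty_ge.
have -> : n%:R * d n - theta * Dsum n = \sum_(j < n) (a j.+1 - theta) * d (n - j.+1)%N.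
  rewrite drec big_ord_recl a0 mul0r add0r.
  have -> : theta * Dsum n = \sum_(j < n) theta * d (n - j.+1)%N.
    by rewrite /Dsum (reindex_inj rev_ord_inj) mulr_sumr.
  by rewrite -sumrB; apply: eq_bigr => j _; rewrite mulrBl.
apply: le_trans (ler_norm_sum _ _ _) _.
apply: (@le_trans _ _ (\sum_(j < n) (e / 2 * d (n - j.+1)%N +
    ((j < N0)%N)%:R * d (n - N0)%N))).
  apply: ler_sum => j _; rewrite normrM [`|d _|]ger0_norm//.
  have [jN|jN] := ltnP j N0; last first.
    rewrite mul0r addr0 ler_wpM2r// distrC; apply: HN => /=.
    exact: leq_trans jN (leqnSn j).
  rewrite mul1r; apply: (@le_trans _ _ (d (n - N0)%N)); last first.
    by rewrite lerDr mulr_ge0// ltW.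
  apply: (@le_trans _ _ (1 * d (n - j.+1)%N)).
    rewrite ler_wpM2r// ler_norml; have := a01 j.+1; have th := theta01.
    by move=> /andP[? ?]; move: th => /andP[? ?]; apply/andP; split; lra.
  by rewrite mul1r; apply: renewal_mono; exact: leq_sub2l.
rewrite big_split /= -mulr_sumr -mulr_suml.
have -> : \sum_(j < n) d (n - j.+1)%N = Dsum n by rewrite [RHS](reindex_inj rev_ord_inj).
have cN : \sum_(j < n) ((j < N0)%N)%:R = N0%:R :> R.
  transitivity (\sum_(j < n | (j < N0)%N) (1 : R)).
    by rewrite [RHS]big_mkcond; apply: eq_bigr => j _; case: ifP.
  by rewrite -(big_ord_widen n (fun=> 1 : R) nN) sumr_const card_ord.
rewrite cN [leRHS](_ : _ = e / 2 * Dsum n + e / 2 * Dsum n); last by rewrite -mulrDl; congr (_ *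
  _); lra.
rewrite lerD2l.
have nb : 2 / e * N0%:R + N0%:R <= n%:R by near: n; exact: nbhs_infty_ger.
have Nnb : N0%:R <= e / 2 * (n - N0)%N%:R.
  have : 2 / e * N0%:R <= (n - N0)%N%:R by rewrite natrB//; lra.
  by rewrite -(ler_pM2l e20) mulrA (_ : e / 2 * (2 / e) = 1) ?mul1r//; field; rewrite gt_eqF.
apply: (@le_trans _ _ (e / 2 * ((n - N0)%N%:R * d (n - N0)%N))); first by rewrite mulrA ler_wpM2r.
rewrite ler_pM2l//.
by apply: le_trans (Dsum_lower _) _; apply: Dsum_mono; exact: leq_subr.
Unshelve. all: by end_near. Qed.

Lemma renewal_gt0 : \forall n \near \oo, 0 < d n.
Proof.
have th : 0 < theta / 2 by have := theta01; move=> /andP[? _]; lra.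
near=> n; have n0 : (0 < n)%N by near: n; exact: nbhs_infty_gt.
have : `|n%:R * d n - theta * Dsum n| <= theta / 2 * Dsum n.
  by near: n; exact: renewal_ratio.
rewrite ler_norml => /andP[h _]; have D1 := Dsum_ge1 n n0.
have h2 : 0 < theta / 2 * Dsum n by rewrite mulr_gt0//; lra.
have : 0 < n%:R * d n by lra.
by rewrite pmulr_rgt0// ltr0n.
Unshelve. all: by end_near. Qed.

(** Partial sums increase, so [n * d n] is at most about [(n + 1) * d (n + 1)]. One factor
    [1 + delta / 3] pays for the ratio errors, another for [(n + 1) / n], and their product is at
    most [1 + delta]. *)
Lemma renewal_succ delta : 0 < delta <= 1 ->
  \forall n \near \oo, d n <= (1 + delta) * d n.+1.
Proof.
move=> /andP[del0 del1]; have [th0 th1] := andP theta01.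
pose e := theta * delta / 9; have e0 : 0 < e by rewrite divr_gt0// mulr_gt0.
have [N1 _ HN1] := renewal_ratio e e0.
near=> n; have n0 : (0 < n)%N by near: n; exact: nbhs_infty_gt.
have n0R : 0 < n%:R :> R by rewrite ltr0n.
have nd : 3 / delta <= n%:R by near: n; exact: nbhs_infty_ger.
have h1 : `|n%:R * d n - theta * Dsum n| <= e * Dsum n.
  by near: n; exact: renewal_ratio.
have h2 : `|n.+1%:R * d n.+1 - theta * Dsum n.+1| <= e * Dsum n.+1.
  by apply: HN1 => /=; apply: leqW; near: n; exact: nbhs_infty_ge.
move: h1; rewrite ler_norml => /andP[_ h1].
move: h2; rewrite ler_norml => /andP[h2 _].
have DD : Dsum n <= Dsum n.+1 by apply: Dsum_mono.
have Dn0 : 0 <= Dsum n by apply: le_trans (Dsum_ge1 n n0).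
have td : 0 < theta * delta by rewrite mulr_gt0.
have tdd : theta * delta * delta <= theta * delta by rewrite ler_piMr// ltW.
have th3 : theta + e <= (1 + delta / 3) * (theta - e) by rewrite /e; lra.
have the : 0 < theta - e.
  have : theta * delta <= theta by rewrite ler_piMr// ltW.
  by rewrite /e; lra.
have l1 : n%:R * d n <= (theta + e) * Dsum n by lra.
have l2 : (theta - e) * Dsum n.+1 <= n.+1%:R * d n.+1 by lra.
have l3 : n%:R * d n <= (1 + delta / 3) * (n.+1%:R * d n.+1).
  apply: le_trans l1 _; apply: le_trans (ler_wpM2r Dn0 th3) _.
  rewrite -mulrA ler_pM2l; last by lra.
  apply: le_trans l2; by rewrite ler_pM2l.
have l4 : n.+1%:R <= (1 + delta / 3) * n%:R.
  rewrite -natr1; suff : 1 <= delta / 3 * n%:R by lra.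
  by move: nd; rewrite ler_pdivrMr//; lra.
rewrite -(ler_pM2l n0R); apply: le_trans l3 _.
rewrite mulrA [leRHS]mulrA; apply: ler_wpM2r => //.
apply: (@le_trans _ _ ((1 + delta / 3) * ((1 + delta / 3) * n%:R))).
  by rewrite ler_pM2l//; lra.
rewrite mulrA [leRHS]mulrC ler_pM2r//.
have : delta * delta <= delta by rewrite ler_piMr// ltW.
by lra.
Unshelve. all: by end_near. Qed.

Lemma renewal_shift l delta : 0 < delta <= 1 ->
  \forall n \near \oo, d n <= (1 + delta) * d (n + l)%N.
Proof.
elim: l delta => [|l IH] delta /andP[del0 del1].
  by near=> n; rewrite addn0 ler_peMl//; lra.
have d3 : 0 < delta / 3 <= 1 by apply/andP; split; lra.
have [N1 _ HN1] := IH _ d3; have [N2 _ HN2] := renewal_succ _ d3.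
near=> n; rewrite addnS.
apply: le_trans (HN1 n _) _; first by rewrite /=; near: n; exact: nbhs_infty_ge.
apply: (@le_trans _ _ ((1 + delta / 3) * ((1 + delta / 3) * d (n + l).+1))).
  rewrite ler_pM2l; last by lra.
  apply: HN2 => /=; apply: leq_trans (leq_addr _ _); near: n; exact: nbhs_infty_ge.
rewrite mulrA ler_wpM2r//.
have : delta * delta <= delta by rewrite ler_piMr// ltW.
by lra.
Unshelve. all: by end_near. Qed.

Lemma renewal_cvg1 l : d (n - l)%N / d n @[n --> \oo] --> (1 : R).
Proof.
apply/cvgrPdist_le => e e0; pose delta := Num.min e 1.
have del : 0 < delta <= 1 by rewrite lt_min e0 ltr01 ge_min lexx orbT.
have [N1 _ HN1] := renewal_shift l delta del.
near=> n; have dn0 : 0 < d n by near: n; exact: renewal_gt0.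
have nl : (l + N1 <= n)%N by near: n; exact: nbhs_infty_ge.
have ln : (l <= n)%N by apply: leq_trans nl; exact: leq_addr.
have := HN1 (n - l)%N _; rewrite subnK// => /(_ _) h.
have h1 : d (n - l)%N <= (1 + delta) * d n by apply: h; rewrite /= leq_subRL.
have h2 : d n <= d (n - l)%N by apply: renewal_mono; exact: leq_subr.
rewrite distrC ger0_norm ?subr_ge0 ?ler_pdivlMr ?mul1r//.
rewrite lerBlDr ler_pdivrMr//; apply: le_trans h1 _.
by rewrite ler_pM2r// addrC lerD2r ge_min lexx.
Unshelve. all: by end_near. Qed.

(** [(n - l) * d (n - l)] is at most the partial sum at [n], hence at most [(2 / theta) * n * d n],
    while [n <= 2 * (n - l)]; this gives [4 / theta]. *)
Lemma renewal_dominated : exists2 C : R, 0 <= C &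
  \forall n \near \oo, forall l, (l.*2 <= n)%N -> d (n - l)%N <= C * d n.
Proof.
have [th0 th1] := andP theta01; have t2 : 0 < theta / 2 by lra.
exists (4 / theta); first by rewrite divr_ge0// ltW.
near=> n => l ln; have n0 : (0 < n)%N by near: n; exact: nbhs_infty_gt.
have : `|n%:R * d n - theta * Dsum n| <= theta / 2 * Dsum n.
  by near: n; exact: renewal_ratio.
rewrite ler_norml => /andP[h _].
have h1 : theta / 2 * Dsum n <= n%:R * d n by lra.
have h2 : (n - l)%N%:R * d (n - l)%N <= Dsum n.
  by apply: le_trans (Dsum_lower _) _; apply: Dsum_mono; exact: leq_subr.
have nl0 : (0 < n - l)%N by lia.
have h3 : n%:R <= 2 * (n - l)%N%:R :> R by rewrite -natrM ler_nat; lia.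
have h4 : theta / 2 * ((n - l)%N%:R * d (n - l)%N) <= 2 * (n - l)%N%:R * d n.
  apply: (@le_trans _ _ (n%:R * d n)); last by rewrite ler_wpM2r.
  by apply: le_trans h1; rewrite ler_pM2l.
have m0 : 0 < (n - l)%N%:R :> R by rewrite ltr0n.
rewrite -(ler_pM2l m0) -(ler_pM2l t2); apply: le_trans h4 _.
rewrite le_eqVlt; apply/orP; left; apply/eqP; field; by rewrite gt_eqF.
Unshelve. all: by end_near. Qed.

End Renewal.

Section StrictMinimumDecay.
Context {d : measure_display} {T : measurableType d} {R : realType}.
Context {P : probability T R}.
Variable D : cbp P.

Lemma min_end_prob_ge0 n : 0 <= min_end_prob D n.
Proof. exact: fine_ge0. Qed.

Lemma min_end_prob0 : min_end_prob D 0 = 1.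
Proof.
rewrite /min_end_prob (_ : _ @^-1` _ = setT) ?probability_setT//.
by apply/seteqP; split=> // w _; rewrite /= /min_end size_seqA.
Qed.

(** Deleting the first step of a path keeps a strict minimum at its end, and the shifted block has
    the same law. *)
Lemma min_end_prob_decr n : min_end_prob D n.+1 <= min_end_prob D n.
Proof.
rewrite /min_end_prob -[in leRHS](_ : P (seqA D 1 n @^-1` [set s | min_end D s]) = P (seqA D 0 n
  @^-1` _)); last first.
  exact: (eqlaw_seqA D 1 0 n).
apply: fine_le; rewrite ?fin_num_measure//; try exact: seqA_meas.
apply: le_measure; rewrite ?inE; try exact: seqA_meas.
move=> w /= /allP h; apply/allP => j; rewrite mem_iota size_seqA /= => jn.
have ES : seqA D 0 n.+1 w = A D 0 w :: seqA D 1 n w by rewrite -add1n seqA_cat seqA1.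
move: h; rewrite ES => /(_ j.+1); rewrite mem_iota [size _]/= size_seqA => /(_ jn).
by rewrite [take _ (_ :: _)]/= /lnS !big_cons ltrD2l.
Qed.

Lemma neg_walk_prob0 : neg_walk_prob D 0 = 0.
Proof.
rewrite /neg_walk_prob (_ : [set w | _] = set0) ?measure0//.
by apply/seteqP; split=> // w; rewrite /= /walk big_ord0 ltxx.
Qed.

Lemma walk_event_meas n (Y : set R) : measurable [set w | Y (walk D n w)].
Proof.
have -> : [set w | Y (walk D n w)] = seqA D 0 n @^-1` [set s | Y (lnS D s)].
  by apply/seteqP; split=> w /=; rewrite walk_lnS.
exact: seqA_meas.
Qed.

Lemma neg_walk_prob01 n : 0 <= neg_walk_prob D n <= 1.
Proof.
rewrite fine_ge0//= -lee_fin fineK; last first.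
  by apply: fin_num_measure; exact: (walk_event_meas n (fun x => x < 0)).
by apply: probability_le1; exact: (walk_event_meas n (fun x => x < 0)).
Qed.

(** The walk vanishes only if the product of the A's equals [(m * lambda)^(- n)], a single point. *)
Lemma walk_zero_le n : fine (P [set w | walk D n w = 0]) <=
  prod_at D n (expR (- (n%:R * ln (m D * lambda D)))).
Proof.
apply: fine_le; try by apply: fin_num_measure; exact: (walk_event_meas n (fun x => x = 0)).
  by apply: fin_num_measure; exact: seqA_meas.
apply: le_measure; rewrite ?inE; [exact: (walk_event_meas n (fun x => x = 0))|exact: seqA_meas|].
move=> w /=; rewrite walk_lnS; set s := seqA D 0 n w => s0.
have p0 : (0 : R) < (prodA s)%:R by rewrite ltr0n prodA_gt0.
have : n%:R * ln (m D * lambda D) + ln (prodA s)%:R = 0 by rewrite -lnS_prodA.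
by move=> h; apply: (@ln_inj _) ; rewrite ?posrE ?expR_gt0 ?expRK//; lra.
Qed.

Lemma neg_walk_prob_cvg rho : nondegenerate_walk D ->
  fine (P [set w | 0 < walk D n w]) @[n --> \oo] --> rho -> neg_walk_prob D n @[n --> \oo] --> 1
    - rho.
Proof.
move=> nd rc.
have negE n : neg_walk_prob D n = 1 - fine (P [set w | 0 < walk D n w]) - fine (P [set w | walk D
  n w = 0]).
  pose E1 := [set w | walk D n w < 0]; pose E2 := [set w | 0 < walk D n w].
  pose E3 := [set w | walk D n w = 0].
  have m1 : measurable E1 by exact: (walk_event_meas n (fun x => x < 0)).
  have m2 : measurable E2 by exact: (walk_event_meas n (fun x => 0 < x)).
  have m3 : measurable E3 by exact: (walk_event_meas n (fun x => x = 0)).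
  have U23 : P (E2 `|` E3) = (P E2 + P E3)%E.
    apply: measureU => //; apply/seteqP; split=> // w [/= h1 h2].
    by move: h1; rewrite /E1 /E2 /= (h2 : walk D n w = 0) ltxx.
  have U : P (E1 `|` (E2 `|` E3)) = (P E1 + (P E2 + P E3))%E.
    rewrite -U23; apply: measureU => //; first exact: measurableU.
    apply/seteqP; split=> // w [/= h1 [/= h2|/= h2]].
      by have := lt_trans h1 h2; rewrite ltxx.
    by move: h1; rewrite /E1 /E2 /= (h2 : walk D n w = 0) ltxx.
  have : P (E1 `|` (E2 `|` E3)) = 1%E.
    rewrite -(probability_setT P); congr (P _); apply/seteqP; split=> // w _.
    by rewrite /E1 /E2 /E3 /=; have [h|h|h] := ltgtP (walk D n w) 0; [left|right; left|right;
      right].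
  rewrite U => h; have : fine (P E1 + (P E2 + P E3))%E = 1 by rewrite h.
  rewrite !fineD ?fin_numD ?fin_num_measure// /neg_walk_prob -/E1 -/E2 -/E3; lra.
have z0 : fine (P [set w | walk D n w = 0]) @[n --> \oo] --> (0 : R).
  apply/cvgrPdist_le => e e0; have [n0 Hn0] := prod_at_cvg0 D nd e e0.
  exists n0 => // n /= nn0; rewrite sub0r normrN ger0_norm ?fine_ge0//.
  exact: le_trans (walk_zero_le n) (Hn0 _ _ nn0).
rewrite (_ : neg_walk_prob D = fun n => 1 - fine (P [set w | 0 < walk D n w]) - fine (P [set w |
  walk D n w = 0])).
  rewrite -[1 - rho]subr0; apply: cvgB => //; apply: cvgB => //; exact: cvg_cst.
by apply/funext => n; exact: negE.
Qed.

Hypothesis SD : condSD D.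

Lemma condSD_theta : exists2 theta : R, 0 < theta <= 1 & neg_walk_prob D n @[n --> \oo] --> theta.
Proof.
have [nd _ [rho [/andP[r0 r1] rc]]] := SD; exists (1 - rho); last exact: neg_walk_prob_cvg.
by apply/andP; split; lra.
Qed.

Lemma min_end_prob_gt0 : \forall n \near \oo, 0 < min_end_prob D n.
Proof.
have [theta th ac] := condSD_theta.
exact: (renewal_gt0 (min_end_prob D) (neg_walk_prob D) theta min_end_prob0 min_end_prob_ge0
  min_end_prob_decr neg_walk_prob0 neg_walk_prob01 (spitzer_recurrence D) ac th).
Qed.

Lemma min_end_prob_cvg1 l : min_end_prob D (n - l)%N / min_end_prob D n @[n --> \oo] --> (1 : R).
Proof.
have [theta th ac] := condSD_theta.
exact: (renewal_cvg1 (min_end_prob D) (neg_walk_prob D) theta min_end_prob0 min_end_prob_ge0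
  min_end_prob_decr neg_walk_prob0 neg_walk_prob01 (spitzer_recurrence D) ac th).
Qed.

Lemma min_end_prob_dominated : exists2 C : R, 0 <= C &
  \forall n \near \oo, forall l, (l.*2 <= n)%N -> min_end_prob D (n - l)%N <= C * min_end_prob D n.
Proof.
have [theta th ac] := condSD_theta.
exact: (renewal_dominated (min_end_prob D) (neg_walk_prob D) theta min_end_prob_ge0
  min_end_prob_decr neg_walk_prob0 neg_walk_prob01 (spitzer_recurrence D) ac th).
Qed.

End StrictMinimumDecay.

(** * The critical case *)

Section Tannery.
Context {R : realType}.
Variables (d : nat -> R) (g : nat -> nat -> R) (gl abar : nat -> R) (C : R).
Hypothesis d_ge0 : forall n, 0 <= d n.
Hypothesis d_gt0 : \forall n \near \oo, 0 < d n.
Hypothesis d_cvg1 : forall l, d (n - l)%N / d n @[n --> \oo] --> (1 : R).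
Hypothesis d_dom : exists2 C' : R, 0 <= C' &
  \forall n \near \oo, forall l, (l.*2 <= n)%N -> d (n - l)%N <= C' * d n.
Hypothesis C_ge0 : 0 <= C.
Hypothesis g_bnd : forall k l, 0 <= g k l <= C * abar l.
Hypothesis gl_bnd : forall l, 0 <= gl l <= C * abar l.
Hypothesis g_cvg : forall l, g k l @[k --> \oo] --> gl l.
Hypothesis abar_ge0 : forall l, 0 <= abar l.
Hypothesis abar_cvg : cvgn (series abar).
Hypothesis loc : (d n)^-1 * (\sum_(0 <= k < (n./2).+1) d k * abar (n - k)%N)
  @[n --> \oo] --> (0 : R).

Let F n l := d (n - l)%N / d n * g (n - l)%N l.
Let Loc n := (d n)^-1 * (\sum_(0 <= k < (n./2).+1) d k * abar (n - k)%N).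

Lemma series_gl_cvg : cvgn (series gl).
Proof.
apply: (@series_le_cvg _ gl (C *: abar)).
- by move=> l; have /andP[] := gl_bnd l.
- by move=> l; rewrite mulr_ge0.
- by move=> l; have /andP[] := gl_bnd l.
- exact: is_cvg_seriesZ.
Qed.

Lemma F_ge0 n l : 0 <= F n l.
Proof.
have /andP[g0 _] := g_bnd (n - l) l.
by rewrite mulr_ge0// divr_ge0.
Qed.

Lemma F_cvg l : F n l @[n --> \oo] --> gl l.
Proof.
rewrite -[gl l]mul1r; apply: cvgM; first exact: d_cvg1.
exact: (cvg_comp _ _ (@cvg_subnr l) (g_cvg l)).
Qed.

Lemma sumF_cvg m : \sum_(0 <= l < m) F n l @[n --> \oo] --> series gl m.
Proof.
elim: m => [|m IH].
  under eq_fun do rewrite big_geq//.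
  by rewrite /series /= big_geq//; exact: cvg_cst.
under eq_fun do rewrite big_nat_recr//=.
by rewrite seriesSr; apply: cvgD => //; exact: F_cvg.
Qed.

(** If [n - l > n / 2] then [2 l <= n] and the regularity of [d] gives a summable bound; the
    indicator selects the remaining terms, which are those of (LOC). *)
Lemma F_le n l C' : 0 <= C' -> (l <= n)%N -> 0 < d n ->
  (forall j, (j.*2 <= n)%N -> d (n - j)%N <= C' * d n) ->
  F n l <= C' * C * abar l +
    C * ((d n)^-1 * ((n - l < (n./2).+1)%N%:R * (d (n - l)%N * abar l))).
Proof.
move=> C'0 ln dn0 dom; have /andP[g0 g1] := g_bnd (n - l) l.
have dn0' := ltW dn0.
have h : F n l <= d (n - l)%N / d n * (C * abar l) by rewrite ler_wpM2l// divr_ge0.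
have [nl|nl] := boolP (n - l < (n./2).+1)%N.
  apply: le_trans h _; rewrite mul1r.
  rewrite [leLHS](_ : _ = C * ((d n)^-1 * (d (n - l)%N * abar l))); last by ring.
  by rewrite lerDr !mulr_ge0.
rewrite mul0r !mulr0 addr0; apply: le_trans h _.
rewrite -[C' * C * _]mulrA; apply: ler_wpM2r; first by rewrite mulr_ge0.
by rewrite ler_pdivrMr//; apply: dom; lia.
Qed.

Lemma loc_sum n : \sum_(0 <= l < n.+1) (n - l < (n./2).+1)%N%:R * (d (n - l)%N * abar l) =
  \sum_(0 <= k < (n./2).+1) d k * abar (n - k)%N.
Proof.
rewrite !big_mkord (reindex_inj rev_ord_inj) /=.
have hn : (n./2.+1 <= n.+1)%N by lia.
rewrite (big_ord_widen n.+1 (fun k => d k * abar (n - k)%N) hn) [RHS]big_mkcond.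
apply: eq_bigr => k _; rewrite subSS subKn; last by rewrite -ltnS.
by case: ifP; rewrite ?mul1r ?mul0r.
Qed.

(** With [l = n - k] the summand is [F n l], which converges for fixed [l]. Four errors of [e / 4]
    occur: the tail of the limit series, the head up to [m], the dominated tail and the (LOC)
    part. *)
Lemma tannery : exists2 K : R, 0 <= K &
  (\sum_(0 <= k < n.+1) d k * g k (n - k)%N) / d n @[n --> \oo] --> K.
Proof.
have [C' C'0 [N1 _ dom]] := d_dom.
have gl0 l : 0 <= gl l by have /andP[] := gl_bnd l.
have glc := series_gl_cvg.
have sgm : {homo series gl : n m / (n <= m)%N >-> n <= m}.
  by apply/nondecreasing_seqP => n; rewrite seriesSr lerDl.
have sam : {homo series abar : n m / (n <= m)%N >-> n <= m}.
  by apply/nondecreasing_seqP => n; rewrite seriesSr lerDl.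
exists (limn (series gl)).
  apply: le_trans (nondecreasing_cvgn_le sgm glc 0%N).
  by rewrite /series /= big_geq.
apply/cvgrPdist_le => e e0.
have e4 : 0 < e / 4 by lra.
(* The constants [C] and [C'] may be 0; adding 1 here and in [e5] keeps the divisors positive. *)
pose c := C' * C + 1; have c0 : 0 < c by rewrite /c ltr_pwDr// mulr_ge0.
have ec : 0 < e / 4 / c by rewrite divr_gt0.
have [N2 _ H2] := @cvgr_dist_le _ _ _ _ _ _ _ glc _ e4.
have [N3 _ H3] := @cvgr_dist_le _ _ _ _ _ _ _ abar_cvg _ ec.
pose m := maxn N2 N3.
have K1 : `|limn (series gl) - series gl m| <= e / 4 by apply: H2; exact: leq_maxl.
have K2 : `|limn (series abar) - series abar m| <= e / 4 / c by apply: H3; exact: leq_maxr.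
pose e5 := e / 4 / (C + 1); have e50 : 0 < e5 by rewrite divr_gt0// ltr_pwDr.
near=> n.
have mn : (m <= n.+1)%N by apply: leqW; near: n; exact: nbhs_infty_ge.
have dn0 : 0 < d n by near: n; exact: d_gt0.
have K3 : `|series gl m - \sum_(0 <= l < m) F n l| <= e / 4.
  near: n; exact: (@cvgr_dist_le _ _ _ _ _ _ _ (sumF_cvg m) _ e4).
have K4 : `|0 - Loc n| <= e5.
  near: n; exact: (@cvgr_dist_le _ _ _ _ _ _ _ loc _ e50).
have domn l : (l.*2 <= n)%N -> d (n - l)%N <= C' * d n.
  by apply: dom => /=; near: n; exact: nbhs_infty_ge.
have -> : (\sum_(0 <= k < n.+1) d k * g k (n - k)%N) / d n = \sum_(0 <= l < n.+1) F n l.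
  rewrite !big_mkord (reindex_inj rev_ord_inj) mulr_suml /=.
  apply: eq_bigr => l _; rewrite /F subSS subKn; last by rewrite -ltnS.
  by rewrite mulrAC.
rewrite (big_cat_nat _ mn)//=.
set S1 := \sum_(0 <= l < m) F n l in K3 *; set S2 := \sum_(m <= l < n.+1) F n l.
have S20 : 0 <= S2 by apply: sumr_ge0 => l _; exact: F_ge0.
have S2le : S2 <= C' * C * (\sum_(m <= l < n.+1) abar l) + C * Loc n.
  apply: (@le_trans _ _ (\sum_(m <= l < n.+1) (C' * C * abar l +
     C * ((d n)^-1 * ((n - l < (n./2).+1)%N%:R * (d (n - l)%N * abar l)))))).
    by apply: ler_sum_nat => l /andP[_ ln]; apply: F_le.
  rewrite big_split /= -!mulr_sumr lerD2l ler_wpM2l// /Loc ler_pM2l ?invr_gt0//.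
  rewrite -loc_sum [leRHS](big_cat_nat _ mn)//= lerDr; apply: sumr_ge0 => l _.
  by rewrite !mulr_ge0.
have A1 : \sum_(m <= l < n.+1) abar l <= e / 4 / c.
  have := sub_series abar n.+1 m; rewrite leqNgt ltnS.
  have -> : \sum_(m <= l < n.+1) abar l = series abar n.+1 - series abar m.
    by rewrite sub_series mn.
  have := nondecreasing_cvgn_le sam abar_cvg n.+1.
  by have := ler_norm (limn (series abar) - series abar m); lra.
have A2 : C' * C * (\sum_(m <= l < n.+1) abar l) <= e / 4.
  apply: (@le_trans _ _ (c * (e / 4 / c))); last by rewrite mulrC divfK// gt_eqF.
  apply: ler_pM => //; [by rewrite mulr_ge0|by apply: sumr_ge0|by rewrite /c; lra].
have A3 : C * Loc n <= e / 4.
  apply: (@le_trans _ _ ((C + 1) * e5)); last first.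
    by rewrite /e5 mulrC divfK// gt_eqF// ltr_pwDr.
  apply: (@le_trans _ _ (C * e5)); last by rewrite ler_pM2r// lerDl.
  by rewrite ler_wpM2l//; move: K4; rewrite sub0r normrN; apply: le_trans; exact: ler_norm.
rewrite [leLHS](_ : _ = `|(limn (series gl) - series gl m) + (series gl m - S1) - S2|); last first.
  by congr (`|_|); ring.
apply: le_trans (ler_normB _ _) _; rewrite [`|S2|]ger0_norm//.
by have := ler_normD (limn (series gl) - series gl m) (series gl m - S1); lra.
Unshelve. all: by end_near. Qed.

End Tannery.

Section TotalVariation.
Context {R : realType}.
Local Open Scope ereal_scope.

Definition nat_mean (nu : probability nat R) (h : nat -> \bar R) : \bar R :=
  \sum_(y <oo) nu [set y] * h y.

Lemma nat_mean_ge0 nu h : (forall y, 0 <= h y) -> 0 <= nat_mean nu h.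
Proof. by move=> h0; apply: nneseries_ge0 => y _ _; rewrite mule_ge0. Qed.

Lemma nat_mass (nu : probability nat R) (E : set nat) :
  nu E = \sum_(y <oo) nu (E `&` [set y]).
Proof. by rewrite (prob_fibers_nat nu (V := id)). Qed.

Lemma nat_mean_le1 nu h : (forall y, 0 <= h y <= 1) -> nat_mean nu h <= 1.
Proof.
move=> h01; rewrite -(probability_setT nu) nat_mass.
apply: lee_nneseries => y _; first by have /andP[h0 _] := h01 y; rewrite mule_ge0.
by rewrite setTI -[leRHS]mule1 lee_wpmul2l//; have /andP[] := h01 y.
Qed.

Lemma nat_mean_fin nu h : (forall y, 0 <= h y <= 1) -> nat_mean nu h \is a fin_num.
Proof.
move=> h01; rewrite ge0_fin_numE; last by apply: nat_mean_ge0 => y; have /andP[] := h01 y.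
exact: le_lt_trans (nat_mean_le1 nu h h01) (ltry _).
Qed.

(* On E the bound reads (mu - nu) h <= mu - nu, off E it is (mu - nu) h <= 0. *)
Lemma nat_mean_exchange (mu nu : probability nat R) h : (forall y, 0 <= h y <= 1) ->
  nat_mean mu h + nu [set y | nu [set y] <= mu [set y]] <=
  nat_mean nu h + mu [set y | nu [set y] <= mu [set y]].
Proof.
move=> h01; set E := [set y | _].
have h0 y : 0 <= h y by have /andP[] := h01 y.
have m0 (mu' : probability nat R) y : 0 <= mu' [set y] * h y by rewrite mule_ge0.
rewrite /nat_mean !(nat_mass _ E) -!nneseriesD//.
apply: lee_nneseries => y _; first by rewrite adde_ge0.
have fy : h y \is a fin_num.
  by rewrite ge0_fin_numE//; have /andP[_ h1] := h01 y; exact: le_lt_trans h1 (ltry _).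
have [Ey|Ey] := pselect (E y).
  have -> : E `&` [set y] = [set y] by apply/seteqP; split=> [w []//|w /= ->].
  have := h01 y; move: Ey; rewrite /E /=.
  rewrite -(fineK fy) -[mu _]fineK ?fin_num_measure// -[nu _]fineK ?fin_num_measure//.
  rewrite -!EFinM -!EFinD !lee_fin => ab /andP[h0' h1].
  have : (0 <= (fine (mu [set y]) - fine (nu [set y])) * (1 - fine (h y)))%R.
    by rewrite mulr_ge0// subr_ge0.
  by move=> h2; lra.
have -> : E `&` [set y] = set0 by apply/seteqP; split=> // w [/= Ew wy]; apply: Ey; rewrite -wy.
rewrite !measure0 !adde0 lee_wpmul2r// ltW// ltNge; exact/negP.
Qed.

(** The set where [mu] dominates [nu] pointwise bounds the difference from above; exchanging the
    roles bounds it from below. As [tv_dist] is a supremum over events, no factor 2 appears. *)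
Lemma nat_mean_tv (mu nu : probability nat R) h : (forall y, 0 <= h y <= 1) ->
  `|nat_mean mu h - nat_mean nu h| <= tv_dist mu nu.
Proof.
move=> h01.
have one (mu' nu' : probability nat R) E :
    nat_mean mu' h + nu' E <= nat_mean nu' h + mu' E ->
    (fine (nat_mean mu' h) - fine (nat_mean nu' h) <= `|fine (mu' E) - fine (nu' E)|)%R.
  rewrite -[nat_mean mu' h]fineK ?nat_mean_fin// -[nat_mean nu' h]fineK ?nat_mean_fin//.
  rewrite -[mu' E]fineK ?fin_num_measure// -[nu' E]fineK ?fin_num_measure//.
  rewrite -!EFinD lee_fin /= => h2.
  by have := ler_norm (fine (mu' E) - fine (nu' E)); lra.
have tvE E : (`|fine (mu E) - fine (nu E)|%R)%:E <= tv_dist mu nu.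
  apply: ereal_sup_ubound; exists E => //.
  by rewrite -abse_EFin EFinB !fineK ?fin_num_measure.
rewrite -[nat_mean mu h]fineK ?nat_mean_fin// -[nat_mean nu h]fineK ?nat_mean_fin//.
rewrite -EFinB abse_EFin; have [le|ge] := leP (fine (nat_mean nu h)) (fine (nat_mean mu h)).
  rewrite ger0_norm ?subr_ge0//; apply: le_trans (tvE _); rewrite lee_fin.
  exact: one (nat_mean_exchange mu nu h h01).
rewrite ltr0_norm ?subr_lt0// opprB; apply: le_trans (tvE _); rewrite lee_fin distrC.
exact: one (nat_mean_exchange nu mu h h01).
Qed.

End TotalVariation.

(** When the total mass is 0 the normalization is a junk law, but both sides vanish. This covers
    conditioning on [tau_k = k] at times where that event is null. *)
Lemma mnormalize_mul (d : measure_display) (T : measurableType d) (R : realType)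
    (mu : {measure set T -> \bar R}) (P : probability T R) (U : set T) :
  mu setT \is a fin_num -> (mu U <= mu setT)%E ->
  mu U = (mu setT * mnormalize mu P U)%E.
Proof.
move=> fin le; rewrite /mnormalize; have [t0|t0] := eqVneq (mu setT) 0%E.
  by rewrite t0 mul0e; apply/eqP; rewrite eq_le measure_ge0 andbT -t0.
case: ifP => [/= /eqP tinf|_]; first by rewrite tinf in fin.
rewrite muleCA -[X in (_ * (X * _))%E](fineK fin) -EFinM mulfV ?mule1//.
by rewrite fine_eq0.
Qed.

(** * Decomposition at the first minimum *)

Section Decomposition.
Context {d : measure_display} {T : measurableType d} {R : realType}.
Context {P : probability T R}.
Variable D : cbp P.
Local Open Scope ereal_scope.

Notation dm := (dmeas (devents D)).

(* The state reached from y in l steps, sent to the cemetery 0 when the walk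
   has become negative. *)
Definition kept (l y : nat) (w : T) : nat :=
  if nonneg_path D (seqA D 0 l w) then Xs D 0 y l w else 0%N.

Definition start_at (i k y : nat) : set T :=
  state D 0 i k @^-1` [set z | z.1 = y /\ min_end D z.2].

Lemma start_at_meas i k y : measurable (start_at i k y).
Proof. exact: (dm_meas D _ (dm_state D 0 i k)). Qed.

Lemma kept_meas l y Y : measurable (kept l y @^-1` Y).
Proof.
exact: (dm_meas D (fun z => Y (if nonneg_path D z.2 then z.1 else 0%N)) (dm_state D 0 y l)).
Qed.

(** [tau_eqP] splits the event at time [k], and the state there is frozen at [y]. Positivity of [x]
    excludes the cemetery value of [kept]. *)
Lemma path_split i k l x : (0 < x)%N ->
  P (X D i (k + l) @^-1` [set x] `&` tau D (k + l) @^-1` [set k]) =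
  \sum_(y <oo) P (start_at i k y) * P (kept l y @^-1` [set x]).
Proof.
move=> x0; have mX n : measurable (X D i k @^-1` [set n]) by exact: X_meas.
have mt : measurable (tau D (k + l) @^-1` [set k]).
  by have := measurable_tau D (k + l) measurableT (Y := [set k]) I; rewrite setTI.
rewrite (prob_fibers_nat P mX); last by apply: measurableI => //; exact: X_meas.
apply: eq_eseriesr => y _.
pose Z := [set z : nat * seq nat | z.1 = x /\ nonneg_path D z.2].
have -> : P (kept l y @^-1` [set x]) = P (state D k y l @^-1` Z).
  rewrite (eqlaw_state D k 0 y l Z); congr (P _); apply/seteqP; split=> w /=.
    rewrite /kept /Z /state /=; case: ifP => // _ h; by move: x0; rewrite -h.
  by rewrite /kept /Z /state /= => -[h1 ->].
rewrite -(dmeas_indep (devents_indep D) (devents_setT D) (devents_setI D)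
  (devents_meas D) _ _ (block_disjoint k l) (dm_state D 0 i k) (dm_state D k y l)).
have tE w := tau_eqP D (k + l) k w (leq_addr l k).
congr (P _); apply/seteqP; split=> w /=.
  move=> [[Xx /tE[t1 t2]] Xy]; rewrite addKn in t2; split; rewrite /state /=.
    by rewrite -X_Xs.
  by split=> //; rewrite -Xx X_Xs XsD -X_Xs Xy add0n.
rewrite /state /= => -[[Xy me] [Xx np]]; split; last by rewrite X_Xs.
by split; [rewrite X_Xs XsD add0n Xy|apply/tE; rewrite addKn].
Qed.

Lemma start_at_trapped i k y :
  P (start_at i k y) = (min_end_prob D k)%:E * trapped_law D i k [set y].
Proof.
have mt := measurable_tau_eq D k.
have tE w := tau_eqP D k k w (leqnn k).
have SE : start_at i k y = X D i k @^-1` [set y] `&` [set w | tau D k w = k].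
  apply/seteqP; split=> w; rewrite /start_at /state /= -X_Xs => -[h1 h2]; split=> //.
    apply/tE; split=> //; apply/nonneg_pathP => j; rewrite subnn leqn0 => /eqP ->.
    by rewrite addn0.
  by have [] := (tE w).1 h2.
have dE : (min_end_prob D k)%:E = P [set w | tau D k w = k].
  by rewrite min_end_prob_dminus /dminus fineK// fin_num_measure.
rewrite SE dE -[X in P X * _]setTI.
have rE U : mrestr P (measurable_tau_eq D k) U = P (U `&` [set w | tau D k w = k]) by [].
refine (mnormalize_mul _ _ _ (mrestr P (measurable_tau_eq D k)) P (X D i k @^-1` [set y]) _ _).
  by move: (rE setT) => /= ->; rewrite setTI fin_num_measure.
move: (rE setT) (rE (X D i k @^-1` [set y])) => /= -> ->.
by apply: prob_le; [apply: measurableI => //; exact: X_meas|exact: measurableI|move=> w []].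
Qed.

Definition inv_pow (s : R) (x : nat) : R := if (0 < x)%N then (x%:R `^ (- s))%R else 0%R.

Lemma inv_pow_ge0 s x : (0 <= inv_pow s x)%R.
Proof. by rewrite /inv_pow; case: ifP. Qed.

Lemma measurable_state_fun (g : nat -> nat * seq nat -> \bar R) l :
  measurable_fun setT (fun z : nat * T => g z.1 (state D 0 z.1 l z.2)).
Proof.
move=> _ Y _; rewrite setTI.
have -> : (fun z : nat * T => g z.1 (state D 0 z.1 l z.2)) @^-1` Y =
    \bigcup_y ([set y] `*` (state D 0 y l @^-1` (g y @^-1` Y))).
  apply/seteqP; split=> [[y w] /= Yw|[y w] [y' _ [/= -> ]]//].
  by exists y.
apply: bigcup_measurable => y _; apply: measurableX => //.
exact: (dm_meas D _ (dm_state D 0 y l)).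
Qed.

(** Tonelli on the product space. Both restrictions on the integration domain are encoded in [kept],
    since [inv_pow] vanishes at 0. *)
Lemma inv_moment_mean nu s l : (0 < s)%R ->
  inv_moment D nu s l = nat_mean nu (fun y => \int[P]_w (inv_pow s (kept l y w))%:E).
Proof.
move=> s0; rewrite /inv_moment integral_mkcond.
pose g (y : nat) (z : nat * seq nat) : \bar R :=
  (inv_pow s (if nonneg_path D z.2 then z.1 else 0%N))%:E.
have -> : ((fun z => ((X D z.1 l z.2)%:R `^ (- s))%:E) \_
    [set z | (0 < X D z.1 l z.2)%N /\ (0 <= walk_min D l z.2)%R]) =
    (fun z : nat * T => g z.1 (state D 0 z.1 l z.2)).
  apply/funext => z; rewrite /patch /g /state /=.
  have [/set_mem[/= h1 h2]|h] := boolP (z \in _).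
    by rewrite walk_min_nonneg in h2; rewrite h2 /inv_pow -X_Xs h1.
  rewrite /inv_pow; have [np|np] := boolP (nonneg_path D (seqA D 0 l z.2)); last by [].
  case: ifP => // xp; case/negP: h.
  by rewrite inE /= walk_min_nonneg X_Xs.
rewrite /Pinit fubini_tonelli1; last 2 first.
- exact: measurable_state_fun.
- by move=> z; rewrite lee_fin inv_pow_ge0.
rewrite (integral_nat nu id (fubini_F P _))//.
by move=> n; apply: integral_ge0 => w _; rewrite lee_fin inv_pow_ge0.
Qed.

Definition kept_mean (r : nat -> \bar R) (l y : nat) : \bar R :=
  \sum_(x <oo) P (kept l y @^-1` [set x]) * r x.

Lemma kept_meanE r l y : (forall x, 0 <= r x) ->
  kept_mean r l y = \int[P]_w r (kept l y w).
Proof.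
move=> r0; rewrite (integral_nat P (kept l y))// => n; exact: kept_meas.
Qed.

Lemma kept_mean_01 r l y : (forall x, 0 <= r x <= 1) -> 0 <= kept_mean r l y <= 1.
Proof.
move=> r01; rewrite /kept_mean nneseries_ge0; last first.
  by move=> x _ _; have /andP[h0 _] := r01 x; rewrite mule_ge0.
rewrite -(probability_setT P) (prob_fibers_nat P (V := kept l y))//; last first.
  by move=> n; exact: kept_meas.
apply: lee_nneseries => x _; first by have /andP[h0 _] := r01 x; rewrite mule_ge0.
by rewrite setTI -[leRHS]mule1 lee_wpmul2l//; have /andP[] := r01 x.
Qed.

Lemma kept_mean_le (r : nat -> \bar R) nu (C s : R) l : (0 <= C)%R -> (0 < s)%R ->
  (forall x, 0 <= r x <= (C * inv_pow s x)%:E) ->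
  nat_mean nu (kept_mean r l) <= C%:E * inv_moment D nu s l.
Proof.
move=> C0 s0 rb; rewrite inv_moment_mean// /nat_mean -nneseriesZl; last first.
  move=> y _; rewrite mule_ge0//; apply: integral_ge0 => w _.
  by rewrite lee_fin inv_pow_ge0.
have r0 x : 0 <= r x by have /andP[] := rb x.
apply: lee_nneseries => y _.
  by rewrite mule_ge0// kept_meanE//; apply: integral_ge0.
rewrite muleCA lee_wpmul2l// kept_meanE//.
have mk (f : nat -> \bar R) : measurable_fun setT (fun w => f (kept l y w)).
  by apply: measurable_discrete => x; exact: kept_meas.
rewrite -ge0_integralZl_EFin//; last 2 first.
- by move=> w _; rewrite lee_fin inv_pow_ge0.
- exact: (mk (fun x => (inv_pow s x)%:E)).
apply: ge0_le_integral => //.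
- exact: (mk (fun x => C%:E * (inv_pow s x)%:E)).
- by move=> w _; have /andP[_] := rb (kept l y w).
Qed.

(** Sum [path_split] over the position of the first minimum; [r 0 = 0] removes extinction and
    cemetery alike. *)
Lemma state_mean_split i n r : (forall x, 0 <= r x <= 1) -> r 0%N = 0 ->
  \sum_(x <oo) P (X D i n @^-1` [set x]) * r x =
  \sum_(k < n.+1) (min_end_prob D k)%:E * nat_mean (trapped_law D i k) (kept_mean r (n - k)).
Proof.
move=> r01 rz; have r0 x : 0 <= r x by have /andP[] := r01 x.
have mt k : measurable (tau D n @^-1` [set k]).
  by have := measurable_tau D n measurableT (Y := [set k]) I; rewrite setTI.
have term x : P (X D i n @^-1` [set x]) * r x =
    \sum_(k < n.+1) \sum_(y <oo) P (start_at i k y) *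
       (P (kept (n - k) y @^-1` [set x]) * r x).
  have [->|x0] := posnP x.
    rewrite rz mule0 big1// => k _; rewrite eseries0// => y _ _.
    by rewrite !mule0.
  have -> : P (X D i n @^-1` [set x]) =
      \sum_(k < n.+1) P (X D i n @^-1` [set x] `&` tau D n @^-1` [set (k : nat)]).
    rewrite (prob_fibers_nat P mt (X_meas D i n [set x])) (nneseries_split 0%N n.+1)//.
    rewrite add0n big_mkord [X in _ + X](_ : _ = 0) ?adde0//.
    rewrite eseries0// => k nk _; rewrite (_ : _ `&` _ = set0) ?measure0//.
    apply/seteqP; split=> // w [_ /= tk]; have [tn _ _] := tau_spec D n w.
    by move: nk; rewrite -tk ltnNge tn.
  rewrite ge0_sume_distrl//; apply: eq_bigr => k _.
  have kn : (k <= n)%N by rewrite -ltnS.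
  rewrite -{1 2}(subnKC kn) (path_split i k (n - k) x x0).
  have fx : r x \is a fin_num.
    by rewrite ge0_fin_numE//; have /andP[_ h1] := r01 x; exact: le_lt_trans h1 (ltry _).
  rewrite muleC -(fineK fx) -nneseriesZl; last by move=> y _; rewrite mule_ge0.
  by apply: eq_eseriesr => y _; rewrite muleC -muleA.
rewrite (eq_eseriesr (fun x _ => term x)) nneseries_sum; last first.
  by move=> k x _; apply: nneseries_ge0 => y _ _; rewrite !mule_ge0.
apply: eq_bigr => k _; rewrite nneseries_interchange; last first.
  by move=> x y; rewrite !mule_ge0.
rewrite /nat_mean -nneseriesZl; last first.
  by move=> y _; rewrite mule_ge0//; have /andP[] := kept_mean_01 r (n - k) y r01.
apply: eq_eseriesr => y _; rewrite muleA -start_at_trapped.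
rewrite -[P (start_at i k y)]fineK ?fin_num_measure ?nneseriesZl//.
  by move=> x _; rewrite mule_ge0.
exact: start_at_meas.
Qed.

End Decomposition.

Section PartTwo.
Context {d : measure_display} {T : measurableType d} {R : realType}.
Context {P : probability T R}.
Variable D : cbp P.
Variable i : nat.
Local Open Scope ereal_scope.

Lemma failure_rate_critical (Y : nat -> set (nat * nat * nat * nat)) (C q : R) :
  condC D i -> (0 <= C)%R -> (0 < q)%R ->
  (forall k, (0 < k)%N -> P (obs D 0 k @^-1` Y k) <= (C * k%:R `^ (- q))%:E) ->
  exists2 K : R, (0 <= K)%R &
    (fine (P (fail_event D i Y n)) / dminus D n)%R @[n --> \oo] --> K.
Proof.
move=> [SD [nu_lim [[tv _] [s0 [abar [s00 UIM LOC]]]]]] C0 q0 hY.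
(* (UIM) is available only up to [s0]; lowering the exponent from [q] to [s] weakens the failure
   bound, as [k >= 1]. *)
pose s := Num.min s0 q; have sp : (0 < s)%R by rewrite lt_min s00 q0.
have ss0 : (0 < s <= s0)%R by rewrite sp ge_min lexx.
have [abar_cvg abar_sup] := UIM s ss0.
have loc := LOC s ss0.
pose r (x : nat) : \bar R := if (0 < x)%N then P (obs D 0 x @^-1` Y x) else 0.
have r01 x : 0 <= r x <= 1.
  rewrite /r; case: ifP => _; last by rewrite lexx lee01.
  by rewrite measure_ge0 probability_le1//; exact: obs_meas.
have rb x : 0 <= r x <= (C * inv_pow s x)%:E.
  have /andP[-> _] := r01 x; rewrite /r /inv_pow; case: ifP => x0; last by rewrite mulr0 lexx.
  apply: le_trans (hY x x0) _; rewrite lee_fin ler_wpM2l// ler_powR ?ler1n//.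
  by rewrite lerN2 ge_min lexx orbT.
pose G l y := kept_mean D r l y.
have G01 l y : 0 <= G l y <= 1 by exact: kept_mean_01.
pose g k l : R := fine (nat_mean (trapped_law D i k) (G l)).
pose gl l : R := fine (nat_mean nu_lim (G l)).
have mean_fin nu l : nat_mean nu (G l) \is a fin_num by apply: nat_mean_fin.
have mean_bnd nu l : (range (trapped_law D i) `|` [set nu_lim]) nu ->
    (0 <= fine (nat_mean nu (G l)) <= C * abar s l)%R.
  move=> nuR; rewrite -!lee_fin fineK// nat_mean_ge0 /=; last first.
    by move=> y; have /andP[] := G01 l y.
  apply: le_trans (kept_mean_le D r nu C s l C0 sp rb) _.
  rewrite EFinM lee_wpmul2l//; apply: le_trans (abar_sup l).
  by apply: ereal_sup_ubound; exists nu.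
have abar_ge0 l : (0 <= abar s l)%R.
  rewrite -lee_fin; apply: le_trans (abar_sup l).
  apply: (@le_trans _ _ (inv_moment D nu_lim s l)); last first.
    by apply: ereal_sup_ubound; exists nu_lim => //; right.
  by apply: integral_ge0 => z _; rewrite lee_fin powR_ge0.
(* [G l] takes values in [0, 1], so total variation convergence of the trapped laws gives
   convergence of its means. *)
have g_cvg l : g k l @[k --> \oo] --> gl l.
  have [tvfin tv0] := (fine_cvgP _ _).1 tv.
  apply/cvgrPdist_le => e e0.
  near=> k; have kf : tv_dist (trapped_law D i k) nu_lim \is a fin_num by near: k; exact: tvfin.
  have ke : (`|0 - fine (tv_dist (trapped_law D i k) nu_lim)| <= e)%R.
    near: k; exact: (@cvgr_dist_le _ _ _ _ _ _ _ tv0 _ e0).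
  rewrite distrC -lee_fin; apply: (@le_trans _ _ (tv_dist (trapped_law D i k) nu_lim)).
    rewrite -abse_EFin EFinB !fineK//; exact: nat_mean_tv.
  rewrite -(fineK kf) lee_fin; apply: le_trans ke; rewrite sub0r normrN; exact: ler_norm.
have dd : min_end_prob D = dminus D by apply/funext => n; exact: min_end_prob_dminus.
rewrite -dd in loc *.
have [K K0 Kc] := tannery (min_end_prob D) g gl (abar s) C (min_end_prob_ge0 D)
  (min_end_prob_gt0 D SD) (min_end_prob_cvg1 D SD)
  (min_end_prob_dominated D SD) C0 (fun k l => mean_bnd _ l (or_introl (imageP _ I)))
  (fun l => mean_bnd _ l (or_intror erefl)) g_cvg abar_ge0 abar_cvg loc.
exists K => //; rewrite (_ : (fun n => _) =
  (fun n => (\sum_(0 <= k < n.+1) min_end_prob D k * g k (n - k)%N) / min_end_prob D n)%R)//.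
apply/funext => n; congr (_ / _)%R.
rewrite fail_event_prob (state_mean_split D i n r r01 erefl) big_mkord -sum_fine.
  by apply: eq_bigr => k _; rewrite fineM ?mean_fin.
by move=> k _; rewrite fin_numM ?mean_fin.
Unshelve. all: by end_near. Qed.

End PartTwo.

Theorem theorem2p5 (d : measure_display) (T : measurableType d) (R : realType)
    (P : probability T R) (D : cbp P) (i : nat) (p q K eps : R) :
  (0 < i)%N -> 2 <= p -> q = p / 2 -> moment_bounds D p q K -> 0 < eps ->
  (nondecreasing_bprei D -> condH D ->
     (limn_esup (fun n => (Rfail D i eps n / bsc D i q n)%:E) < +oo)%E) /\
  (critical_bprei D -> condC D i ->
     [/\ exists2 K1 : R, 0 <= K1 &
           Rfail1 D i eps n / dminus D n @[n --> \oo] --> K1,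
         exists2 K2 : R, 0 <= K2 &
           Rfail2 D i eps n / dminus D n @[n --> \oo] --> K2 &
         exists2 K3 : R, 0 <= K3 &
           Rfail3 D i eps n / dminus D n @[n --> \oo] --> K3]).
Proof.
move=> i0 p2 qp mb e0; have q0 : 0 < q by rewrite qp; lra.
split=> [nd [H1 H2 _ _ _]|_ hC].
  exact: (failure_rate_nondecreasing D i i0 nd H1 H2 p q K eps p2 qp mb e0).
have [C1 C10 h1] := bad1_bound D p q K p2 qp mb.
have [C2 C20 h2] := bad2_bound D p q K p2 qp mb.
have [C3 C30 h3] := bad3_bound D p q K p2 qp mb eps e0.
have epp : 0 <= eps `^ (- p) := powR_ge0 _ _.
split.
- apply: (failure_rate_critical D i (bad1 D eps) (C1 * eps `^ (- p)) q hC _ q0).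
    exact: mulr_ge0.
  by move=> k k0; exact: h1.
- apply: (failure_rate_critical D i (bad2 D eps) (C2 * eps `^ (- p)) q hC _ q0).
    exact: mulr_ge0.
  by move=> k k0; exact: h2.
- exact: (failure_rate_critical D i (bad3 D eps) C3 q hC C30 q0 h3).
Qed.
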